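(* Let $k_\pm\in\mathbb C(q)$ be nonzero, $\bar\rho=k_+k_-(q+q^{-1})^2$, $U=qu^2/(q+q^{-1})$, and for the generators of $\bar A_q$ put $\mathcal W_+(u)=\sum_{k\ge0}W_{-k}U^{-k-1}$, $\mathcal W_-(u)=\sum_{k\ge0}W_{k+1}U^{-k-1}$, $\mathcal G_+(u)=\sum_{k\ge0}G_{k+1}U^{-k-1}$, $\mathcal G_-(u)=\sum_{k\ge0}\tilde G_{k+1}U^{-k-1}$. There is an algebra isomorphism $\iota:\bar A_q\to U_q^{DJ,+}$ such that (coefficientwise in $u$), with $\mathcal X(u)=\exp\!\Big(-(q-q^{-1})\sum_{n\ge1}\frac{1}{q^n+q^{-n}}E_{n\delta}(qu^2)^{-n}\Big)$, $$\mathcal W_+(u)\mapsto-k_-q(q+q^{-1})\,\mathcal X(u)\sum_{k\ge0}q^kE_{k\delta+\alpha_1}(qu^2)^{-k-1},$$ $$\mathcal W_-(u)\mapsto k_+q^{-1}(q+q^{-1})\Big(\sum_{k\ge0}q^{k-1}E_{k\delta+\alpha_0}(qu^2)^{-k-1}\Big)\mathcal X(u),$$ $$\mathcal G_+(u)\mapsto\frac{\bar\rho}{q-q^{-1}}\big(\mathcal X(u)-1\big),$$ $$\mathcal G_-(u)\mapsto\frac{\bar\rho}{q-q^{-1}}\Big(\exp\!\Big((q-q^{-1})\sum_{n\ge1}\frac{q^{2n}}{q^n+q^{-n}}E_{n\delta}(qu^2)^{-n}\Big)-1\Big)-\bar\rho(q-q^{-1})\sum_{k,\ell\ge0}q^{k+\ell}E_{k\delta+\alpha_0}\,\mathcal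 X(u)\,E_{\ell\delta+\alpha_1}(qu^2)^{-k-\ell-1}.$$
   Context: $\mathbb N=\{0,1,2,\dots\}$; base field $\mathbb C(q)$; $[X,Y]=XY-YX$, $[X,Y]_q=qXY-q^{-1}YX$. $\bar A_q$ is the unital associative algebra with generators $W_{-k},W_{k+1},G_{k+1},\tilde G_{k+1}$ ($k\in\mathbb N$) and relations, for all $k,\ell\in\mathbb N$: $[W_0,W_{k+1}]=[W_{-k},W_1]=(\tilde G_{k+1}-G_{k+1})/(q+q^{-1})$; $[W_0,G_{k+1}]_q=[\tilde G_{k+1},W_0]_q=\bar\rho W_{-k-1}$; $[G_{k+1},W_1]_q=[W_1,\tilde G_{k+1}]_q=\bar\rho W_{k+2}$; $[W_{-k},W_{-\ell}]=0$; $[W_{k+1},W_{\ell+1}]=0$; $[W_{-k},W_{\ell+1}]+[W_{k+1},W_{-\ell}]=0$; $[W_{-k},G_{\ell+1}]+[G_{k+1},W_{-\ell}]=0$; $[W_{-k},\tilde G_{\ell+1}]+[\tilde G_{k+1},W_{-\ell}]=0$; $[W_{k+1},G_{\ell+1}]+[G_{k+1},W_{\ell+1}]=0$; $[W_{k+1},\tilde G_{\ell+1}]+[\tilde G_{k+1},W_{\ell+1}]=0$; $[G_{k+1},G_{\ell+1}]=0$; $[\tilde G_{k+1},\tilde G_{\ell+1}]=0$; $[\tilde G_{k+1},G_{\ell+1}]+[G_{k+1},\tilde G_{\ell+1}]=0$; and in addition $\Delta_{n+1}=0$ for all $n\in\mathbb N$, where $$\Delta_{n+1}=G_{n+1}+\tilde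 G_{n+1}-\frac{q^2-q^{-2}}{q^{n+1}+q^{-n-1}}\sum_{k=0}^nq^{-n+2k}(W_{-k}W_{n+1-k}+W_{k+1}W_{k-n})+\frac{q-q^{-1}}{\bar\rho(q^{n+1}+q^{-n-1})}\sum_{k=0}^{n-1}q^{-n+1+2k}(\tilde G_{k+1}G_{n-k}+G_{k+1}\tilde G_{n-k}).$$ $U_q^{DJ,+}$ is the subalgebra of the Drinfeld–Jimbo algebra $U_q(\widehat{sl_2})$ generated by $E_0,E_1$; its defining relations are the $q$-Serre relations $[E_i,[E_i,[E_i,E_j]_q]_{q^{-1}}]=0$ ($i\ne j$), where $[X,Y]_{q^{-1}}=q^{-1}XY-qYX$. (Damiani's) positive root vectors in $U_q^{DJ,+}$: $E_{\alpha_0}=E_0$, $E_{\alpha_1}=E_1$, $E_\delta=E_0E_1-q^{-2}E_1E_0$, and for $k\in\mathbb N$ $$E_{(k+1)\delta+\alpha_1}=\frac{[E_\delta,E_{k\delta+\alpha_1}]}{q+q^{-1}},\qquad E_{(k+1)\delta+\alpha_0}=\frac{[E_{k\delta+\alpha_0},E_\delta]}{q+q^{-1}};$$ the imaginary root vectors $E_{n\delta}$ ($n\ge1$), which commute with each other, are defined by $$\exp\Big((q-q^{-1})\sum_{k\ge1}E_{k\delta}z^k\Big)=1+(q-q^{-1})\sum_{k\ge1}\tilde\psi_kz^k,\qquad \tilde\psi_k=E_{(k-1)\delta+\alpha_0}E_{\alpha_1}-q^{-2}E_{\alpha_1}E_{(k-1)\delta+\alpha_0}.$$ *)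

(* Defs.v *)
From HB Require Import structures.
From mathcomp Require Import all_boot all_order all_algebra generic_quotient.
From mathcomp Require Import boolp reals complex finmap monalg.

Set Implicit Arguments.
Unset Strict Implicit.
Unset Printing Implicit Defensive.

Import GRing.Theory.
Local Open Scope ring_scope.
Local Open Scope quotient_scope.

Definition Cq (R : realType) : fieldType := {fraction {poly R[i]}}.
Definition qvar (R : realType) : Cq R := tofrac 'X.

Lemma qvar_sub_neq0 (R : realType) : qvar R - (qvar R)^-1 != 0.
Proof.
have q0 : qvar R != 0 by rewrite /qvar tofrac_eq0 polyX_eq0.
rewrite subr_eq0; apply/eqP => /(congr1 (fun x => x * qvar R)).
rewrite mulVf // /qvar -rmorphM -[RHS](rmorph1 (@tofrac _)) => /eqP.
rewrite tofrac_eq => /eqP /(congr1 (fun p : {poly R[i]} => size p)).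
by rewrite -expr2 size_polyXn size_poly1.
Qed.

(** * Algebras given by generators and relations *)

(* The free unital associative algebra on I: the algebra of the free monoid.  *)
Definition free_alg (K : fieldType) (I : choiceType) := {malg K[{fmonom I}]}.

HB.instance Definition _ (K : fieldType) (I : choiceType) :=
  GRing.Lalgebra.on (free_alg K I).

Fact free_alg_scalerAr (K : fieldType) (I : choiceType) (k : K)
  (x y : free_alg K I) : k *: (x * y) = x * (k *: y).
Proof.
suff mulrZ (g h : {malg K[{fmonom I}]}) : k *: (g * h) = g * (k *: h).
  exact: mulrZ.
apply/malgP => m; rewrite [LHS]mcoeffZ [in LHS]mcoeffMl.
rewrite [RHS](@mcoeffMlw _ _ (msupp g) (msupp h)) ?msuppZ_le // mulr_sumr.
apply: eq_bigr => k1 _; rewrite mulr_sumr; apply: eq_bigr => k2 _.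
by rewrite mcoeffZ mulrnAr mulrCA.
Qed.

HB.instance Definition _ (K : fieldType) (I : choiceType) :=
  GRing.Lalgebra_isAlgebra.Build K (free_alg K I) (@free_alg_scalerAr K I).

Definition free_gen (K : fieldType) (I : choiceType) : I -> free_alg K I :=
  locked (fun i => << fmu i >>).

Definition const_coef (K : fieldType) (I : choiceType) : free_alg K I -> K :=
  @mcoeff _ _ (@fmone I).

HB.instance Definition _ (K : fieldType) (I : choiceType) :=
  GRing.RMorphism.copy (@const_coef K I) (@mcoeff _ _ (@mone {fmonom I})).
HB.instance Definition _ (K : fieldType) (I : choiceType) :=
  GRing.isScalable.Build K (free_alg K I) K *%R (@const_coef K I)
    (fun c => (mcoeffZ c)^~ (@fmone I)).

Lemma const_coef_gen (K : fieldType) (I : choiceType) (i : I) :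
  const_coef (free_gen K i) = 0.
Proof. by rewrite /free_gen -lock /const_coef mcoeffU1 fm1_eq1. Qed.

Section Presentation.
Variables (K : fieldType) (I : choiceType).
Variable rel : free_alg K I -> free_alg K I -> Prop.

(* The two-sided ideal generated by the differences x - y, for rel x y.       *)
Inductive rel_ideal : free_alg K I -> Prop :=
| rel_ideal_base x y : rel x y -> rel_ideal (x - y)
| rel_ideal_zero : rel_ideal 0
| rel_ideal_add x y : rel_ideal x -> rel_ideal y -> rel_ideal (x + y)
| rel_ideal_mul a x b : rel_ideal x -> rel_ideal (a * x * b).

(* MathComp algebras satisfy 1 != 0, so a presented algebra needs an argument *)
(* that the ideal is proper; this one is enough for relations without         *)
(* constant terms.                                                            *)
Definition rel_augmented :=
  forall x y, rel x y -> const_coef x = const_coef y.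

Definition rel_equiv (x y : free_alg K I) : bool := `[< rel_ideal (x - y) >].

Lemma rel_idealN x : rel_ideal x -> rel_ideal (- x).
Proof. by move=> /(rel_ideal_mul (-1) 1); rewrite mulr1 mulN1r. Qed.

Fact rel_equiv_refl : reflexive rel_equiv.
Proof. by move=> x; apply/asboolP; rewrite subrr; apply: rel_ideal_zero. Qed.

Fact rel_equiv_sym : symmetric rel_equiv.
Proof.
by move=> x y; apply/asboolP/asboolP => /rel_idealN; rewrite opprB.
Qed.

Fact rel_equiv_trans : transitive rel_equiv.
Proof.
move=> y x z /asboolP xy /asboolP yz; apply/asboolP.
by have := rel_ideal_add xy yz; rewrite addrA subrK.
Qed.

Canonical rel_equiv_equiv :=
  EquivRel rel_equiv rel_equiv_refl rel_equiv_sym rel_equiv_trans.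

Definition presented of rel_augmented := {eq_quot rel_equiv}.

Variable aug : rel_augmented.
Local Notation Q := (presented aug).

HB.instance Definition _ := Choice.on Q.
HB.instance Definition _ := Quotient.on Q.

Definition presented_pi (x : free_alg K I) : Q := \pi_Q x.
Local Notation p := presented_pi.

Lemma presented_piP x y : p x = p y <-> rel_ideal (x - y).
Proof.
split; first by move=> /eqmodP /asboolP.
by move=> h; apply/eqmodP/asboolP.
Qed.

Lemma presented_reprK (a : Q) : p (repr a) = a.
Proof. exact: reprK. Qed.

Lemma presented_repr x : rel_ideal (repr (p x) - x).
Proof. by apply/presented_piP; rewrite presented_reprK. Qed.

Lemma presented_ind (P : Q -> Prop) : (forall x, P (p x)) -> forall a, P a.
Proof. by move=> h a; rewrite -(presented_reprK a). Qed.

Definition presented_zero : Q := p 0.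
Definition presented_one : Q := p 1.
(* Locked, so that failing unifications do not compute in the free algebra.   *)
Definition presented_opp : Q -> Q := locked (fun a => p (- repr a)).
Definition presented_add : Q -> Q -> Q :=
  locked (fun a b => p (repr a + repr b)).
Definition presented_mul : Q -> Q -> Q :=
  locked (fun a b => p (repr a * repr b)).
Definition presented_scale : K -> Q -> Q :=
  locked (fun k a => p (k *: repr a)).

Fact presented_oppE x : presented_opp (p x) = p (- x).
Proof.
rewrite /presented_opp -lock; apply/presented_piP; rewrite -opprD; apply/rel_idealN/presented_repr.
Qed.

Fact presented_addE x y : presented_add (p x) (p y) = p (x + y).
Proof.
rewrite /presented_add -lock; apply/presented_piP; rewrite opprD addrACA.
by apply: rel_ideal_add; apply: presented_repr.
Qed.

Fact presented_mulE x y : presented_mul (p x) (p y) = p (x * y).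
Proof.
rewrite /presented_mul -lock; apply/presented_piP.
have subM (A : pzRingType) (a b c d : A) :
    a * b - c * d = (a - c) * b + c * (b - d).
  by rewrite mulrBl mulrBr addrA subrK.
rewrite subM; apply: rel_ideal_add.
  by have := rel_ideal_mul 1 (repr (p y)) (presented_repr x); rewrite mul1r.
by have := rel_ideal_mul x 1 (presented_repr y); rewrite mulr1.
Qed.

Fact presented_scaleE k x : presented_scale k (p x) = p (k *: x).
Proof.
rewrite /presented_scale -lock; apply/presented_piP; rewrite -scalerBr.
have := rel_ideal_mul (k *: 1) 1 (presented_repr x).
by rewrite mulr1 -scalerAl mul1r.
Qed.

Local Notation pE := (presented_oppE, presented_addE, presented_mulE,
  presented_scaleE).

Fact presented_addA : associative presented_add.
Proof.
by do 3 elim/presented_ind => ?; rewrite !pE addrA.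
Qed.

Fact presented_addC : commutative presented_add.
Proof. by do 2 elim/presented_ind => ?; rewrite !pE addrC. Qed.

Fact presented_add0 : left_id presented_zero presented_add.
Proof. by elim/presented_ind => ?; rewrite !pE add0r. Qed.

Fact presented_addN : left_inverse presented_zero presented_opp presented_add.
Proof. by elim/presented_ind => ?; rewrite !pE addNr. Qed.

HB.instance Definition _ := GRing.isZmodule.Build Q
  presented_addA presented_addC presented_add0 presented_addN.

Fact presented_mulA : associative presented_mul.
Proof. by do 3 elim/presented_ind => ?; rewrite !pE mulrA. Qed.

Fact presented_mul1 : left_id presented_one presented_mul.
Proof. by elim/presented_ind => ?; rewrite !pE mul1r. Qed.

Fact presented_mulr1 : right_id presented_one presented_mul.
Proof. by elim/presented_ind => ?; rewrite !pE mulr1. Qed.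

Fact presented_mulDl : left_distributive presented_mul +%R.
Proof.
by do 3 elim/presented_ind => ?; rewrite /GRing.add /= !pE mulrDl.
Qed.

Fact presented_mulDr : right_distributive presented_mul +%R.
Proof.
by do 3 elim/presented_ind => ?; rewrite /GRing.add /= !pE mulrDr.
Qed.

Fact presented_one_neq0 : presented_one != 0.
Proof.
apply/eqP => /presented_piP; rewrite subr0 => h.
suff: const_coef (1 : free_alg K I) = 0.
  by rewrite rmorph1 => /eqP; rewrite oner_eq0.
elim: h => [x y /aug xy||x y _ x0 _ y0|a x b _ x0].
- by rewrite rmorphB /= xy subrr.
- exact: rmorph0.
- by rewrite rmorphD /= x0 y0 addr0.
- by rewrite !rmorphM /= x0 mulr0 mul0r.
Qed.

HB.instance Definition _ := GRing.Zmodule_isNzRing.Build Q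
  presented_mulA presented_mul1 presented_mulr1 presented_mulDl presented_mulDr
  presented_one_neq0.

Fact presented_scaleA k l a :
  presented_scale k (presented_scale l a) = presented_scale (k * l) a.
Proof. by elim/presented_ind: a => ?; rewrite !pE scalerA. Qed.

Fact presented_scale1 : left_id 1 presented_scale.
Proof. by elim/presented_ind => ?; rewrite !pE scale1r. Qed.

Fact presented_scaleDr : right_distributive presented_scale +%R.
Proof.
by move=> k; do 2 elim/presented_ind => ?;
   rewrite /GRing.add /= !pE scalerDr.
Qed.

Fact presented_scaleDl a : {morph presented_scale^~ a : k l / k + l}.
Proof.
by move=> k l; elim/presented_ind: a => ?; rewrite [RHS]/GRing.add /= !pE scalerDl.
Qed.

HB.instance Definition _ := GRing.Zmodule_isLmodule.Build K Q
  presented_scaleA presented_scale1 presented_scaleDr presented_scaleDl.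

Fact presented_scaleAl k (a b : Q) : k *: (a * b) = (k *: a) * b.
Proof.
elim/presented_ind: a => ?; elim/presented_ind: b => ?.
by rewrite /GRing.mul /GRing.scale /= !pE scalerAl.
Qed.

HB.instance Definition _ :=
  GRing.Lmodule_isLalgebra.Build K Q presented_scaleAl.

Fact presented_scaleAr k (a b : Q) : k *: (a * b) = a * (k *: b).
Proof.
elim/presented_ind: a => ?; elim/presented_ind: b => ?.
by rewrite /GRing.mul /GRing.scale /= !pE scalerAr.
Qed.

HB.instance Definition _ :=
  GRing.Lalgebra_isAlgebra.Build K Q presented_scaleAr.

Definition presented_gen (i : I) : Q := p (free_gen K i).

Fact presented_pi_linear : linear p.
Proof.
by move=> k x y; rewrite /GRing.add /GRing.scale /= !pE.
Qed.

Fact presented_pi_multiplicative : monoid_morphism p.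
Proof. by split=> [|x y]; [|exact: esym (presented_mulE x y)]. Qed.

HB.instance Definition _ :=
  GRing.isLinear.Build K (free_alg K I) Q _ p presented_pi_linear.
HB.instance Definition _ :=
  GRing.isMonoidMorphism.Build (free_alg K I) Q p presented_pi_multiplicative.

Lemma presented_rel x y : rel x y -> p x = p y.
Proof. by move=> xy; apply/presented_piP/rel_ideal_base. Qed.

End Presentation.

(** * The algebras $\bar A_q$ and $U_q^{DJ,+}$ *)

Section Commutators.
Variables (K : fieldType) (A : algType K).

Definition comm (x y : A) : A := x * y - y * x.
Definition qcomm (q : K) (x y : A) : A := q *: (x * y) - q^-1 *: (y * x).

End Commutators.

Section AltRelations.
Variables (K : fieldType) (q rho : K) (A : algType K).
(* G k and Gt k stand for G_{k+1} and \tilde G_{k+1}.                         *)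
Variables (W : int -> A) (G Gt : nat -> A).

(* \Delta_{n+1}                                                               *)
Definition alt_Delta (n : nat) : A :=
  G n + Gt n
  - ((q ^+ 2 - q ^- 2) / (q ^+ n.+1 + q ^- n.+1)) *:
      \sum_(k < n.+1) q ^ (- n%:Z + 2 * k%:Z) *:
        (W (- k%:Z) * W (n%:Z + 1 - k%:Z) + W (k%:Z + 1) * W (k%:Z - n%:Z))
  + ((q - q^-1) / (rho * (q ^+ n.+1 + q ^- n.+1))) *:
      \sum_(k < n) q ^ (- n%:Z + 1 + 2 * k%:Z) *:
        (Gt k * G (n - k.+1)%N + G k * Gt (n - k.+1)%N).

Inductive alt_rel : A -> A -> Prop :=
| alt_rel_W0W k : alt_rel (comm (W 0) (W (k%:Z + 1)))
    ((q + q^-1)^-1 *: (Gt k - G k))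
| alt_rel_WW1 k : alt_rel (comm (W (- k%:Z)) (W 1))
    ((q + q^-1)^-1 *: (Gt k - G k))
| alt_rel_W0G k : alt_rel (qcomm q (W 0) (G k)) (rho *: W (- k%:Z - 1))
| alt_rel_GtW0 k : alt_rel (qcomm q (Gt k) (W 0)) (rho *: W (- k%:Z - 1))
| alt_rel_GW1 k : alt_rel (qcomm q (G k) (W 1)) (rho *: W (k%:Z + 2))
| alt_rel_W1Gt k : alt_rel (qcomm q (W 1) (Gt k)) (rho *: W (k%:Z + 2))
| alt_rel_WmWm k l : alt_rel (comm (W (- k%:Z)) (W (- l%:Z))) 0
| alt_rel_WpWp k l : alt_rel (comm (W (k%:Z + 1)) (W (l%:Z + 1))) 0
| alt_rel_WmWp k l : alt_rel
    (comm (W (- k%:Z)) (W (l%:Z + 1)) + comm (W (k%:Z + 1)) (W (- l%:Z))) 0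
| alt_rel_WmG k l : alt_rel
    (comm (W (- k%:Z)) (G l) + comm (G k) (W (- l%:Z))) 0
| alt_rel_WmGt k l : alt_rel
    (comm (W (- k%:Z)) (Gt l) + comm (Gt k) (W (- l%:Z))) 0
| alt_rel_WpG k l : alt_rel
    (comm (W (k%:Z + 1)) (G l) + comm (G k) (W (l%:Z + 1))) 0
| alt_rel_WpGt k l : alt_rel
    (comm (W (k%:Z + 1)) (Gt l) + comm (Gt k) (W (l%:Z + 1))) 0
| alt_rel_GG k l : alt_rel (comm (G k) (G l)) 0
| alt_rel_GtGt k l : alt_rel (comm (Gt k) (Gt l)) 0
| alt_rel_GtG k l : alt_rel (comm (Gt k) (G l) + comm (G k) (Gt l)) 0
| alt_rel_Delta n : alt_rel (alt_Delta n) 0.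

Lemma alt_rel_augmented (c : {lrmorphism A -> K | *%R}) :
  (forall i, c (W i) = 0) -> (forall k, c (G k) = 0) ->
  (forall k, c (Gt k) = 0) -> forall x y, alt_rel x y -> c x = c y.
Proof.
have cZ a x : c (a *: x) = a * c x by exact: linearZ.
have cM x y : c (x * y) = c x * c y by exact: rmorphM.
have cB x y : c (x - y) = c x - c y by exact: raddfB.
have cD x y : c (x + y) = c x + c y by exact: raddfD.
have c0 : c 0 = 0 by exact: raddf0.
have cS n (F : 'I_n -> A) : c (\sum_i F i) = \sum_i c (F i).
  exact: raddf_sum.
move=> cW cG cGt; pose cE := (cZ, cM, cB, cD, c0, cW, cG, cGt, mulr0, subr0, addr0).
move=> x y []; last first.
  by move=> n; rewrite /alt_Delta !(cE, cS) !big1 ?cE // => i _; rewrite !cE.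
all: by move=> *; rewrite /comm /qcomm !cE.
Qed.

End AltRelations.

Section Alternating.
Variables (K : fieldType) (q rho : K).

(* Indices of the generators W_i (every integer i is either -k or k+1),        *)
(* G_{k+1} and \tilde G_{k+1}.                                                *)
Definition alt_index : choiceType := (int + (nat + nat))%type.
Local Notation F := (free_alg K alt_index).

Let fW (i : int) : F := free_gen K (inl i : alt_index).
Let fG (k : nat) : F := free_gen K (inr (inl k) : alt_index).
Let fGt (k : nat) : F := free_gen K (inr (inr k) : alt_index).

Definition Aq_rel : F -> F -> Prop := alt_rel q rho fW fG fGt.

Fact Aq_rel_augmented : rel_augmented Aq_rel.
Proof.
by apply: (@alt_rel_augmented _ _ _ _ _ _ _ (@const_coef K alt_index)) => k;
  exact: const_coef_gen.
Qed.

Definition Aq := presented Aq_rel_augmented.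

HB.instance Definition _ := GRing.Algebra.on Aq.

Definition AqW (i : int) : Aq := presented_gen Aq_rel_augmented (inl i).
Definition AqG (k : nat) : Aq := presented_gen Aq_rel_augmented (inr (inl k)).
Definition AqGt (k : nat) : Aq := presented_gen Aq_rel_augmented (inr (inr k)).

End Alternating.

Section SerreRelations.
Variables (K : fieldType) (q : K) (A : algType K) (E : 'I_2 -> A).

Inductive serre_rel : A -> A -> Prop :=
| serre_rel_intro (i j : 'I_2) : i != j ->
    serre_rel (comm (E i) (qcomm q^-1 (E i) (qcomm q (E i) (E j)))) 0.

Lemma serre_rel_augmented (c : {lrmorphism A -> K | *%R}) :
  (forall i, c (E i) = 0) -> forall x y, serre_rel x y -> c x = c y.
Proof.
have cM x y : c (x * y) = c x * c y by exact: rmorphM.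
have cB x y : c (x - y) = c x - c y by exact: raddfB.
move=> cE x y [i j _]; rewrite /comm cB !cM cE mul0r mulr0 subrr.
exact/esym/raddf0.
Qed.

End SerreRelations.

Section Uplus.
Variables (K : fieldType) (q : K).
Local Notation F := (free_alg K 'I_2).

Definition Uplus_rel : F -> F -> Prop := serre_rel q (@free_gen K 'I_2).

Fact Uplus_rel_augmented : rel_augmented Uplus_rel.
Proof.
by apply: (@serre_rel_augmented _ _ _ _ (@const_coef K 'I_2)) => i;
  exact: const_coef_gen.
Qed.

Definition Uplus := presented Uplus_rel_augmented.

HB.instance Definition _ := GRing.Algebra.on Uplus.

Definition UplusE (i : 'I_2) : Uplus := presented_gen Uplus_rel_augmented i.

End Uplus.

(** * Formal power series with coefficients in an algebra *)

Section Series.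
Variables (K : fieldType) (A : algType K).

(* The series \sum_n (f n) t^n, in a central variable t.                      *)
Definition series := nat -> A.
Implicit Types f g : series.

Definition ser_one : series := fun n => (n == 0)%:R.
Definition ser_mul f g : series := fun n => \sum_(i < n.+1) f i * g (n - i)%N.
Definition ser_exp_nat f (m : nat) : series := iter m (ser_mul f) ser_one.
Arguments ser_exp_nat : simpl never.

(* For f 0 = 0, the powers f^m with m > n do not contribute to the coefficient *)
(* of t^n in exp f = \sum_m f^m / m!; we only use this case.                   *)
Definition ser_exp f : series := fun n =>
  \sum_(m < n.+1) (m`!%:R^-1 : K) *: ser_exp_nat f m n.

(* \sum_k (a k) t^(k + 1)                                                     *)
Definition ser_shift (a : nat -> A) : series :=
  fun n => if n is k.+1 then a k else 0.

(* f at t/c, that is \sum_n (f n) c^-n t^n.                                   *)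
Definition ser_rescale (c : K) f : series := fun n => c ^- n *: f n.

Lemma ser_exp_natS f m : ser_exp_nat f m.+1 = ser_mul f (ser_exp_nat f m).
Proof. by []. Qed.

Lemma ser_exp_nat_lt f g n : f 0%N = 0 -> g 0%N = 0 ->
    (forall i, (i < n)%N -> f i = g i) ->
  forall m, m != 1%N -> ser_exp_nat f m n = ser_exp_nat g m n.
Proof.
move=> f0 g0 fg.
have lt m i : (i < n)%N -> ser_exp_nat f m i = ser_exp_nat g m i.
  elim: m i => // m IH i lin; rewrite !ser_exp_natS; apply: eq_bigr => j _.
  by rewrite fg ?IH //; [apply: leq_ltn_trans (leq_subr _ _) lin|
    apply: leq_ltn_trans lin; rewrite -ltnS].
have exp0 h m : h 0%N = 0 -> ser_exp_nat h m.+1 0%N = 0.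
  by move=> h0; rewrite ser_exp_natS /ser_mul big_ord1 h0 mul0r.
case=> [|[|m]] // _; rewrite (ser_exp_natS f m.+1) (ser_exp_natS g m.+1); apply: eq_bigr => -[j /= ltj] _.
case: j ltj => [|j] ltj; first by rewrite f0 g0 !mul0r.
have [ltjn|] := ltnP j.+1 n.
  by rewrite fg // lt //; case: (n) ltj ltjn => // n' _ _; rewrite ltnS subSS leq_subr.
rewrite -ltnS => lenj; have -> : j.+1 = n by apply/eqP; rewrite eqn_leq -ltnS ltj.
by rewrite subnn !exp0 // !mulr0.
Qed.

Lemma ser_exp_sub f g n : f 0%N = 0 -> g 0%N = 0 ->
    (forall i, (i < n.+1)%N -> f i = g i) ->
  ser_exp f n.+1 - f n.+1 = ser_exp g n.+1 - g n.+1.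
Proof.
move=> f0 g0 fg.
have one h : (1`!%:R^-1 : K) *: ser_exp_nat h 1 n.+1 = h n.+1.
  rewrite invr1 scale1r /ser_exp_nat /= /ser_mul big_ord_recr /= subnn.
  rewrite /ser_one eqxx mulr1 big1 ?add0r // => i _.
  by rewrite subn_eq0 leqNgt ltn_ord mulr0.
have [i1 i1E] : {i : 'I_n.+2 | i = 1%N :> nat} by exists (Ordinal (isT : 1 < n.+2)%N).
have expB h : ser_exp h n.+1 - h n.+1 =
    \sum_(m < n.+2 | m != i1) (m`!%:R^-1 : K) *: ser_exp_nat h m n.+1.
  by rewrite /ser_exp (bigD1 i1) // i1E one addrAC subrr add0r.
rewrite !expB; apply: eq_bigr => m mi1; congr (_ *: _).
by apply: ser_exp_nat_lt => //; rewrite -i1E.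
Qed.

End Series.

(** * Damiani's root vectors *)

Section RootVectors.
Variables (K : fieldType) (q : K) (A : algType K) (E0 E1 : A).

(* root_alpha1 k = E_{k delta + alpha_1}, root_alpha0 k = E_{k delta + alpha_0} *)
Definition root_delta : A := E0 * E1 - q ^- 2 *: (E1 * E0).

Fixpoint root_alpha1 (k : nat) : A :=
  if k is k'.+1 then (q + q^-1)^-1 *: comm root_delta (root_alpha1 k') else E1.

Fixpoint root_alpha0 (k : nat) : A :=
  if k is k'.+1 then (q + q^-1)^-1 *: comm (root_alpha0 k') root_delta else E0.

(* \tilde\psi_{k+1}                                                           *)
Definition root_psi (k : nat) : A :=
  root_alpha0 k * E1 - q ^- 2 *: (E1 * root_alpha0 k).

(* The equation that defines the imaginary root vectors; Ed k = E_{(k+1) delta} *)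
Definition imaginary_root_vectors (Ed : nat -> A) : Prop :=
  forall n : nat,
    ser_exp (ser_shift (fun k => (q - q^-1) *: Ed k)) n =
    ser_one A n + ser_shift (fun k => (q - q^-1) *: root_psi k) n.

Lemma ser_shift0 (a : nat -> A) : ser_shift a 0%N = 0.
Proof. by []. Qed.

Lemma imaginary_root_vectors_exists :
  q - q^-1 != 0 -> exists Ed, imaginary_root_vectors Ed.
Proof.
move=> q0; pose t := ser_shift (fun k => (q - q^-1) *: root_psi k).
pose step (f : series A) n : series A := fun i =>
  if i == n.+1 then t n.+1 - (ser_exp f n.+1 - f n.+1) else f i.
pose pre := fix pre n : series A := if n is n'.+1 then step (pre n') n' else (fun=> 0).
have preS n : pre n.+1 = step (pre n) n by [].
have pre0 n : pre n 0%N = 0 by elim: n.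
have preE n i d : (i <= n)%N -> pre (n + d)%N i = pre n i.
  move=> le_in; elim: d => [|d IH]; first by rewrite addn0.
  rewrite addnS preS /step ifF //; apply/eqP => ie.
  by move: le_in; rewrite ie leqNgt ltnS leq_addr.
pose b n := pre n n.
have preb n i : (i <= n)%N -> pre n i = b i.
  by move=> le_in; rewrite -(subnKC le_in) preE.
exists (fun k => (q - q^-1)^-1 *: b k.+1) => n.
set f := ser_shift _.
have fb i : f i = b i by case: i => [|i] //=; rewrite scalerA divff // scale1r.
case: n => [|n].
  rewrite /ser_exp big_ord1 invr1 scale1r /ser_exp_nat /= /ser_one.
  by rewrite addr0.
rewrite /ser_one add0r -/(t n.+1).
have agree i : (i < n.+1)%N -> f i = pre n i by move=> le_in; rewrite fb preb.
rewrite -(subrK (f n.+1) (ser_exp f _)) (ser_exp_sub erefl (pre0 n) agree).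
by rewrite fb /b preS /step eqxx addrC subrK.
Qed.

Lemma imaginary_root_vectors_unique (Ed Ed' : nat -> A) :
  q - q^-1 != 0 -> imaginary_root_vectors Ed -> imaginary_root_vectors Ed' ->
  Ed =1 Ed'.
Proof.
move=> q0 Eh Eh'.
suff H n i : (i < n.+1)%N -> ser_shift (fun k => (q - q^-1) *: Ed k) i =
    ser_shift (fun k => (q - q^-1) *: Ed' k) i.
  by move=> k; apply: (scalerI q0); apply: (H k.+1 k.+1).
elim: n i => [|n IH] i; first by rewrite ltnS leqn0 => /eqP ->.
rewrite ltnS leq_eqVlt => /orP[/eqP -> |]; last exact: IH.
have := ser_exp_sub erefl erefl IH; rewrite Eh Eh' => /addrI /oppr_inj.
exact.
Qed.

End RootVectors.

(* Main.v *)
Require Import Defs.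
From HB Require Import structures.
From mathcomp Require Import all_boot all_order all_algebra.
From mathcomp Require Import reals.
From mathcomp Require Import boolp complex finmap monalg ring zify.

Set Implicit Arguments.
Unset Strict Implicit.
Unset Printing Implicit Defensive.

Import GRing.Theory.
Local Open Scope ring_scope.

(** Everything reduces to relations between the root vectors x_k of weight
    k delta + alpha_1 and y_k of weight k delta + alpha_0 that follow from the
    q-Serre relations.  Since E_delta acts on the x_k and on the y_k as a shift,
    it remains to know that the elements phi_{k,l} = y_k x_l - q^-2 x_l y_k only
    depend on k + l.  This goes by induction on k + l: moving y_0 through the
    quadratic relations of the x_k gives the exchange relation of the psi_r with
    the x_k, hence a three-term recursion for the commutators [psi_r, psi_s] with
    r + s fixed, whose solution is [2r]/[2] times [psi_1, psi_{r+s-1}]; the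
    antisymmetry of the commutator then forces it to vanish.

    The series X = exp(-(q - q^-1) sum_n E_{n delta} t^n / (q^n + q^-n)) is
    determined by X(qt) X(t/q) psi(t) = 1, so that its exchange relation with
    the x_k is a square root of that of psi.  The images of the alternating
    generators are the coefficients of a = X x(qt), b = y(qt) X, X and
    g = Y - (q - q^-1)^2 t b x(qt), with Y = X(q^2 t)^-1, and all the defining
    relations are consequences of the exchange relations.  Conversely W_0 and W_1
    satisfy the q-Serre relations and generate the alternating algebra, which
    provides the inverse map. *)

(** * Identities in noncommutative algebras *)

(** Neither algebra is given a basis: bijectivity comes from two composites that fix generators, and
    the rest is identities between series. The commutators of the E_{n delta} with the real root
    vectors are never computed. It is psi, quadratic in real root vectors, whose exchange relation
    the Serre relations give, with factor (s - q^-2 t)/(s - q^2 t) at x(s). A series with factor (s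
    - qt)/(s - t/q), dilated by q and by q^-1 and multiplied, has the inverse factor; this suggests
    X(qt) X(t/q) psi(t) = 1 and explains the denominators q^n + q^-n. The obstacle on the other side
    is the number of alternating relations with two free indices. Those with one index 0 and those
    that involve X are read off from the series; the others, such as [a_m, a_n] = 0, follow from
    these by shifting indices. *)

Section NcReflection.
Variables (K : fieldType) (A : algType K).

Inductive ncexp :=
| NcVar of nat | NcZero | NcOne | NcAdd of ncexp & ncexp | NcOpp of ncexp
| NcMul of ncexp & ncexp | NcScale of K & ncexp.

Fixpoint nceval (env : seq A) (e : ncexp) : A :=
  match e with
  | NcVar i => nth 0 env i
  | NcZero => 0
  | NcOne => 1
  | NcAdd e1 e2 => nceval env e1 + nceval env e2
  | NcOpp e1 => - nceval env e1
  | NcMul e1 e2 => nceval env e1 * nceval env e2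
  | NcScale c e1 => c *: nceval env e1
  end.

Definition ncpoly := seq (K * seq nat).

(** The normalizer uses its own fixpoints for comparison and concatenation, so that [nc_coefs] can
    unfold exactly these by [cbv] and leave the scalars of [K] untouched. *)
Fixpoint nc_eqn (m n : nat) : bool :=
  match m, n with
  | 0%N, 0%N => true | m'.+1, n'.+1 => nc_eqn m' n' | _, _ => false
  end.

Fixpoint nc_eqw (v w : seq nat) : bool :=
  match v, w with
  | [::], [::] => true
  | i :: v', j :: w' => if nc_eqn i j then nc_eqw v' w' else false
  | _, _ => false
  end.

Fixpoint nc_app (T : Type) (s t : seq T) : seq T :=
  if s is x :: s' then x :: nc_app s' t else t.

Fixpoint nc_scale (c : K) (p : ncpoly) : ncpoly :=
  if p is (d, w) :: p' then (c * d, w) :: nc_scale c p' else [::].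

Fixpoint nc_mul1 (c : K) (v : seq nat) (p : ncpoly) : ncpoly :=
  if p is (d, w) :: p' then (c * d, nc_app v w) :: nc_mul1 c v p' else [::].

Fixpoint nc_mul (p r : ncpoly) : ncpoly :=
  if p is (c, v) :: p' then nc_app (nc_mul1 c v r) (nc_mul p' r) else [::].

Fixpoint ncnorm (e : ncexp) : ncpoly :=
  match e with
  | NcVar i => [:: (1, [:: i])]
  | NcZero => [::]
  | NcOne => [:: (1, [::])]
  | NcAdd e1 e2 => nc_app (ncnorm e1) (ncnorm e2)
  | NcOpp e1 => nc_scale (-1) (ncnorm e1)
  | NcMul e1 e2 => nc_mul (ncnorm e1) (ncnorm e2)
  | NcScale c e1 => nc_scale c (ncnorm e1)
  end.

Fixpoint nc_insert (c : K) (w : seq nat) (p : ncpoly) : ncpoly :=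
  if p is (d, v) :: p' then
    if nc_eqw w v then (c + d, v) :: p' else (d, v) :: nc_insert c w p'
  else [:: (c, w)].

Fixpoint nc_collect (p : ncpoly) : ncpoly :=
  if p is (c, w) :: p' then nc_insert c w (nc_collect p') else [::].

(** A proposition and not a test: zero in [K] is left to [ring] and [field]. The singleton case
    avoids a trailing [True]. *)
Fixpoint nc_null (p : ncpoly) : Prop :=
  match p with
  | [::] => True
  | [:: (c, _)] => c = 0
  | (c, _) :: p' => c = 0 /\ nc_null p'
  end.

Section Soundness.
Variable env : seq A.

Fixpoint nc_word (w : seq nat) : A :=
  if w is i :: w' then nth 0 env i * nc_word w' else 1.

Fixpoint nc_value (p : ncpoly) : A :=
  if p is (c, w) :: p' then c *: nc_word w + nc_value p' else 0.

Lemma nc_word_app v w : nc_word (nc_app v w) = nc_word v * nc_word w.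
Proof. by elim: v => [|i v IH] /=; rewrite ?mul1r // IH mulrA. Qed.

Lemma nc_value_app p r : nc_value (nc_app p r) = nc_value p + nc_value r.
Proof. by elim: p => [|[c w] p IH] /=; rewrite ?add0r // IH addrA. Qed.

Lemma nc_value_scale c p : nc_value (nc_scale c p) = c *: nc_value p.
Proof.
by elim: p => [|[d w] p IH] /=; rewrite ?scaler0 // IH scalerDr scalerA.
Qed.

Lemma nc_value_mul1 c v p :
  nc_value (nc_mul1 c v p) = c *: nc_word v * nc_value p.
Proof.
elim: p => [|[d w] p IH] /=; first by rewrite mulr0.
by rewrite IH nc_word_app mulrDr -!scalerAl -scalerAr scalerA.
Qed.

Lemma nc_value_mul p r : nc_value (nc_mul p r) = nc_value p * nc_value r.
Proof.
elim: p => [|[c v] p IH] /=; first by rewrite mul0r.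
by rewrite nc_value_app nc_value_mul1 IH mulrDl.
Qed.

Lemma nc_eqwP v w : nc_eqw v w -> v = w.
Proof.
elim: v w => [|i v IH] [|j w] //=.
case: ifP => // ij /IH ->; congr (_ :: _).
by elim: i j ij => [|i IHi] [|j] //= /IHi ->.
Qed.

Lemma nc_value_insert c w p :
  nc_value (nc_insert c w p) = c *: nc_word w + nc_value p.
Proof.
elim: p => [|[d v] p IH] //=; case: ifP => [/nc_eqwP -> | _] /=.
  by rewrite scalerDl addrA.
by rewrite IH addrCA.
Qed.

Lemma nc_value_collect p : nc_value (nc_collect p) = nc_value p.
Proof. by elim: p => [|[c w] p IH] //=; rewrite nc_value_insert IH. Qed.

Lemma nc_value_null p : nc_null p -> nc_value p = 0.
Proof.
elim: p => [|[c w] p IH] //=; case: p IH => [_ ->|x p IH [-> /IH ->]] /=;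
  by rewrite scale0r addr0.
Qed.

Lemma ncnormP e : nc_value (ncnorm e) = nceval env e.
Proof.
elim: e => [i|||e1 IH1 e2 IH2|e IH|e1 IH1 e2 IH2|c e IH] //=.
- by rewrite mulr1 scale1r addr0.
- by rewrite scale1r addr0.
- by rewrite nc_value_app IH1 IH2.
- by rewrite nc_value_scale IH scaleN1r.
- by rewrite nc_value_mul IH1 IH2.
- by rewrite nc_value_scale IH.
Qed.

Lemma nc_eq e1 e2 : nc_null (nc_collect (ncnorm (NcAdd e1 (NcOpp e2)))) ->
  nceval env e1 = nceval env e2.
Proof.
by move=> /nc_value_null; rewrite nc_value_collect ncnormP => /subr0_eq.
Qed.

End Soundness.
End NcReflection.

Ltac nc_mem a l :=
  match l with
  | nil => constr:(false)
  | a :: _ => constr:(true)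
  | _ :: ?l' => nc_mem a l'
  end.
Ltac nc_atoms T l e :=
  match e with
  | GRing.add ?a ?b => let l1 := nc_atoms T l a in nc_atoms T l1 b
  | GRing.mul ?a ?b => let l1 := nc_atoms T l a in nc_atoms T l1 b
  | GRing.opp ?a => nc_atoms T l a
  | GRing.scale _ ?a => nc_atoms T l a
  | GRing.zero => l
  | GRing.one _ => l
  | _ => match nc_mem e l with true => l | false => constr:(@cons T e l) end
  end.
Ltac nc_index a l :=
  match l with
  | a :: _ => constr:(0%N)
  | _ :: ?l' => let n := nc_index a l' in constr:(S n)
  end.
Ltac nc_reify K l e :=
  match e with
  | GRing.add ?a ?b =>
      let a' := nc_reify K l a in let b' := nc_reify K l b in
      constr:(@NcAdd K a' b')
  | GRing.mul ?a ?b =>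
      let a' := nc_reify K l a in let b' := nc_reify K l b in
      constr:(@NcMul K a' b')
  | GRing.opp ?a => let a' := nc_reify K l a in constr:(@NcOpp K a')
  | GRing.scale ?c ?a => let a' := nc_reify K l a in constr:(@NcScale K c a')
  | GRing.zero => constr:(@NcZero K)
  | GRing.one _ => constr:(@NcOne K)
  | _ => let n := nc_index e l in constr:(@NcVar K n)
  end.

(** Certificate pattern: [s] is an explicit combination of known relations, zero by rewriting;
    [x - y = s] is then an identity of noncommutative polynomials, left to [nc_coefs]. *)
Lemma nc_lin (V : zmodType) (x y s : V) : s = 0 -> x - y = s -> x = y.
Proof. by move=> -> /subr0_eq. Qed.

Lemma nc_from (V : zmodType) (a b x y : V) : a = b -> x - y = a - b -> x = y.
Proof. by move=> -> ; rewrite subrr => /subr0_eq. Qed.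

(* Reduces an equation in an algebra to the equations in the ground field that *)
(* compare the coefficients of the noncommutative monomials.                   *)
Ltac nc_coefs K :=
  match goal with
  | |- @eq ?T ?x ?y =>
      let l0 := constr:(@nil T) in
      let l1 := nc_atoms T l0 x in let l := nc_atoms T l1 y in
      let x' := nc_reify K l x in let y' := nc_reify K l y in
      refine (@nc_eq K _ l x' y' _);
      cbv [nc_null nc_collect ncnorm nc_insert nc_eqw nc_eqn nc_mul nc_mul1
           nc_scale nc_app];
      repeat match goal with |- _ /\ _ => split end
  end.

(* The q-Serre relations are invariant under exchanging the two generators and *)
(* reversing products, so statements about the y_k are obtained from those     *)
(* about the x_k in the converse algebra.                                      *)
Section ConverseAlgebra.
Variables (K : fieldType) (A : algType K).

HB.instance Definition _ :=
  GRing.Zmodule_isLmodule.Build K A^c (@scalerA K A) (@scale1r K A)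
    (@scalerDr K A) (@scalerDl K A).

Fact converse_scaleAl (k : K) (a b : A^c) : k *: (a * b) = (k *: a) * b.
Proof. exact: (@scalerAr K A k b a). Qed.
HB.instance Definition _ :=
  GRing.Lmodule_isLalgebra.Build K A^c converse_scaleAl.

Fact converse_scaleAr (k : K) (a b : A^c) : k *: (a * b) = a * (k *: b).
Proof. exact: (@scalerAl K A k b a). Qed.
HB.instance Definition _ :=
  GRing.Lalgebra_isAlgebra.Build K A^c converse_scaleAr.

End ConverseAlgebra.

(** * Relations between the real root vectors *)

Section DrinfeldRelations.
Variables (K : fieldType) (q : K).
Hypotheses (q0 : q != 0) (qnu : forall n, (0 < n)%N -> q ^+ n != 1).
Hypothesis charK : [pchar K] =i pred0.

Lemma qpow_sub_neq0 n : (0 < n)%N -> q ^+ n - q ^- n != 0.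
Proof.
move=> n0; have qn0 : q ^+ n != 0 by rewrite expf_neq0.
apply: contraNneq (qnu (_ : 0 < n + n)%N) => [|]; last by rewrite addn_gt0 n0.
by move=> /subr0_eq e; rewrite exprD {1}e mulVf.
Qed.

Lemma qpow_add_neq0 n : (0 < n)%N -> q ^+ n + q ^- n != 0.
Proof.
move=> n0; have qn0 : q ^+ n != 0 by rewrite expf_neq0.
apply: contraNneq (qpow_sub_neq0 (_ : 0 < n + n)%N) => [e|]; last first.
  by rewrite addn_gt0 n0.
rewrite exprD (_ : _ - _ = (q ^+ n + q ^- n) * (q ^+ n - q ^- n)).
  by rewrite e mul0r.
by field.
Qed.

Let kap0 : q - q^-1 != 0.
Proof. by have := @qpow_sub_neq0 1 isT; rewrite expr1. Qed.
Let two0 : q + q^-1 != 0.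
Proof. by have := @qpow_add_neq0 1 isT; rewrite expr1. Qed.
Let kap2 : q ^+ 2 - q ^- 2 != 0.
Proof. exact: qpow_sub_neq0. Qed.
Let kap4 : q ^+ 4 - q ^- 4 != 0.
Proof. exact: qpow_sub_neq0. Qed.

Section Relations.
Variables (A : algType K).
Implicit Types (x y p : nat -> A) (k l n r : nat).

(** Drinfeld's quadratic relation x_{k+1} x_l - q^2 x_l x_{k+1} = q^2 x_k x_{l+1} - x_{l+1} x_k,
    with all terms on one side. *)
Definition xx_rel x k l : A :=
  x k.+1 * x l - q ^+ 2 *: (x l * x k.+1)
  + (x l.+1 * x k - q ^+ 2 *: (x k * x l.+1)).

Definition h0 x y := y 0%N * x 0%N - q ^- 2 *: (x 0%N * y 0%N).
(** The last two equations encode the two q-Serre relations, see [serre_root_system]. Arbitrary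
    sequences are allowed so that the converse algebra with [x] and [y] exchanged satisfies the same
    predicate. *)
Definition root_system x y :=
  let h := h0 x y in
  [/\ forall k, h * x k - x k * h = (q + q^-1) *: x k.+1,
      forall k, y k * h - h * y k = (q + q^-1) *: y k.+1,
      x 1%N * x 0%N - q ^+ 2 *: (x 0%N * x 1%N) = 0
    & y 0%N * y 1%N - q ^+ 2 *: (y 1%N * y 0%N) = 0].

Definition phi x y k l : A := (q - q^-1) *: (y k * x l - q ^- 2 *: (x l * y k)).

(* psi x y n is (q - q^-1) \tilde\psi_n for n > 0, and 1 for n = 0; phiL is the *)
(* same family computed from y_0 instead of x_0.                               *)
Definition phiL x y n : A := if n is k.+1 then phi x y 0 k else 1.
Definition psi x y n : A := if n is k.+1 then phi x y k 0 else 1.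

Lemma psi0 x y : psi x y 0 = 1. Proof. by []. Qed.

(** [p] is a parameter because [xx_px] yields the relation for [phiL], which agrees with [psi] only
    in the degrees where homogeneity is already known. *)
Definition px_rel p x r k : A :=
  p r.+1 * x k - q ^+ 2 *: (p r * x k.+1)
  - (x k * p r.+1 - q ^- 2 *: (x k.+1 * p r)).

(** Leibniz rule: commuting with E_delta raises [l] through x_l and [k], with opposite sign, through
    y_k. So the commutator with psi_1 measures how far phi_{k,l} is from depending on k + l only. *)
Lemma phi_ad x y k l : root_system x y ->
  phi x y 0 0 * phi x y k l - phi x y k l * phi x y 0 0 =
  ((q - q^-1) * (q + q^-1)) *: (phi x y k l.+1 - phi x y k.+1 l).
Proof.
case=> hx hy _ _.
apply: (@nc_lin _ _ _ (((q - q^-1) ^+ 2) *: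
  (y k * (h0 x y * x l - x l * h0 x y - (q + q^-1) *: x l.+1)
   - (y k * h0 x y - h0 x y * y k - (q + q^-1) *: y k.+1) * x l
   - q ^- 2 *: ((h0 x y * x l - x l * h0 x y - (q + q^-1) *: x l.+1) * y k
   - x l * (y k * h0 x y - h0 x y * y k - (q + q^-1) *: y k.+1))))).
  by rewrite hx hy !subrr !(mul0r, mulr0) !subrr scaler0 subr0 scaler0.
by rewrite /phi /h0; nc_coefs K; field.
Qed.

(* Apply the skew derivation z |-> y_0 z - q^-2deg(z) z y_0, which maps x_k to   *)
(* phi_{0,k}, to the quadratic relation.                                       *)
Lemma xx_px x y k l : xx_rel x k l = 0 ->
  px_rel (phiL x y) x k.+1 l + px_rel (phiL x y) x l.+1 k = 0.
Proof.
move=> e; apply: (@nc_lin _ _ _ ((q - q^-1) *: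
   (y 0%N * xx_rel x k l - q ^- 4 *: (xx_rel x k l * y 0%N)))).
  by rewrite e mulr0 mul0r scaler0 subr0 scaler0.
by rewrite /px_rel /= /phi /xx_rel; nc_coefs K; field.
Qed.

Definition py_rel p y r k : A :=
  y k * p r.+1 - q ^+ 2 *: (y k.+1 * p r)
  - (p r.+1 * y k - q ^- 2 *: (p r * y k.+1)).

Definition homogeneous_upto x y n := forall k l k' l',
  (k + l = k' + l')%N -> (k + l < n)%N -> phi x y k l = phi x y k' l'.

(** The induction hypothesis. Homogeneity in degrees below [n] concerns psi_1, ..., psi_n, while the
    exchange relations stop at psi_{n-1}. *)
Definition drinfeld_upto x y n :=
  [/\ homogeneous_upto x y n,
      forall r k, (r.+1 < n)%N -> px_rel (psi x y) x r k = 0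
    & forall r k, (r.+1 < n)%N -> py_rel (psi x y) y r k = 0].

Lemma phi_psi x y n k l : homogeneous_upto x y n -> (k + l < n)%N ->
  phi x y k l = psi x y (k + l).+1.
Proof. by move=> hom kl; apply: hom; rewrite ?addn0. Qed.

Lemma phiL_psi x y n r : homogeneous_upto x y n -> (r <= n)%N ->
  phiL x y r = psi x y r.
Proof. by case: r => // r hom rn; exact: (phi_psi (k := 0) hom). Qed.

(** The exchange factors of psi with x and with y are inverse, so psi(t) passes y(s) x(s') up to a
    ratio of products of two linear factors; clearing denominators leaves three terms on each
    side. *)
Lemma psi_phi x y r k l : let p := psi x y in
  px_rel p x r.+1 l = 0 -> px_rel p x r l = 0 ->
  py_rel p y r.+1 k = 0 -> py_rel p y r k = 0 ->
  p r.+2 * phi x y k l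
  - p r.+1 * (q ^- 2 *: phi x y k.+1 l + q ^+ 2 *: phi x y k l.+1)
  + p r * phi x y k.+1 l.+1 =
  phi x y k l * p r.+2
  - (q ^+ 2 *: phi x y k.+1 l + q ^- 2 *: phi x y k l.+1) * p r.+1
  + phi x y k.+1 l.+1 * p r.
Proof.
move=> p; set X1 := px_rel p x r.+1 l; set X0 := px_rel p x r l.
set Y1 := py_rel p y r.+1 k; set Y0 := py_rel p y r k => eX1 eX0 eY1 eY0.
apply: (@nc_lin _ _ _ ((q - q^-1) *:
   (y k * X1 - q ^+ 2 *: (y k.+1 * X0) + q ^+ 2 *: (Y0 * x l.+1) - Y1 * x l
    - q ^- 2 *: (X1 * y k - q ^- 2 *: (X0 * y k.+1) - x l * Y1
                 + q ^- 2 *: (x l.+1 * Y0))))).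
  rewrite eX1 eX0 eY1 eY0 !(mulr0, mul0r, scaler0, subr0, addr0); done.
by rewrite /X1 /X0 /Y1 /Y0 /px_rel /py_rel /phi; nc_coefs K; field.
Qed.

Let c x y r s := psi x y r * psi x y s - psi x y s * psi x y r.

Lemma psi_comm_rec x y n r s : drinfeld_upto x y n ->
  px_rel (psi x y) x n.-1 0 = 0 -> py_rel (psi x y) y n.-1 0 = 0 ->
  (r.+2 + s.+1 = n.+1)%N ->
  c x y r.+2 s.+1 = (q ^+ 2 + q ^- 2) *: c x y r.+1 s.+2 - c x y r s.+3.
Proof.
move=> [hom qx qy] qxn qyn rs.
have X1 : px_rel (psi x y) x r.+1 s = 0.
  by have [e|?] := eqVneq r.+2 n; [rewrite -e in qxn; case: s rs => // ?; lia|apply: qx; lia].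
have X0 : px_rel (psi x y) x r s = 0 by apply: qx; lia.
have Y1 : py_rel (psi x y) y r.+1 0 = 0.
  by have [e|?] := eqVneq r.+2 n; [rewrite -e in qyn|apply: qy; lia].
have Y0 : py_rel (psi x y) y r 0 = 0 by apply: qy; lia.
have := psi_phi X1 X0 Y1 Y0.
rewrite (phi_psi (k := 0) (l := s) hom) ?(phi_psi (l := s.+1) (k := 0) hom);
  rewrite ?(phi_psi (k := 1) (l := s) hom) ?add0n ?add1n //; try lia.
(* For r = 0 the factor phi_{1,s+1} has degree n, where homogeneity is not yet known; it only occurs
   next to psi_0 = 1 and cancels. *)
case: r {X1 X0 Y1 Y0} rs => [|r] rs e.
  by apply: (nc_from e); rewrite /c !mul1r !mulr1; nc_coefs K; field.
move: e; rewrite (phi_psi hom) ?add1n; last lia.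
by move=> e; apply: (nc_from e); rewrite /c; nc_coefs K; field.
Qed.

Lemma psi_comm_scaled x y n r : drinfeld_upto x y n ->
  px_rel (psi x y) x n.-1 0 = 0 -> py_rel (psi x y) y n.-1 0 = 0 ->
  (r < n)%N ->
  (q ^+ 2 - q ^- 2) *: c x y r.+1 (n - r) =
  (q ^+ r.+1.*2 - q ^- r.+1.*2) *: c x y 1 n.
Proof.
move=> dr qx qy rn.
pose P r := (r <= n)%N -> (q ^+ 2 - q ^- 2) *: c x y r (n.+1 - r) =
  (q ^+ r.*2 - q ^- r.*2) *: c x y 1 n.
suff H r' : P r' /\ P r'.+1 by have [_ /(_ rn)] := H r; rewrite subSS.
elim: r' => [|r' [IH0 IH1]].
  split; rewrite /P => _; first by rewrite /c /= !mul1r !mulr1 double0 expr0 invr1 !subrr scaler0 scale0r.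
  by rewrite subSS subn0.
split=> // r2n.
have := @psi_comm_rec x y n r' (n - r'.+2) dr qx qy.
rewrite (_ : (n - r'.+2).+1 = n.+1 - r'.+2)%N; last lia.
rewrite (_ : (n.+1 - r'.+2).+1 = n.+1 - r'.+1)%N; last lia.
rewrite (_ : (n.+1 - r'.+1).+1 = n.+1 - r')%N; last lia.
move=> -> //; last lia.
rewrite scalerBr scalerA mulrC -scalerA IH0 ?IH1; try lia.
rewrite scalerA -scalerBl; congr (_ *: _).
by rewrite !doubleS !exprS; field; rewrite q0 expf_neq0.
Qed.

Lemma psi_comm1 x y n : drinfeld_upto x y n.+2 ->
  px_rel (psi x y) x n.+1 0 = 0 -> py_rel (psi x y) y n.+1 0 = 0 ->
  c x y 1 n.+2 = 0.
Proof.
move=> dr qx qy; have := @psi_comm_scaled x y n.+2 n.+1 dr qx qy (ltnSn _).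
rewrite subSnn (_ : c x y n.+2 1 = - c x y 1 n.+2); last by rewrite /c opprB.
rewrite scalerN => /eqP; rewrite eq_sym -subr_eq0 opprK -scalerDl scaler_eq0.
case/orP => [/eqP e|/eqP //].
(* Antisymmetry gives the commutator the coefficient q^(2n+4) - q^(-2n-4) + q^2 - q^-2, which
   factors as (q^(n+3) - q^(-n-3)) (q^(n+1) + q^(-n-1)). *)
have := mulf_neq0 (@qpow_sub_neq0 n.+3 isT) (@qpow_add_neq0 n.+1 isT).
rewrite (_ : _ * _ = q ^+ n.+2.*2 - q ^- n.+2.*2 + (q ^+ 2 - q ^- 2)).
  by rewrite e eqxx.
rewrite !doubleS -addnn !exprS exprD; field.
by rewrite expf_neq0 ?q0.
Qed.

Lemma psi1_x x y k : root_system x y ->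
  psi x y 1 * x k - x k * psi x y 1 = ((q - q^-1) * (q + q^-1)) *: x k.+1.
Proof.
case=> hx _ _ _; rewrite -scalerA -hx (_ : psi x y 1 = (q - q^-1) *: h0 x y) //.
by nc_coefs K; field.
Qed.

Lemma psi1_y x y k : root_system x y ->
  y k * psi x y 1 - psi x y 1 * y k = ((q - q^-1) * (q + q^-1)) *: y k.+1.
Proof.
case=> _ hy _ _; rewrite -scalerA -hy (_ : psi x y 1 = (q - q^-1) *: h0 x y) //.
by nc_coefs K; field.
Qed.

(** By [phi_ad], [psi_1, psi_n] is a nonzero multiple of phi_{k,l+1} - phi_{k+1,l} whenever k + l =
    n - 1. *)
Lemma homogeneousS x y n : root_system x y -> homogeneous_upto x y n ->
  (0 < n)%N -> c x y 1 n = 0 -> homogeneous_upto x y n.+1.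
Proof.
move=> rs hom; case: n hom => // n hom _ cn.
have step k l : (k + l = n)%N -> phi x y k l.+1 = phi x y k.+1 l.
  move=> kl; have := phi_ad k l rs.
  rewrite (phi_psi (k := k) hom) ?kl // -[phi x y 0 0]/(psi x y 1) -/(c x y 1 n.+1) cn.
  by move/esym/eqP; rewrite scaler_eq0 (negPf (mulf_neq0 kap0 two0)) subr_eq0 => /eqP.
have low k l : (k + l <= n.+1)%N -> phi x y k l = phi x y (k + l) 0.
  move: k; elim: l => [|l IH] k; first by rewrite addn0.
  rewrite leq_eqVlt => /orP[/eqP e|kl]; last by apply: hom; rewrite ?addn0.
  by rewrite step ?IH; [congr (phi x y _ _) | | ]; lia.
by move=> k l k' l' e kl; rewrite low // [RHS]low -?e.
Qed.

(** Commute the relation with psi_1, which commutes with psi_r and psi_{r+1} and shifts the x_k. *)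
Lemma px_relS x y r k : root_system x y -> c x y 1 r.+1 = 0 -> c x y 1 r = 0 ->
  px_rel (psi x y) x r k = 0 -> px_rel (psi x y) x r k.+1 = 0.
Proof.
move=> rs e1 e0 e; apply: (scalerI (mulf_neq0 kap0 two0)); rewrite scaler0.
have ex j : psi x y 1 * x j - x j * psi x y 1 -
    ((q - q^-1) * (q + q^-1)) *: x j.+1 = 0 by rewrite psi1_x // subrr.
move: e1 e0 e ex; rewrite /c /px_rel.
move: (psi x y 1) (psi x y r.+1) (psi x y r) => p1 pS pr e1 e0 e ex.
apply: (@nc_lin _ _ _ (p1 * (pS * x k - q ^+ 2 *: (pr * x k.+1)
     - (x k * pS - q ^- 2 *: (x k.+1 * pr)))
  - (pS * x k - q ^+ 2 *: (pr * x k.+1)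
     - (x k * pS - q ^- 2 *: (x k.+1 * pr))) * p1
  - ((p1 * pS - pS * p1) * x k - q ^+ 2 *: ((p1 * pr - pr * p1) * x k.+1)
     - (x k * (p1 * pS - pS * p1) - q ^- 2 *: (x k.+1 * (p1 * pr - pr * p1))))
  - (pS * (p1 * x k - x k * p1 - ((q - q^-1) * (q + q^-1)) *: x k.+1)
     - q ^+ 2 *: (pr * (p1 * x k.+1 - x k.+1 * p1 -
                   ((q - q^-1) * (q + q^-1)) *: x k.+2))
     - ((p1 * x k - x k * p1 - ((q - q^-1) * (q + q^-1)) *: x k.+1) * pS
        - q ^- 2 *: ((p1 * x k.+1 - x k.+1 * p1 -
                   ((q - q^-1) * (q + q^-1)) *: x k.+2) * pr))))).
  by rewrite e e1 e0 !ex !(mul0r, mulr0, scaler0, subr0).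
by nc_coefs K; field.
Qed.

Lemma xx_ad1 x y k l : root_system x y ->
  psi x y 1 * xx_rel x k l - xx_rel x k l * psi x y 1 =
  ((q - q^-1) * (q + q^-1)) *: (xx_rel x k.+1 l + xx_rel x k l.+1).
Proof.
move=> rs; have ex j : psi x y 1 * x j - x j * psi x y 1 -
    ((q - q^-1) * (q + q^-1)) *: x j.+1 = 0 by rewrite psi1_x // subrr.
move: (psi x y 1) ex => p1 ex.
pose D j := p1 * x j - x j * p1 - ((q - q^-1) * (q + q^-1)) *: x j.+1.
pose M i j := D i * x j + x i * D j.
apply: (@nc_lin _ _ _ (M k.+1 l - q ^+ 2 *: M l k.+1
    + (M l.+1 k - q ^+ 2 *: M k l.+1))).
  by rewrite /M /D !ex !(mul0r, mulr0, add0r, scaler0, oppr0).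
by rewrite /M /D /xx_rel; nc_coefs K; field.
Qed.

(** The t^2 coefficient of moving psi(t) past a product of two x-currents. Its extreme terms carry
    the different scalars q^4 and q^-4, so the relation with both indices raised can be isolated. *)
Lemma xx_ad2 x y k l : root_system x y ->
    (forall j, px_rel (psi x y) x 1 j = 0) ->
  psi x y 2 * xx_rel x k l
  - q ^+ 2 *: (psi x y 1 * (xx_rel x k.+1 l + xx_rel x k l.+1))
  + q ^+ 4 *: xx_rel x k.+1 l.+1 =
  xx_rel x k l * psi x y 2
  - q ^- 2 *: ((xx_rel x k.+1 l + xx_rel x k l.+1) * psi x y 1)
  + q ^- 4 *: xx_rel x k.+1 l.+1.
Proof.
move=> rs; have ex j : psi x y 1 * x j - x j * psi x y 1 -
    ((q - q^-1) * (q + q^-1)) *: x j.+1 = 0 by rewrite psi1_x // subrr.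
rewrite /px_rel; move: (psi x y 1) (psi x y 2) ex => p1 p2 ex1 ex2.
pose D1 j := p1 * x j - x j * p1 - ((q - q^-1) * (q + q^-1)) *: x j.+1.
pose D2 j := p2 * x j - q ^+ 2 *: (p1 * x j.+1)
    - (x j * p2 - q ^- 2 *: (x j.+1 * p1)).
pose M i j := D2 i * x j - q ^+ 2 *: (D1 i * x j.+1) + x i * D2 j
  - q ^- 2 *: (x i.+1 * D1 j).
apply: (@nc_lin _ _ _ (M k.+1 l - q ^+ 2 *: M l k.+1
    + (M l.+1 k - q ^+ 2 *: M k l.+1))).
  by rewrite /M /D1 /D2 !ex1 !ex2 !(mul0r, mulr0, add0r, scaler0, oppr0).
by rewrite /M /D1 /D2 /xx_rel; nc_coefs K; field.
Qed.

Lemma xx_relC x k l : xx_rel x k l = xx_rel x l k.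
Proof. by rewrite /xx_rel addrC. Qed.

(* Commuting the relations of degree d with psi_1 and psi_2 yields those of     *)
(* degree d + 1 and d + 2.                                                     *)
Lemma xx_rel0 x y : root_system x y ->
  (forall j, px_rel (psi x y) x 1 j = 0) -> forall k l, xx_rel x k l = 0.
Proof.
move=> rs ex k l.
suff H d : forall k l, (k + l <= d)%N -> xx_rel x k l = 0 by apply: (H (k + l)%N).
elim: d => [|d IH] {k l} k l.
  rewrite leqn0 addn_eq0 => /andP[/eqP -> /eqP ->].
  by case: rs => _ _ e _; rewrite /xx_rel e addr0.
have inner i j : (i.+1 + j.+1 <= d.+1)%N -> xx_rel x i.+1 j.+1 = 0.
  move=> ij; have := @xx_ad2 x y i j rs ex.
  rewrite (IH i j) ?(IH i.+1 j) ?(IH i j.+1); try lia.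
  rewrite addr0 !(mulr0, mul0r, scaler0, oppr0, add0r) => /eqP.
  by rewrite -subr_eq0 -scalerBl scaler_eq0 (negPf kap4) => /eqP.
have edge : xx_rel x 0 d.+1 = 0.
  have := @xx_ad1 x y 0 d rs; rewrite (IH 0 d)%N // mulr0 mul0r subrr => /esym/eqP.
  rewrite scaler_eq0 (negPf (mulf_neq0 kap0 two0)) /=.
  (* For d > 0 the companion term of [xx_ad1] is an inner relation; for d = 0 the two terms agree by
     [xx_relC] and 2 is invertible. *)
  case: (d) inner => [|d'] inner; last by rewrite inner ?add0r // => /eqP.
  rewrite xx_relC -mulr2n -scaler_nat scaler_eq0 => /orP[|/eqP //].
  by have /pcharf0P -> := charK.
rewrite leq_eqVlt => /orP[/eqP|]; last exact: IH.
case: k l => [|k] [|l] kl //; last by apply: inner; rewrite kl.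
  by rewrite -[l.+1]add0n kl.
by rewrite xx_relC -[k.+1]addn0 kl.
Qed.

End Relations.

(** * Transfer to the converse algebra and the next exchange relation *)

Section Converse.
Variable A : algType K.
Implicit Types x y p : nat -> A.

Lemma root_system_converse x y :
  @root_system A x y -> @root_system A^c y x.
Proof. by case=> h1 h2 h3 h4; split. Qed.

(** In the converse algebra [psi] becomes [phiL], so the two families agree as far as homogeneity
    reaches. *)
Lemma psi_converse x y n r : homogeneous_upto x y n -> (r <= n)%N ->
  @psi A^c y x r = psi x y r.
Proof. by move=> hom rn; rewrite -(phiL_psi hom rn); case: r rn. Qed.

Lemma px_converse p y r k : @px_rel A^c p y r k = py_rel p y r k.
Proof. by []. Qed.

Lemma px_rel_congr p p' x r k :
  p r = p' r -> p r.+1 = p' r.+1 -> px_rel p x r k = px_rel p' x r k.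
Proof. by rewrite /px_rel => -> ->. Qed.

Lemma py_rel_congr p p' y r k :
  p r = p' r -> p r.+1 = p' r.+1 -> py_rel p y r k = py_rel p' y r k.
Proof. by rewrite /py_rel => -> ->. Qed.

Lemma homogeneous_converse x y n :
  homogeneous_upto x y n -> @homogeneous_upto A^c y x n.
Proof. by move=> hom k l k' l' e kl; apply: hom; rewrite addnC // e addnC. Qed.

Lemma psi_comm1_hom x y n : root_system x y -> homogeneous_upto x y n.+1 ->
  psi x y 1 * psi x y n - psi x y n * psi x y 1 = 0.
Proof.
case: n => [|n] rs hom; first by rewrite mulr1 mul1r subrr.
rewrite [psi x y 1]/(phi x y 0 0) phi_ad // (hom n 1%N n.+1 0%N) ?subrr ?scaler0 //; lia.
Qed.

(** By [xx_px] the relations with indices (m+1, 0) and (1, m) add up to zero; the second is known,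
    or equals the first when m = 0. *)
Lemma px_next x y m : homogeneous_upto x y m.+2 -> xx_rel x m 0 = 0 ->
  ((0 < m)%N -> px_rel (psi x y) x 1 m = 0) -> px_rel (psi x y) x m.+1 0 = 0.
Proof.
move=> hom /(@xx_px _ x y m 0) e e1.
have pE r k : (r < m.+2)%N -> px_rel (phiL x y) x r k = px_rel (psi x y) x r k.
  by move=> rm; apply: px_rel_congr; apply: phiL_psi hom _; lia.
move: e; rewrite !pE //; case: m {hom pE} e1 => [_|m ->] //; last by rewrite addr0.
rewrite -mulr2n -scaler_nat => /eqP; rewrite scaler_eq0 => /orP[|/eqP //].
by have /pcharf0P -> := charK.
Qed.

Lemma px_rel_ind x y r : root_system x y -> homogeneous_upto x y r.+2 ->
  px_rel (psi x y) x r 0 = 0 -> forall k, px_rel (psi x y) x r k = 0.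
Proof.
move=> rs hom e; elim=> [|k IH] //; apply: px_relS => //.
  exact: psi_comm1_hom.
by apply: psi_comm1_hom => // k1 l1 k2 l2 e1 kl; apply: hom => //; lia.
Qed.

End Converse.

(** * The induction on the degree *)

Section Main.
Variables (A : algType K) (x y : nat -> A).
Hypothesis rs : root_system x y.

Let rs' : @root_system A^c y x. Proof. exact: root_system_converse. Qed.

Lemma py_rel_psi n r k : homogeneous_upto x y n -> (r < n)%N ->
  @px_rel A^c (@psi A^c y x) y r k = py_rel (psi x y) y r k.
Proof.
move=> hom rn; rewrite px_converse.
by apply: (@py_rel_congr A (@psi A^c y x)); apply: (psi_converse hom _); lia.
Qed.

Lemma drinfeld_step m : drinfeld_upto x y m.+2 ->
  px_rel (psi x y) x m.+1 0 = 0 -> py_rel (psi x y) y m.+1 0 = 0 ->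
  drinfeld_upto x y m.+3.
Proof.
move=> dr ex ey; have [hom qx qy] := dr.
have hom3 : homogeneous_upto x y m.+3 by apply: homogeneousS => //; exact: psi_comm1.
split=> // r k; rewrite ltnS leq_eqVlt => /orP[/eqP [->]|].
- exact: px_rel_ind.
- exact: qx.
- rewrite -(py_rel_psi _ hom3) //; apply: (@px_rel_ind A^c) => //.
    exact: homogeneous_converse.
  by rewrite (py_rel_psi _ hom3).
- exact: qy.
Qed.

Lemma drinfeld_upto2 : drinfeld_upto x y 2.
Proof.
have hom1 : homogeneous_upto x y 1 by move=> [|k] [|l] [|k'] [|l'].
split; first by apply: homogeneousS => //; rewrite subrr.
  case=> // k _; apply: (nc_from (psi1_x k rs)); rewrite /px_rel psi0.
  by nc_coefs K; field.
case=> // k _; apply: (nc_from (psi1_y k rs)); rewrite /py_rel psi0.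
by nc_coefs K; field.
Qed.

(** Separate from the general step because [xx_rel0] itself needs the exchange relation of psi_2;
    here [xx_rel x 0 0], a Serre relation, suffices. *)
Lemma drinfeld_upto3 : drinfeld_upto x y 3.
Proof.
have [hom qx qy] := drinfeld_upto2; apply: drinfeld_step; first exact: drinfeld_upto2.
  by apply: px_next => //; case: rs => _ _ e _; rewrite /xx_rel e addr0.
rewrite -(py_rel_psi _ hom) //; apply: (@px_next A^c) => //.
  exact: homogeneous_converse.
by case: rs' => _ _ e _; rewrite /xx_rel e addr0.
Qed.

Lemma xx_relE k l : xx_rel x k l = 0.
Proof.
have [hom qx qy] := drinfeld_upto3.
by apply: (xx_rel0 rs) => // j; apply: qx.
Qed.

Lemma yy_relE k l : @xx_rel A^c y k l = 0.
Proof.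
have [hom qx qy] := drinfeld_upto3.
by apply: (xx_rel0 rs') => // j; rewrite (py_rel_psi _ hom) // qy.
Qed.

Lemma drinfeld_all n : drinfeld_upto x y n.+2.
Proof.
elim: n => [|n IH]; first exact: drinfeld_upto2.
have [hom qx qy] := IH; have [_ qx3 qy3] := drinfeld_upto3.
apply: drinfeld_step => //.
  by apply: px_next => //; [exact: xx_relE|move=> _; apply: qx3].
rewrite -(py_rel_psi _ hom) //; apply: (@px_next A^c) => //.
- exact: homogeneous_converse.
- exact: yy_relE.
- move=> n0; rewrite (py_rel_psi _ hom) //; exact: qy3.
Qed.

Lemma drinfeldE n : drinfeld_upto x y n.
Proof.
have [hom qx qy] := drinfeld_all n; split=> [k l k' l' e kl|r k rn|r k rn].
- by apply: hom => //; lia.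
- by apply: qx; lia.
- by apply: qy; lia.
Qed.

Lemma phiE k l : phi x y k l = psi x y (k + l).+1.
Proof. by have [hom _ _] := drinfeldE (k + l).+1; apply: phi_psi hom _. Qed.

Lemma psi_xE r k : px_rel (psi x y) x r k = 0.
Proof. by have [_ qx _] := drinfeldE r.+2; apply: qx. Qed.

Lemma psi_yE r k : py_rel (psi x y) y r k = 0.
Proof. by have [_ _ qy] := drinfeldE r.+2; apply: qy. Qed.

(** Full homogeneity makes [psi_1, psi_n] vanish by [phi_ad], and [psi_comm_scaled] reduces every
    other commutator to this one. *)
Lemma psi_comm r s : psi x y r * psi x y s = psi x y s * psi x y r.
Proof.
case: r s => [|r] [|s]; rewrite ?mul1r ?mulr1 //.
have := @psi_comm_scaled A x y (r + s.+1) r (drinfeldE _) (psi_xE _ _) (psi_yE _ _).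
have [hom _ _] := drinfeldE (r + s.+1).+1.
rewrite psi_comm1_hom // scaler0 addKn addnS ltnS leq_addr => /(_ isT)/eqP.
by rewrite scaler_eq0 (negPf kap2) subr_eq0 => /eqP.
Qed.

End Main.

End DrinfeldRelations.

(** * The algebra of formal power series *)

(** The carrier of [series] under a new name, which can bear the algebra structure whose product is
    [ser_mul]. *)
Definition fps (K : fieldType) (A : algType K) := nat -> A.

Section Fps.
Variables (K : fieldType) (A : algType K).
Local Notation S := (fps A).
Implicit Types f g h : S.

HB.instance Definition _ := gen_eqMixin S.
HB.instance Definition _ := gen_choiceMixin S.

Definition fps_zero : S := fun=> 0.
Definition fps_opp f : S := fun n => - f n.
Definition fps_add f g : S := fun n => f n + g n.
Definition fps_one : S := ser_one A.
Definition fps_mul f g : S := ser_mul f g.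
Definition fps_scale (c : K) f : S := fun n => c *: f n.

Fact fps_addA : associative fps_add.
Proof. by move=> f g h; apply/funext => n; apply: addrA. Qed.
Fact fps_addC : commutative fps_add.
Proof. by move=> f g; apply/funext => n; apply: addrC. Qed.
Fact fps_add0 : left_id fps_zero fps_add.
Proof. by move=> f; apply/funext => n; apply: add0r. Qed.
Fact fps_addN : left_inverse fps_zero fps_opp fps_add.
Proof. by move=> f; apply/funext => n; apply: addNr. Qed.

HB.instance Definition _ :=
  GRing.isZmodule.Build S fps_addA fps_addC fps_add0 fps_addN.

(** Lets associativity be inherited from [{poly A}] by truncation. *)
Lemma fps_mul_poly (p r : {poly A}) f g n :
  (forall i, (i <= n)%N -> f i = p`_i) -> (forall i, (i <= n)%N -> g i = r`_i) ->
  fps_mul f g n = (p * r)`_n.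
Proof.
move=> fp gr; rewrite coefM; apply: eq_bigr => i _.
by rewrite fp ?gr ?leq_subr // -ltnS.
Qed.

Fact fps_mulA : associative fps_mul.
Proof.
move=> f g h; apply/funext => n; pose p (s : S) := \poly_(i < n.+1) s i.
have pE s i : (i <= n)%N -> s i = (p s)`_i by move=> le_in; rewrite coef_poly ltnS le_in.
have pM s s' i : (i <= n)%N -> fps_mul s s' i = (p s * p s')`_i.
  by move=> le_in; apply: fps_mul_poly => j ji; apply: pE; lia.
rewrite (@fps_mul_poly (p f) (p g * p h)) // ?mulrA; last by move=> i; apply: pM.
  by apply/esym/fps_mul_poly => i; [apply: pM | apply: pE].
exact: pE.
Qed.
Fact fps_mul1 : left_id fps_one fps_mul.
Proof.
move=> f; apply/funext => n; rewrite /fps_mul /ser_mul big_ord_recl subn0 mul1r.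
by rewrite big1 ?addr0 // => i _; rewrite mul0r.
Qed.
Fact fps_mulr1 : right_id fps_one fps_mul.
Proof.
move=> f; apply/funext => n; rewrite /fps_mul /ser_mul big_ord_recr subnn /= mulr1.
rewrite big1 ?add0r // => i _; rewrite /fps_one /ser_one subn_eq0 leqNgt ltn_ord.
exact: mulr0.
Qed.
Fact fps_mulDl : left_distributive fps_mul +%R.
Proof.
move=> f g h; apply/funext => n; rewrite /GRing.add /= /fps_add -big_split /=.
by apply: eq_bigr => i _; apply: mulrDl.
Qed.
Fact fps_mulDr : right_distributive fps_mul +%R.
Proof.
move=> f g h; apply/funext => n; rewrite /GRing.add /= /fps_add -big_split /=.
by apply: eq_bigr => i _; apply: mulrDr.
Qed.
Fact fps_one_neq0 : fps_one != 0.
Proof.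
by apply/eqP => /(congr1 (fun f : S => f 0%N)) /eqP; rewrite /fps_one /ser_one oner_eq0.
Qed.

HB.instance Definition _ := GRing.Zmodule_isNzRing.Build S
  fps_mulA fps_mul1 fps_mulr1 fps_mulDl fps_mulDr fps_one_neq0.

Fact fps_scaleA c d f : fps_scale c (fps_scale d f) = fps_scale (c * d) f.
Proof. by apply/funext => n; apply: scalerA. Qed.
Fact fps_scale1 : left_id 1 fps_scale.
Proof. by move=> f; apply/funext => n; apply: scale1r. Qed.
Fact fps_scaleDr : right_distributive fps_scale +%R.
Proof. by move=> c f g; apply/funext => n; apply: scalerDr. Qed.
Fact fps_scaleDl f : {morph fps_scale^~ f : c d / c + d}.
Proof. by move=> c d; apply/funext => n; apply: scalerDl. Qed.

HB.instance Definition _ := GRing.Zmodule_isLmodule.Build K S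
  fps_scaleA fps_scale1 fps_scaleDr fps_scaleDl.

Fact fps_scaleAl c f g : c *: (f * g) = (c *: f) * g.
Proof.
apply/funext => n; rewrite /GRing.scale /GRing.mul /= /fps_scale scaler_sumr.
by apply: eq_bigr => i _; apply: scalerAl.
Qed.
HB.instance Definition _ := GRing.Lmodule_isLalgebra.Build K S fps_scaleAl.

Fact fps_scaleAr c f g : c *: (f * g) = f * (c *: g).
Proof.
apply/funext => n; rewrite /GRing.scale /GRing.mul /= /fps_scale scaler_sumr.
by apply: eq_bigr => i _; apply: scalerAr.
Qed.
HB.instance Definition _ := GRing.Lalgebra_isAlgebra.Build K S fps_scaleAr.

Lemma fpsP f g : (forall n, f n = g n) -> f = g. Proof. exact: funext. Qed.
Lemma fpsD f g n : (f + g) n = f n + g n. Proof. by []. Qed.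
Lemma fpsN f n : (- f) n = - f n. Proof. by []. Qed.
Lemma fpsZ c f n : (c *: f) n = c *: f n. Proof. by []. Qed.
Lemma fpsM f g n : (f * g) n = \sum_(i < n.+1) f i * g (n - i)%N.
Proof. by []. Qed.
Lemma fps0 n : (0 : S) n = 0. Proof. by []. Qed.
Lemma fps1 n : (1 : S) n = (n == 0)%:R. Proof. by []. Qed.
Definition fpsE := (fpsD, fpsN, fpsZ, fps0, fps1).

Definition fpsC (a : A) : S := fun n => if n is 0 then a else 0.
Definition fpsX : S := fun n => (n == 1)%:R.

Lemma fpsCM a f n : (fpsC a * f) n = a * f n.
Proof.
by rewrite fpsM big_ord_recl subn0 big1 ?addr0 // => i _; rewrite mul0r.
Qed.

Lemma fpsMC a f n : (f * fpsC a) n = f n * a.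
Proof.
rewrite fpsM big_ord_recr subnn /= big1 ?add0r // => i _.
by case: (n - i)%N (subn_gt0 i n) => [|m]; rewrite ?ltn_ord // mulr0.
Qed.

Lemma fpsXM f n : (fpsX * f) n = if n is m.+1 then f m else 0.
Proof.
case: n => [|n]; rewrite fpsM big_ord_recl mul0r add0r ?big_ord0 //.
rewrite big_ord_recl mul1r subSS subn0 big1 ?addr0 // => i _.
by rewrite mul0r.
Qed.

Lemma fpsMX f n : (f * fpsX) n = if n is m.+1 then f m else 0.
Proof.
case: n => [|n]; rewrite fpsM big_ord_recr subnn /= mulr0 addr0 ?big_ord0 //.
rewrite big_ord_recr /= subSnn mulr1 big1 ?add0r // => i _.
by rewrite subSn ?(ltnW (ltn_ord i)) // /fpsX eqSS subn_eq0 leqNgt ltn_ord mulr0.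
Qed.

Lemma fpsX_comm f : f * fpsX = fpsX * f.
Proof. by apply: fpsP => n; rewrite fpsXM fpsMX. Qed.

Lemma ser_shiftE (a : nat -> A) : ser_shift a = fpsX * (a : S).
Proof. by apply: fpsP => n; rewrite fpsXM. Qed.

Definition dilate (c : K) f : S := fun n => c ^+ n *: f n.

Lemma dilateD c f g : dilate c (f + g) = dilate c f + dilate c g.
Proof. by apply: fpsP => n; apply: scalerDr. Qed.
Lemma dilateN c f : dilate c (- f) = - dilate c f.
Proof. by apply: fpsP => n; apply: scalerN. Qed.
Lemma dilateZ c d f : dilate c (d *: f) = d *: dilate c f.
Proof. by apply: fpsP => n; rewrite /dilate !fpsE !scalerA mulrC. Qed.
Lemma dilateM c f g : dilate c (f * g) = dilate c f * dilate c g.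
Proof.
apply: fpsP => n; rewrite /dilate !fpsM scaler_sumr; apply: eq_bigr => i _.
by rewrite -scalerAl -scalerAr scalerA -exprD subnKC // -ltnS.
Qed.
Lemma dilate1 c : dilate c 1 = 1.
Proof. by apply: fpsP => -[|n]; rewrite /dilate fpsE ?scale1r ?scaler0. Qed.
Lemma dilateC c a : dilate c (fpsC a) = fpsC a.
Proof. by apply: fpsP => -[|n]; rewrite /dilate /= ?scale1r ?scaler0. Qed.
Lemma dilate_X c : dilate c fpsX = c *: fpsX.
Proof. by apply: fpsP => -[|[|n]]; rewrite /dilate fpsE /= ?expr1 ?scaler0. Qed.
Lemma dilate_comp c d f : dilate c (dilate d f) = dilate (c * d) f.
Proof. by apply: fpsP => n; rewrite /dilate scalerA exprMn. Qed.
Lemma dilate_id f : dilate 1 f = f.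
Proof. by apply: fpsP => n; rewrite /dilate expr1n scale1r. Qed.
Definition dilateE := (dilateD, dilateN, dilateZ, dilateM, dilate1, dilateC, dilate_X, dilate_comp).

Lemma ser_rescaleE c f : ser_rescale c f = dilate c^-1 f.
Proof. by apply: fpsP => n; rewrite /dilate exprVn. Qed.

Hypothesis charK : [pchar K] =i pred0.

Let natf_neq0 n : (n.+1%:R : K) != 0.
Proof. by have /pcharf0P -> := charK. Qed.

(** The Euler operator t d/dt, a derivation that keeps the index. *)
Definition theta f : S := fun n => n%:R *: f n.

Lemma thetaM f g : theta (f * g) = theta f * g + f * theta g.
Proof.
apply: fpsP => n; rewrite /theta fpsD !fpsM scaler_sumr -big_split /=.
apply: eq_bigr => i _.
by rewrite -scalerAl -scalerAr -scalerDl -natrD subnKC // -ltnS.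
Qed.

Lemma thetaD f g : theta (f + g) = theta f + theta g.
Proof. by apply: fpsP => n; apply: scalerDr. Qed.

Lemma ser_exp_natE f m : ser_exp_nat f m = f ^+ m.
Proof. by elim: m => // m IH; rewrite ser_exp_natS IH exprS. Qed.

Lemma theta_exp f m : f * theta f = theta f * f ->
  theta (f ^+ m.+1) = m.+1%:R *: (theta f * f ^+ m).
Proof.
move=> ff; elim: m => [|m IH]; first by rewrite !expr1 expr0 mulr1 scale1r.
rewrite exprS thetaM IH -scalerAr (mulrA f) ff -mulrA -exprS.
by rewrite -[X in X + _]scale1r -scalerDl nat1r.
Qed.

Lemma exp_nat_small f m n : f 0%N = 0 -> (n < m)%N -> (f ^+ m) n = 0.
Proof.
move=> f0; elim: m n => // m IH n nm; rewrite exprS fpsM big1 // => -[[|i] /= lt_in] _.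
  by rewrite f0 mul0r.
by rewrite IH ?mulr0 //; lia.
Qed.

Lemma fps_sum M (F : 'I_M -> S) n : (\sum_m F m) n = \sum_m F m n.
Proof.
elim: M F => [|M IH] F; first by rewrite !big_ord0.
by rewrite !big_ord_recl fpsD IH.
Qed.

Lemma ser_expE f n N : f 0%N = 0 -> (n <= N)%N ->
  ser_exp f n = (\sum_(m < N.+1) (m`!%:R^-1 : K) *: f ^+ m) n.
Proof.
move=> f0 nN; rewrite fps_sum /ser_exp.
rewrite -(subnKC nN) -addSn big_split_ord /= [X in _ = _ + X]big1 ?addr0.
  by apply: eq_bigr => m _; rewrite ser_exp_natE.
by move=> i _; rewrite fpsZ exp_nat_small ?scaler0 // leq_addr.
Qed.

Lemma ser_exp0 f : f 0%N = 0 -> ser_exp f 0 = 1.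
Proof. by move=> f0; rewrite /ser_exp big_ord1 invr1 scale1r. Qed.

Lemma theta_ser_exp f : f 0%N = 0 -> f * theta f = theta f * f ->
  theta (ser_exp f) = theta f * ser_exp f.
Proof.
move=> f0 ff; apply: fpsP => -[|n].
  by rewrite fpsM big_ord1 /theta !scale0r mul0r.
transitivity ((theta f * \sum_(m < n.+1) (m`!%:R^-1 : K) *: f ^+ m) n.+1).
  rewrite mulr_sumr fps_sum /theta (ser_expE f0 (leqnn _)) fps_sum big_ord_recl.
  rewrite fpsZ expr0 fpsE /= scaler0 add0r scaler_sumr; apply: eq_bigr => m _.
  rewrite fpsZ scalerA mulrC -scalerA -[X in _ *: X]/(theta _ _) theta_exp //.
  rewrite -scalerAr !fpsZ scalerA; congr (_ *: _); rewrite /bump add1n factS natrM.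
  by rewrite invfM mulrAC mulVf ?mul1r // natf_neq0.
rewrite !fpsM big_ord_recl [RHS]big_ord_recl /theta !scale0r !mul0r !add0r.
apply: eq_bigr => i _; congr (_ * _).
by rewrite (ser_expE (N := n)) //= subSS leq_subr.
Qed.

(** Uniqueness for a linear differential equation: as f_0 = 0, coefficient n+1 of f g involves only
    lower coefficients of g, and n+1 is invertible. *)
Lemma theta_eq f g h : g 0%N = h 0%N -> f 0%N = 0 ->
  theta g = f * g -> theta h = f * h -> g = h.
Proof.
move=> gh f0 eg eh; apply: fpsP => n; elim/ltn_ind: n => -[|n] IH //.
have := congr1 (fun s : S => s n.+1) eg; have := congr1 (fun s : S => s n.+1) eh.
rewrite /theta !fpsM big_ord_recl f0 mul0r add0r => e1.
rewrite big_ord_recl f0 mul0r add0r => e2.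
apply: (scalerI (natf_neq0 n)); rewrite e1 e2; apply: eq_bigr => i _.
by rewrite IH // /= subSS ltnS leq_subr.
Qed.

Definition ccomm f g := forall i j, f i * g j = g j * f i.

Lemma ccomm_sym f g : ccomm f g -> ccomm g f.
Proof. by move=> fg i j; rewrite fg. Qed.

Lemma ccomm_mul f g : ccomm f g -> f * g = g * f.
Proof.
move=> fg; apply: fpsP => n; rewrite !fpsM (reindex_inj rev_ord_inj) /=.
by apply: eq_bigr => i _; rewrite subSS fg subKn // -ltnS.
Qed.

Lemma ccommC f g : (forall i, fpsC (f i) * g = g * fpsC (f i)) <-> ccomm f g.
Proof.
split=> fg i; last by apply: fpsP => j; rewrite fpsCM fpsMC.
by move=> j; rewrite -fpsCM fg fpsMC.
Qed.

Lemma ccomm_exp f g : ccomm f g -> ccomm f (ser_exp g).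
Proof.
move=> fg i j; rewrite /ser_exp mulr_sumr mulr_suml; apply: eq_bigr => m _.
rewrite -scalerAr -scalerAl ser_exp_natE -fpsCM -fpsMC.
suff -> : fpsC (f i) * g ^+ m = g ^+ m * fpsC (f i) by [].
by apply: commrX; move/ccommC: fg; apply.
Qed.

Lemma ccomm_theta f g : ccomm f g -> ccomm f (theta g).
Proof. by move=> fg i j; rewrite /theta -scalerAl -scalerAr fg. Qed.

(** Both sides solve [theta h = (theta f + theta g) * h] with constant term 1. *)
Lemma ser_expD f g : f 0%N = 0 -> g 0%N = 0 ->
  ccomm f f -> ccomm g g -> ccomm f g ->
  ser_exp (f + g) = (ser_exp f : S) * ser_exp g :> S.
Proof.
move=> f0 g0 ff gg fg.
have fgfg : ccomm (f + g) (f + g).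
  by move=> i j; rewrite !fpsD !mulrDl !mulrDr ff gg fg (fg j) addrACA.
apply: (@theta_eq (theta f + theta g)).
- by rewrite fpsM big_ord1 !ser_exp0 ?mulr1 // fpsD f0 g0 addr0.
- by rewrite fpsD /theta !scale0r addr0.
- rewrite theta_ser_exp ?thetaD //; first by rewrite fpsD f0 g0 addr0.
  by rewrite -thetaD; exact/ccomm_mul/ccomm_theta.
rewrite thetaM !theta_ser_exp //; try exact/ccomm_mul/ccomm_theta.
rewrite mulrDl !mulrA; congr (_ + _ * _).
exact/esym/ccomm_mul/ccomm_exp/ccomm_sym/ccomm_theta.
Qed.

Lemma ser_exp_0 : ser_exp (0 : S) = (1 : S).
Proof.
apply: fpsP => n; rewrite /ser_exp big_ord_recl invr1 scale1r ser_exp_natE expr0.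
by rewrite big1 ?addr0 // => i _; rewrite ser_exp_natE exprS mul0r fps0 scaler0.
Qed.

Lemma dilate_exp c f : ser_exp (dilate c f) = dilate c (ser_exp f).
Proof.
have dX m : dilate c (f ^+ m) = dilate c f ^+ m.
  by elim: m => [|m IH]; rewrite ?expr0 ?dilate1 // !exprS dilateM IH.
apply: fpsP => n; rewrite {2}/dilate /ser_exp scaler_sumr; apply: eq_bigr => m _.
by rewrite !ser_exp_natE scalerA mulrC -scalerA -dX.
Qed.

End Fps.

(** * The series X and its exchange relations *)

Section Logarithm.
Variables (K : fieldType) (A : algType K).
Hypothesis charK : [pchar K] =i pred0.
Implicit Types f g : fps A.

(** If f' truncates f after index n, then exp f and exp f' differ at n+1 by exactly f_{n+1}; exp f'
    commutes with g by induction. *)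
Lemma ccomm_log f g : f 0%N = 0 -> ccomm g (ser_exp f) -> ccomm g f.
Proof.
move=> f0 gf i n; elim/ltn_ind: n => -[|n] IH; first by rewrite f0 mul0r mulr0.
pose f' : fps A := fun j => if (j <= n)%N then f j else 0.
have f'f : ccomm (fpsC (g i)) f'.
  move=> [|k] j /=; last by rewrite mul0r mulr0.
  by rewrite /f'; case: ifP => jn; rewrite ?mul0r ?mulr0 // IH.
have e : ser_exp f n.+1 - f n.+1 = ser_exp f' n.+1.
  rewrite (@ser_exp_sub _ _ f f' n f0) /f' ?ltnn ?subr0 //= ?f0 //.
  by move=> j; rewrite ltnS => ->.
have -> : f n.+1 = ser_exp f n.+1 - ser_exp f' n.+1 by rewrite -e subKr.
rewrite mulrBr mulrBl gf; congr (_ - _).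
exact: (ccomm_exp f'f 0%N).
Qed.

End Logarithm.

Section Exchange.
Variables (K : fieldType) (A : algType K).
Implicit Types (F G : fps A) (x : nat -> A).

Definition two_term x (c : K) k : fps A := fpsC (x k) - c *: (fpsX A * fpsC (x k.+1)).

Lemma two_termMl F x c k :
  F * two_term x c k = F * fpsC (x k) - c *: (fpsX A * (F * fpsC (x k.+1))).
Proof. by rewrite mulrBr -scalerAr !mulrA fpsX_comm. Qed.

Lemma two_termMr F x c k :
  two_term x c k * F = fpsC (x k) * F - c *: (fpsX A * (fpsC (x k.+1) * F)).
Proof. by rewrite mulrBl -scalerAl !mulrA. Qed.

(* F(t)(x_k - a t x_{k+1}) = (x_k - b t x_{k+1})F(t), that is, F(t) x(s) equals *)
(* (s - b t)/(s - a t) x(s) F(t) up to boundary terms.                          *)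
Definition exchange (a b : K) F x :=
  forall k, F * two_term x a k = two_term x b k * F.

Lemma exchangeM a b c F G x :
  exchange b c F x -> exchange a b G x -> exchange a c (F * G) x.
Proof. by move=> eF eG k; rewrite -mulrA eG mulrA eF mulrA. Qed.

Lemma exchange_inv a b F G x :
  F * G = 1 -> G * F = 1 -> exchange a b F x -> exchange b a G x.
Proof.
move=> FG GF eF k; rewrite -[LHS]mulr1 -FG mulrA -(mulrA G) -eF mulrA GF.
by rewrite mul1r.
Qed.

Lemma dilate_two_term x c d k : dilate d (two_term x c k) = two_term x (d * c) k.
Proof. by rewrite /two_term !dilateE -scalerAl scalerA mulrC. Qed.

Lemma exchange_dilate a b c F x :
  exchange a b F x -> exchange (c * a) (c * b) (dilate c F) x.
Proof. by move=> eF k; rewrite -!dilate_two_term -!dilateM eF. Qed.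

Lemma exchange_coef a b F x n k : exchange a b F x ->
  F n.+1 * x k - a *: (F n * x k.+1) = x k * F n.+1 - b *: (x k.+1 * F n).
Proof.
move=> /(_ k)/(congr1 (fun f : fps A => f n.+1)).
rewrite two_termMl two_termMr.
by rewrite !fpsE fpsMC fpsCM !fpsXM fpsMC fpsCM.
Qed.

Lemma exchangeP a b F x :
  (forall k, F 0%N * x k = x k * F 0%N) ->
  (forall n k, F n.+1 * x k - a *: (F n * x k.+1) =
     x k * F n.+1 - b *: (x k.+1 * F n)) -> exchange a b F x.
Proof.
move=> e0 eS k; apply: fpsP => n.
rewrite two_termMl two_termMr.
rewrite !fpsE !fpsMC !fpsCM !fpsXM.
by case: n => [|n]; rewrite ?fpsMC ?fpsCM // !scaler0 !subr0 e0.
Qed.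

Definition current (c : K) x k : fps A := fun i => c ^+ i *: x (k + i)%N.

Lemma currentS c x k : current c x k = fpsC (x k) + c *: (fpsX A * current c x k.+1).
Proof.
apply: fpsP => -[|n]; rewrite !fpsE fpsXM /current /= ?addn0 ?expr0 ?scale1r.
  by rewrite scaler0 addr0.
by rewrite add0r scalerA exprS addSnnS.
Qed.

(** Summing the exchange relations with weights s^i leaves the boundary terms a t F x_k and b t x_k
    F. At s = b t the factor s - b t vanishes and these express F times the current; [exchange_left]
    is the case s = a t. *)
Lemma exchange_right a b F x : (forall k, F 0%N * x k = x k * F 0%N) ->
  exchange a b F x -> forall k,
  b *: (fpsC (x k) * F) - a *: (F * fpsC (x k)) = (b - a) *: (F * current b x k).
Proof.
move=> e0 eF k; apply: fpsP => n; elim: n k => [|n IH] k.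
  rewrite !fpsE fpsCM fpsMC fpsM big_ord1 /current expr0 scale1r addn0 e0.
  by rewrite scalerBl.
rewrite currentS mulrDr -scalerAr mulrA fpsX_comm -mulrA.
rewrite !fpsE !fpsMC !fpsCM fpsXM.
have := IH k.+1; rewrite !fpsE fpsMC fpsCM => e.
rewrite scalerDr scalerA [(b - a) * b]mulrC -scalerA -e.
apply: (nc_from (congr1 ( *:%R (- b)) (exchange_coef n k eF))).
by nc_coefs K; ring.
Qed.

Lemma exchange_left a b F x : (forall k, F 0%N * x k = x k * F 0%N) ->
  exchange a b F x -> forall k,
  b *: (fpsC (x k) * F) - a *: (F * fpsC (x k)) = (b - a) *: (current a x k * F).
Proof.
move=> e0 eF k; apply: fpsP => n; elim: n k => [|n IH] k.
  rewrite !fpsE fpsCM fpsMC fpsM big_ord1 /current expr0 scale1r addn0 e0.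
  by rewrite scalerBl.
rewrite currentS mulrDl -scalerAl -mulrA.
rewrite !fpsE !fpsMC !fpsCM fpsXM.
have := IH k.+1; rewrite !fpsE fpsMC fpsCM => e.
rewrite scalerDr scalerA [(b - a) * a]mulrC -scalerA -e.
apply: (nc_from (congr1 ( *:%R (- a)) (exchange_coef n k eF))).
by nc_coefs K; ring.
Qed.

Lemma exchange_current a b F x : (forall k, F 0%N * x k = x k * F 0%N) ->
  b != a -> exchange a b F x -> forall k, F * current b x k = current a x k * F.
Proof.
move=> e0 ba eF k; have ba0 : b - a != 0 by rewrite subr_eq0.
by apply: (scalerI ba0); rewrite -exchange_right // exchange_left.
Qed.

End Exchange.

Section ExchangeSqrt.
Variables (K : fieldType) (A : algType K).
Implicit Types (F G : fps A) (x : nat -> A).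

(* The lowest coefficient z_n of the defect Z of the exchange relation for G     *)
(* satisfies (c^n + c^-n) z_n = 0.                                             *)
Lemma exchange_sqrt (c : K) F G x : c != 0 ->
  (forall n, (0 < n)%N -> c ^+ n + c ^- n != 0) -> G 0%N = 1 ->
  dilate c G * dilate c^-1 G * F = 1 -> F * (dilate c G * dilate c^-1 G) = 1 ->
  exchange (c ^+ 2) (c ^- 2) F x -> exchange c^-1 c G x.
Proof.
move=> c0 cn G0 GF FG eF.
pose Z k := G * two_term x c^-1 k - two_term x c k * G.
suff Z0 n k : Z k n = 0 by move=> k; apply/subr0_eq/fpsP => n; exact: Z0.
have ZE k' : dilate c (Z k') * dilate c^-1 G + dilate c G * dilate c^-1 (Z k') = 0.
  have d1 : dilate c (two_term x c^-1 k') = dilate c^-1 (two_term x c k').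
    by rewrite !dilate_two_term mulrC.
  have := exchange_inv FG GF eF k'.
  have -> : two_term x (c ^- 2) k' = dilate c^-1 (two_term x c^-1 k').
    by rewrite dilate_two_term -invfM.
  have -> : two_term x (c ^+ 2) k' = dilate c (two_term x c k').
    by rewrite dilate_two_term.
  rewrite /Z; move: (two_term x c^-1 k') (two_term x c k') d1 => u v d1.
  by rewrite !(dilateD, dilateN, dilateM) d1 => e; apply: (nc_from e); nc_coefs K; ring.
elim/ltn_ind: n k => n IH k.
have [->|n0] := posnP n.
  by rewrite /Z two_termMl two_termMr !fpsE fpsMC fpsCM !fpsXM /= G0 mul1r mulr1 !scaler0 !subr0 subrr.
have := congr1 (fun f : fps A => f n) (ZE k); rewrite fpsD !fpsM.
have dZ d i : (i < n)%N -> dilate d (Z k) i = 0.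
  by move=> lt_in; rewrite /dilate IH ?scaler0.
rewrite big_ord_recr big1 => [|i _]; last by rewrite dZ ?mul0r /=.
rewrite big_ord_recl big1 => [|i _]; last by rewrite dZ ?mulr0 //= /bump /=; lia.
rewrite /= subnn subn0 {1 2 3 4}/dilate !expr0 !scale1r G0 add0r addr0 mulr1 mul1r.
rewrite -scalerDl exprVn => /eqP; rewrite scaler_eq0 => /orP[|/eqP //].
by rewrite (negPf (cn n n0)).
Qed.

End ExchangeSqrt.

(** * The alternating currents built from X and the real root currents *)

Section HalfCurrents.
Variables (K : fieldType) (q : K) (A : algType K).
Hypotheses (q0 : q != 0) (qnu : forall n, (0 < n)%N -> q ^+ n != 1).
Hypothesis charK : [pchar K] =i pred0.
Variables (x y : nat -> A) (F : fps A).
Hypothesis rs : root_system q x y.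
Hypothesis F0 : F 0%N = 0.
Hypothesis Fexp : ser_exp F = psi q x y.

Local Notation psi := (psi q x y : fps A).
Local Notation kap := (q - q^-1).
Local Notation t := (fpsX A).
Local Notation x0 := (fpsC (x 0%N)).
Local Notation y0 := (fpsC (y 0%N)).

Definition logX : fps A := fun n => - (q ^+ n + q ^- n)^-1 *: F n.
Definition logY : fps A := fun n => (q ^+ (2 * n) / (q ^+ n + q ^- n)) *: F n.
Definition seriesX : fps A := ser_exp logX.
Definition seriesY : fps A := ser_exp logY.
Local Notation X := seriesX.
Local Notation Y := seriesY.

Let psi_psi : ccomm psi psi. Proof. move=> i j; exact: psi_comm. Qed.
Let FF : ccomm F F.
Proof.
apply: ccomm_log => //; rewrite Fexp; apply/ccomm_sym/ccomm_log => //.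
by rewrite Fexp.
Qed.

Let ccommZ (f g : fps A) (c : nat -> K) : ccomm f g -> ccomm f (fun n => c n *: g n).
Proof. by move=> fg i j; rewrite -scalerAr -scalerAl fg. Qed.

Let fl : ccomm F logX. Proof. exact: ccommZ. Qed.
Let ll : ccomm logX logX. Proof. exact/ccommZ/ccomm_sym/fl. Qed.
Let lL : ccomm logX logY. Proof. exact/ccommZ/ccomm_sym/fl. Qed.
Let LL : ccomm logY logY. Proof. exact/ccommZ/ccomm_sym/ccommZ. Qed.
Let dil (f g : fps A) c : ccomm f g -> ccomm f (dilate c g).
Proof. exact: ccommZ. Qed.
Let logX0 : logX 0%N = 0. Proof. by rewrite /logX F0 scaler0. Qed.
Let logY0 : logY 0%N = 0. Proof. by rewrite /logY F0 scaler0. Qed.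
Let dilate0 (f : fps A) c : f 0%N = 0 -> dilate c f 0%N = 0.
Proof. by rewrite /dilate => ->; rewrite scaler0. Qed.

Lemma seriesX0 : X 0%N = 1.
Proof. exact: ser_exp0. Qed.

Lemma seriesX_comm : ccomm X X.
Proof. exact/ccomm_exp/ccomm_sym/ccomm_exp. Qed.

Lemma seriesX_psi : ccomm X psi.
Proof. by rewrite -Fexp; exact/ccomm_exp/ccomm_sym/ccomm_exp/fl. Qed.

(** On logarithms the two dilations multiply coefficient n by q^n + q^-n, which cancels the
    denominator and leaves -log psi. *)
Lemma seriesX_sqrt : dilate q X * dilate q^-1 X * psi = 1.
Proof.
rewrite -Fexp -!dilate_exp -!ser_expD ?dilate0 //.
- rewrite (_ : _ + _ + _ = 0) ?ser_exp_0 //; apply: fpsP => n.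
  rewrite !fpsD /dilate !scalerA -!scalerDl fps0.
  case: n => [|n]; first by rewrite F0 scaler0 addr0.
  rewrite -[X in _ + X]scale1r -scalerDl (_ : _ + 1 = 0) ?scale0r //.
  have := @qpow_add_neq0 K q q0 qnu n.+1 isT; rewrite exprVn.
  have : q ^+ n.+1 != 0 by rewrite expf_neq0.
  move: (q ^+ n.+1) => r r0 rr; field; rewrite r0 /=.
  by apply: contraNneq rr => e; rewrite -[r + _](mulfK r0) mulrDl mulVf // e mul0r.
- by rewrite fpsD !dilate0 ?addr0.
- have dd c d : ccomm (dilate c logX) (dilate d logX) by exact/dil/ccomm_sym/dil.
  by move=> i j; rewrite !fpsD !mulrDl !mulrDr !(dd q _ i) !(dd q^-1 _ i) addrACA.
- have dF c : ccomm F (dilate c logX) by exact/dil.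
  by move=> i j; rewrite !fpsD mulrDl mulrDr !dF.
- exact/dil/ccomm_sym/dil.
- exact/dil/ccomm_sym/dil.
- exact/dil/ccomm_sym/dil.
Qed.

Lemma seriesXY : dilate (q ^+ 2) X * Y = 1.
Proof.
rewrite -!dilate_exp -!ser_expD ?dilate0 //.
- rewrite (_ : _ + _ = 0) ?ser_exp_0 //; apply: fpsP => n.
  rewrite !fpsD /dilate !scalerA -!scalerDl fps0 -exprM.
  by rewrite mulrN addNr scale0r.
- exact/dil/ccomm_sym/dil.
- exact/ccomm_sym/dil/ccomm_sym.
Qed.

Let qn n : (0 < n)%N -> q ^+ n + q ^- n != 0.
Proof. by move=> n0; exact: (@qpow_add_neq0 K q q0 qnu n n0). Qed.
Let kap0 : kap != 0.
Proof. by have := @qpow_sub_neq0 K q q0 qnu 1 isT; rewrite expr1. Qed.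

Lemma psi_exchange_x : exchange (q ^+ 2) (q ^- 2) psi x.
Proof.
apply: exchangeP => [k|r k]; first by rewrite mul1r mulr1.
by have /subr0_eq := psi_xE q0 qnu charK rs r k.
Qed.

Lemma psi_exchange_y : exchange (q ^- 2) (q ^+ 2) psi y.
Proof.
apply: exchangeP => [k|r k]; first by rewrite mul1r mulr1.
by have /subr0_eq := psi_yE q0 qnu charK rs r k.
Qed.

Let dX_psi c : dilate c X * psi = psi * dilate c X.
Proof. exact/ccomm_mul/ccomm_sym/dil/ccomm_sym/seriesX_psi. Qed.
Let dX_dX c d : dilate c X * dilate d X = dilate d X * dilate c X.
Proof. exact/ccomm_mul/dil/ccomm_sym/dil/seriesX_comm. Qed.

Lemma X_exchange_x : exchange q^-1 q X x.
Proof.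
apply: (exchange_sqrt q0 qn seriesX0 seriesX_sqrt _ psi_exchange_x).
by rewrite mulrA -dX_psi -mulrA -dX_psi mulrA seriesX_sqrt.
Qed.

Lemma X_exchange_y : exchange q q^-1 X y.
Proof.
have q0' : q^-1 != 0 by rewrite invr_eq0.
rewrite -[X in exchange X]invrK; apply: (exchange_sqrt (F := psi)) => //.
- by move=> n n0; rewrite !exprVn invrK addrC qn.
- exact: seriesX0.
- by rewrite invrK dX_dX seriesX_sqrt.
- by rewrite invrK mulrA -dX_psi -mulrA -dX_psi mulrA dX_dX seriesX_sqrt.
- by rewrite exprVn invrK; exact: psi_exchange_y.
Qed.

Definition seriesPsi : fps A := dilate q psi.
Local Notation Psi := seriesPsi.

Lemma XPsiC : X * Psi = Psi * X.
Proof. exact/ccomm_mul/dil/seriesX_psi. Qed.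

Lemma YX : Y * dilate (q ^+ 2) X = 1.
Proof.
rewrite -seriesXY; apply/ccomm_mul/dil/ccomm_sym/ccomm_exp/ccomm_sym/ccomm_exp/ccomm_sym.
exact: lL.
Qed.

(** The previous identity dilated by q reads X(q^2 t) X(t) psi(qt) = 1, and Y inverts X(q^2 t). *)
Lemma YE : Y = X * Psi.
Proof.
have e : dilate (q ^+ 2) X * X * Psi = 1.
  have := congr1 (dilate q) seriesX_sqrt.
  by rewrite !dilateM !dilate_comp dilate1 mulfV // dilate_id.
by rewrite -[LHS]mulr1 -e !mulrA YX mul1r.
Qed.

Lemma Y_exchange_x : exchange (q ^+ 3) q Y x.
Proof.
rewrite YE; apply: exchangeM X_exchange_x _.
have := exchange_dilate q psi_exchange_x.
by rewrite -exprS (_ : q * q ^- 2 = q^-1) //; field.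
Qed.

Lemma Y_exchange_y : exchange q (q ^+ 3) Y y.
Proof.
rewrite YE XPsiC; apply: (exchangeM (b := q^-1)); last exact: X_exchange_y.
have := exchange_dilate q psi_exchange_y.
by rewrite -exprS (_ : q * q ^- 2 = q^-1) //; field.
Qed.

(* Up to scalars and the substitution of the variable, serA, serB, seriesX and  *)
(* serG are the images of the series of the W_{-k}, W_{k+1}, G_{k+1} and        *)
(* \tilde G_{k+1}.                                                             *)
Definition serXi : fps A := current q x 0.
Definition serEta : fps A := current q y 0.
Definition serA : fps A := X * serXi.
Definition serB : fps A := serEta * X.
Definition serG : fps A := Y - kap ^+ 2 *: (t * (serB * serXi)).
Local Notation a := serA.
Local Notation b := serB.
Local Notation g := serG.

Let X0c (z : nat -> A) k : X 0%N * z k = z k * X 0%N.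
Proof. by rewrite seriesX0 mulr1 mul1r. Qed.
Let Y0c (z : nat -> A) k : Y 0%N * z k = z k * Y 0%N.
Proof. by rewrite /Y ser_exp0 // mulr1 mul1r. Qed.

Let qq1 : q != q^-1. Proof. by rewrite -subr_eq0. Qed.

Lemma serA_qcomm : q *: (x0 * X) - q^-1 *: (X * x0) = kap *: a.
Proof. exact: (exchange_right (X0c x) X_exchange_x 0). Qed.

Lemma serB_qcomm : q *: (X * y0) - q^-1 *: (y0 * X) = kap *: b.
Proof.
have := exchange_left (X0c y) X_exchange_y 0.
rewrite -/serEta -/serB -[kap]opprB scaleNr => <-; rewrite opprB //.
Qed.

Lemma serY_qcomm_x : q *: (Y * x0) - q^-1 *: (x0 * Y) = kap *: (Y * serXi).
Proof.
have e := exchange_right (Y0c x) Y_exchange_x 0.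
apply: (nc_from (congr1 ( *:%R (- q ^- 2)) e)); rewrite -/serXi.
by nc_coefs K; field.
Qed.

Lemma serY_qcomm_y : q *: (y0 * Y) - q^-1 *: (Y * y0) = kap *: (serEta * Y).
Proof.
have e := exchange_left (Y0c y) Y_exchange_y 0.
apply: (nc_from (congr1 ( *:%R (q ^- 2)) e)); rewrite -/serEta.
by nc_coefs K; field.
Qed.

(** Homogeneity enters here through phi_{0,n} = psi_{n+1}; the mirror statement [eta_x0] only needs
    the definition of psi. *)
Lemma y0_xi : (kap * q) *: (t * (y0 * serXi - q ^- 2 *: (serXi * y0))) = Psi - 1.
Proof.
apply: fpsP => -[|n]; rewrite !fpsE fpsXM.
  by rewrite scaler0 /Psi /dilate expr0 scale1r subrr.
rewrite fpsD fpsN fpsZ fpsCM fpsMC /= subr0 /Psi /dilate /serXi /current add0n.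
rewrite -[n in RHS]add0n -(phiE q0 qnu charK rs) /phi.
by nc_coefs K; rewrite ?add0n ?addn0 (exprS q n); field.
Qed.

Lemma eta_x0 : (kap * q) *: (t * (serEta * x0 - q ^- 2 *: (x0 * serEta))) = Psi - 1.
Proof.
apply: fpsP => -[|n]; rewrite !fpsE fpsXM.
  by rewrite scaler0 /Psi /dilate expr0 scale1r subrr.
rewrite fpsD fpsN fpsZ fpsCM fpsMC /= subr0 /Psi /dilate /serEta /current add0n.
rewrite (_ : psi n.+1 = phi q x y n 0) // /phi.
by nc_coefs K; rewrite ?add0n ?addn0 (exprS q n); field.
Qed.

Let qm2 : 1 - q ^+ 2 != 0.
Proof. by rewrite subr_eq0 eq_sym qnu. Qed.

(* Obtained by summing the relations xx_rel z k l over k + l = n - 1. *)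
Lemma xx_sum (B : algType K) (z : nat -> B) n :
  (forall k l, xx_rel q z k l = 0) ->
  (1 - q ^- 2) *: (\sum_(i < n.+1) z i * z (n - i)%N) =
    z n * z 0%N - q ^- 2 *: (z 0%N * z n).
Proof.
case: n => [|n] e0.
  by rewrite big_ord1 subn0 /=; nc_coefs K; ring.
set T := \sum_(i < _) _.
have T1 : T = z 0%N * z n.+1 + \sum_(i < n.+1) z i.+1 * z (n - i)%N.
  by rewrite /T big_ord_recl subn0; congr (_ + _); apply: eq_bigr => i _.
have T2 : T = \sum_(i < n.+1) z i * z (n - i).+1 + z n.+1 * z 0%N.
  rewrite /T big_ord_recr subnn; congr (_ + _); apply: eq_bigr => i _ /=.
  by rewrite subSn // -ltnS.
have T3 : \sum_(i < n.+1) z i.+1 * z (n - i)%N =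
          \sum_(i < n.+1) z (n - i).+1 * z i.
  rewrite (reindex_inj rev_ord_inj); apply: eq_bigr => i _ /=.
  by rewrite subSS subKn // -ltnS.
have T4 : \sum_(i < n.+1) z i * z (n - i).+1 =
          \sum_(i < n.+1) z (n - i)%N * z i.+1.
  rewrite (reindex_inj rev_ord_inj); apply: eq_bigr => i _ /=.
  by rewrite subSS subKn // -ltnS.
have : \sum_(i < n.+1) xx_rel q z i (n - i) = 0 by rewrite big1.
rewrite /xx_rel !big_split /= !sumrN -!scaler_sumr -T3 -T4 => e.
have {T1}T1 : \sum_(i < n.+1) z i.+1 * z (n - i)%N = T - z 0%N * z n.+1.
  by rewrite T1 addrC addKr.
have {T2}T2 : \sum_(i < n.+1) z i * z (n - i).+1 = T - z n.+1 * z 0%N.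
  by rewrite T2 addrK.
move: e; rewrite T1 T2 => e.
have two : (2%:R : K) != 0 by have /pcharf0P -> := charK.
apply: (scalerI two); apply: (nc_from (congr1 ( *:%R (- q ^- 2)) e)).
by nc_coefs K; field.
Qed.

Lemma xi_x0 : (1 - q ^- 2) *: (serXi * serXi) = serXi * x0 - q ^- 2 *: (x0 * serXi).
Proof.
apply: fpsP => n; rewrite !fpsE fpsMC fpsCM fpsM.
transitivity (q ^+ n *: ((1 - q ^- 2) *: (\sum_(i < n.+1) x i * x (n - i)%N))).
  rewrite [RHS]scalerA [q ^+ n * _]mulrC -scalerA.
  congr (_ *: _); rewrite scaler_sumr; apply: eq_bigr => i _.
  by rewrite /serXi /current -scalerAl -scalerAr scalerA -exprD subnKC // -ltnS.
rewrite xx_sum; last exact: (xx_relE q0 qnu charK rs).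
by rewrite /serXi /current add0n; nc_coefs K; ring.
Qed.

Lemma y0_eta : (1 - q ^- 2) *: (serEta * serEta) = y0 * serEta - q ^- 2 *: (serEta * y0).
Proof.
apply: fpsP => n; rewrite !fpsE fpsMC fpsCM fpsM.
transitivity (q ^+ n *: ((1 - q ^- 2) *: (\sum_(i < n.+1) y i * y (n - i)%N))).
  rewrite [RHS]scalerA [q ^+ n * _]mulrC -scalerA.
  congr (_ *: _); rewrite scaler_sumr; apply: eq_bigr => i _.
  by rewrite /serEta /current -scalerAl -scalerAr scalerA -exprD subnKC // -ltnS.
have -> : \sum_(i < n.+1) y i * y (n - i)%N = \sum_(i < n.+1) y (n - i)%N * y i.
  rewrite (reindex_inj rev_ord_inj); apply: eq_bigr => i _ /=.
  by rewrite subSS subKn // -ltnS.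
have e : (1 - q ^- 2) *: (\sum_(i < n.+1) y (n - i)%N * y i) =
    y 0%N * y n - q ^- 2 *: (y n * y 0%N).
  exact: (@xx_sum A^c y n (yy_relE q0 qnu charK rs)).
by rewrite e /serEta /current add0n; nc_coefs K; ring.
Qed.

Lemma serA_comm_x0 : a * x0 = x0 * a.
Proof.
apply: (@nc_lin _ _ _ (- (X * ((1 - q ^- 2) *: (serXi * serXi) - (serXi * x0 - q ^- 2 *: (x0 * serXi))))
  - q^-1 *: ((q *: (x0 * X) - q^-1 *: (X * x0) - kap *: a) * serXi))).
  by rewrite xi_x0 serA_qcomm !subrr mulr0 mul0r scaler0 !oppr0 addr0.
by rewrite /a; nc_coefs K; field.
Qed.

Lemma serB_comm_y0 : b * y0 = y0 * b.
Proof.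
apply: (@nc_lin _ _ _ (((1 - q ^- 2) *: (serEta * serEta) - (y0 * serEta - q ^- 2 *: (serEta * y0))) * X
  + q^-1 *: (serEta * (q *: (X * y0) - q^-1 *: (y0 * X) - kap *: b)))).
  by rewrite y0_eta serB_qcomm !subrr mulr0 mul0r scaler0 addr0.
by rewrite /b; nc_coefs K; field.
Qed.

(** Multiply [y0_xi] by X on the left. Moving y_0 through X by [serB_qcomm] produces kap^2 t b xi,
    which is the correction by which g differs from Y = X Psi. *)
Lemma serG_commA : g - X = (1 - q ^- 2) *: (t * (y0 * a - a * y0)).
Proof.
have e : X * Psi - X = (kap * q) *: (t * (X * y0 * serXi - q ^- 2 *: (X * serXi * y0))).
  rewrite -[Z in _ - Z]mulr1 -mulrBr -y0_xi -scalerAr mulrA fpsX_comm -mulrA.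
  by nc_coefs K; ring.
apply: (@nc_lin _ _ _ (X * Psi - X - (kap * q) *:
    (t * (X * y0 * serXi - q ^- 2 *: (X * serXi * y0)))
    + kap *: (t * ((q *: (X * y0) - q^-1 *: (y0 * X) - kap *: b) * serXi)))).
  by rewrite -e serB_qcomm !subrr mul0r mulr0 scaler0 addr0.
by rewrite /g YE /a; nc_coefs K; field.
Qed.

Lemma serG_commB : g - X = (1 - q ^- 2) *: (t * (b * x0 - x0 * b)).
Proof.
have e : X * Psi - X = (kap * q) *: (t * (serEta * x0 * X - q ^- 2 *: (x0 * serEta * X))).
  rewrite XPsiC -[Z in _ - Z]mul1r -mulrBl -eta_x0 -scalerAl -mulrA.
  by nc_coefs K; ring.
apply: (@nc_lin _ _ _ (X * Psi - X - (kap * q) *: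
    (t * (serEta * x0 * X - q ^- 2 *: (x0 * serEta * X)))
    + kap *: (t * (serEta * (q *: (x0 * X) - q^-1 *: (X * x0) - kap *: a))))).
  by rewrite -e serA_qcomm !subrr !mulr0 scaler0 addr0.
by rewrite /g YE /a /b; nc_coefs K; field.
Qed.

Let tC (f : fps A) : f * t - t * f = 0.
Proof. by rewrite fpsX_comm subrr. Qed.

Lemma serG_qcomm_x : q *: (g * x0) - q^-1 *: (x0 * g) = kap *: a.
Proof.
have e : (kap * q) *: (t * ((serEta * x0 - q ^- 2 *: (x0 * serEta)) * a)) = Psi * a - a.
  by rewrite mulrA scalerAl eta_x0 mulrBl mul1r.
have eY : q *: (Y * x0) - q^-1 *: (x0 * Y) - kap *: (Psi * a) = 0.
  by rewrite serY_qcomm_x YE XPsiC -mulrA subrr.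
have eA : a * x0 - x0 * a = 0 by rewrite serA_comm_x0 subrr.
apply: (@nc_lin _ _ _ ((q *: (Y * x0) - q^-1 *: (x0 * Y) - kap *: (Psi * a))
  - kap *: ((kap * q) *: (t * ((serEta * x0 - q ^- 2 *: (x0 * serEta)) * a)) - (Psi * a - a))
  - (kap ^+ 2 * q) *: (t * (serEta * (a * x0 - x0 * a)))
  + (kap ^+ 2 / q) *: ((x0 * t - t * x0) * (serEta * a)))).
  by rewrite e eY eA tC !subrr !(mulr0, mul0r, scaler0, oppr0, addr0).
by rewrite /g /b /a; nc_coefs K; field.
Qed.

Lemma serG_qcomm_y : q *: (y0 * g) - q^-1 *: (g * y0) = kap *: b.
Proof.
have e : (kap * q) *: (b * (t * (y0 * serXi - q ^- 2 *: (serXi * y0)))) = b * Psi - b.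
  by rewrite scalerAr y0_xi mulrBr mulr1.
have eY : q *: (y0 * Y) - q^-1 *: (Y * y0) - kap *: (b * Psi) = 0.
  by rewrite serY_qcomm_y YE mulrA subrr.
have eB : b * y0 - y0 * b = 0 by rewrite serB_comm_y0 subrr.
apply: (@nc_lin _ _ _ ((q *: (y0 * Y) - q^-1 *: (Y * y0) - kap *: (b * Psi))
  - kap *: ((kap * q) *: (b * (t * (y0 * serXi - q ^- 2 *: (serXi * y0)))) - (b * Psi - b))
  + (kap ^+ 2 * q) *: (t * ((b * y0 - y0 * b) * serXi))
  + (kap ^+ 2 * q) *: ((b * t - t * b) * (y0 * serXi - q ^- 2 *: (serXi * y0)))
  - (kap ^+ 2 * q) *: ((y0 * t - t * y0) * (b * serXi)))).
  by rewrite e eY eB !tC !subrr !(mulr0, mul0r, scaler0, oppr0, addr0).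
by rewrite /g; nc_coefs K; field.
Qed.

(** The exchange relation for two fixed consecutive coefficients of X, summed into the x-current;
    the constant term is [serA_qcomm]. *)
Lemma X_xi m : let C k := fpsC (X k) in
  q *: (t * (C m.+1 * serXi - serXi * C m.+1) - (C m * serXi - serXi * C m)) =
  kap *: (fpsC (a m) - C m * serXi).
Proof.
move=> C; apply: fpsP => n; rewrite !fpsE fpsXM !fpsCM !fpsMC.
case: n => [|n].
  have := congr1 (fun f : fps A => f m) serA_qcomm; rewrite !fpsE fpsCM fpsMC => e.
  rewrite add0r /serXi /current /= expr0 scale1r addn0.
  by apply: (nc_from (congr1 ( *:%R (1)) e)); nc_coefs K; field.
rewrite !fpsE !fpsCM !fpsMC /serXi /current !add0n /=.
apply: (nc_from (congr1 ( *:%R (q ^+ n.+1)) (exchange_coef m n X_exchange_x))).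
by nc_coefs K; rewrite !(exprS q n); field.
Qed.

Lemma X_eta m : let C k := fpsC (X k) in
  q *: (t * (C m.+1 * serEta - serEta * C m.+1) - (C m * serEta - serEta * C m)) =
  - kap *: (fpsC (b m) - serEta * C m).
Proof.
move=> C; apply: fpsP => n; rewrite !fpsE fpsXM !fpsCM !fpsMC.
case: n => [|n].
  have := congr1 (fun f : fps A => f m) serB_qcomm; rewrite !fpsE fpsCM fpsMC => e.
  rewrite add0r /serEta /current /= expr0 scale1r addn0.
  by apply: (nc_from (congr1 ( *:%R (-1)) e)); nc_coefs K; field.
rewrite !fpsE !fpsCM !fpsMC /serEta /current !add0n /=.
apply: (nc_from (congr1 ( *:%R (q ^+ n.+1)) (exchange_coef m n X_exchange_y))).
by nc_coefs K; rewrite !(exprS q n); field.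
Qed.

(** Leibniz rule on eta X xi, with [X_eta] and [X_xi] at the outer factors; their terms eta X_m a
    cancel. *)
Lemma X_serB_xi m : let C k := fpsC (X k) in
  q *: (t * (C m.+1 * (b * serXi) - b * serXi * C m.+1) - (C m * (b * serXi) - b * serXi * C m)) =
  kap *: (b * fpsC (a m) - fpsC (b m) * a).
Proof.
move=> C; have eC k : C k * X - X * C k = 0.
  by apply: fpsP => n; rewrite /C !fpsE fpsCM fpsMC seriesX_comm subrr.
apply: (@nc_lin _ _ _
  ((q *: (t * (C m.+1 * serEta - serEta * C m.+1) - (C m * serEta - serEta * C m))
     - - kap *: (fpsC (b m) - serEta * C m)) * a
   + b * (q *: (t * (C m.+1 * serXi - serXi * C m.+1) - (C m * serXi - serXi * C m))
     - kap *: (fpsC (a m) - C m * serXi))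
   + q *: (t * (serEta * ((C m.+1 * X - X * C m.+1) * serXi)))
   - q *: (serEta * ((C m * X - X * C m) * serXi))
   + kap *: (serEta * ((C m * X - X * C m) * serXi))
   - q *: ((b * t - t * b) * (C m.+1 * serXi - serXi * C m.+1)))).
  by rewrite X_xi X_eta !eC !tC !subrr !(mulr0, mul0r, scaler0, oppr0, addr0).
by rewrite /a /b; nc_coefs K; field.
Qed.

Let XY_comm i j : X i * Y j = Y j * X i.
Proof.
by move: i j; apply/ccomm_sym/ccomm_exp/ccomm_sym/ccomm_exp; exact: lL.
Qed.

Lemma serG0 : g 0%N = 1.
Proof. by rewrite /g !fpsE fpsXM scaler0 subr0 /Y ser_exp0. Qed.

Let XG m n := X m * g n - g n * X m.

(** The X_i commute with the Y_j, so only the correction in g contributes. What matters is that the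
    right side is antisymmetric in m and n. *)
Lemma XG_rec m n :
  XG m.+1 n - XG m n.+1 = - (kap ^+ 3 / q) *: (b n * a m - b m * a n).
Proof.
have gS k : g k.+1 = Y k.+1 - kap ^+ 2 *: (b * serXi) k by rewrite /g !fpsE fpsXM.
have e := congr1 (fun f : fps A => f n) (X_serB_xi m).
move: e; rewrite !fpsE !fpsXM !fpsMC !fpsCM /XG gS.
case: n => [|n].
  rewrite serG0 => e; apply: (@nc_lin _ _ _ (- (kap ^+ 2 / q) *:
    (q *: (0 - (X m * (b * serXi) 0%N - (b * serXi) 0%N * X m)) - kap *: (b 0%N * a m - b m * a 0%N))
    - (X m * Y 1%N - Y 1%N * X m))).
    by rewrite e XY_comm !subrr scaler0 oppr0 addr0.
  by nc_coefs K; field.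
rewrite !fpsE !fpsMC !fpsCM gS => e.
apply: (@nc_lin _ _ _ (- (kap ^+ 2 / q) *:
    (q *: (X m.+1 * (b * serXi) n - (b * serXi) n * X m.+1
          - (X m * (b * serXi) n.+1 - (b * serXi) n.+1 * X m))
     - kap *: (b n.+1 * a m - b m * a n.+1))
    + (X m.+1 * Y n.+1 - Y n.+1 * X m.+1) - (X m * Y n.+2 - Y n.+2 * X m))).
  by rewrite e !XY_comm !subrr scaler0 oppr0 !addr0.
by nc_coefs K; field.
Qed.

(** By [XG_rec] the defect D(m, n) = XG m n - XG n m satisfies D(m+1, n) = D(m, n+1), and D(0, n) =
    0 because X_0 = g_0 = 1. *)
Lemma XG_sym m n : XG m n = XG n m.
Proof.
have step i j : XG i.+1 j - XG j i.+1 = XG i j.+1 - XG j.+1 i.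
  have e1 := XG_rec i j; have e2 := XG_rec j i.
  have : XG i.+1 j - XG i j.+1 = - (XG j.+1 i - XG j i.+1).
    by rewrite e1 e2 -scalerN opprB.
  by move=> e; apply: (nc_from e); nc_coefs K; ring.
apply/subr0_eq; elim: m n => [|m IH] n; last by rewrite step IH.
by rewrite /XG seriesX0 serG0 !mul1r !mulr1 !subrr.
Qed.

(** The commutator expands into a double sum over X_k X_l times an x whose index depends on the
    total only, hence is symmetric because the X_k commute. *)
Lemma X_serA_sym m n : X n.+1 * a m - a m * X n.+1 = X m.+1 * a n - a n * X m.+1.
Proof.
have xk j k : X j.+1 * x k - x k * X j.+1 = - kap *: (X * current q x k.+1) j.
  have := congr1 (fun f : fps A => f j) (exchange_right (X0c x) X_exchange_x k.+1).
  rewrite !fpsE fpsCM fpsMC scaleNr => <-.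
  by apply: (nc_from (exchange_coef j k X_exchange_x)); nc_coefs K; ring.
pose D i j := \sum_(k < i.+1) \sum_(l < j.+1)
  (X k * X l * (q ^+ (i - k + (j - l)) *: x (i - k + (j - l)).+1)).
have aE i : a i = \sum_(k < i.+1) X k * serXi (i - k)%N by [].
have comm i j : X j.+1 * a i - a i * X j.+1 = - kap *: D i j.
  rewrite aE mulr_sumr mulr_suml -sumrB scaler_sumr; apply: eq_bigr => k _.
  rewrite mulrA seriesX_comm -!mulrA -mulrBr /serXi /current -scalerAl -scalerAr -scalerBr.
  rewrite xk fpsM !scaler_sumr mulr_sumr; apply: eq_bigr => l _.
  rewrite /current add0n -!scalerAr !scalerA mulrA exprD.
  by congr (_ *: (_ * x _)); ring.
have Dsym i j : D i j = D j i.
  rewrite /D exchange_big /=; apply: eq_bigr => l _; apply: eq_bigr => k _.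
  by rewrite seriesX_comm [(i - k + _)%N]addnC.
by rewrite !comm Dsym.
Qed.

Lemma X_serB_sym m n : X n.+1 * b m - b m * X n.+1 = X m.+1 * b n - b n * X m.+1.
Proof.
have yk j k : X j.+1 * y k - y k * X j.+1 = kap *: (current q y k.+1 * X) j.
  have := congr1 (fun f : fps A => f j) (exchange_left (X0c y) X_exchange_y k.+1).
  rewrite !fpsE fpsCM fpsMC => e.
  apply: (nc_from (f_equal2 (fun u v => u - v) (exchange_coef j k X_exchange_y) e)).
  by nc_coefs K; ring.
pose D i j := \sum_(k < i.+1) \sum_(l < j.+1)
  ((q ^+ (k + l) *: y (k + l).+1) * (X (i - k)%N * X (j - l)%N)).
have bE i : b i = \sum_(k < i.+1) serEta k * X (i - k)%N by [].
have comm i j : X j.+1 * b i - b i * X j.+1 = kap *: D i j.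
  rewrite bE mulr_sumr mulr_suml -sumrB scaler_sumr; apply: eq_bigr => k _.
  rewrite -[serEta k * _ * _]mulrA [X (i - k)%N * _]seriesX_comm !mulrA -mulrBl.
  rewrite /serEta /current -scalerAl -scalerAr -scalerBr yk fpsM !scaler_sumr mulr_suml.
  apply: eq_bigr => l _.
  rewrite /current add0n -!scalerAl !scalerA -[y _ * _ * _]mulrA [X (i - k)%N * _]seriesX_comm exprD.
  by congr (_ *: (y _ * _)); ring.
have Dsym i j : D i j = D j i.
  rewrite /D exchange_big /=; apply: eq_bigr => l _; apply: eq_bigr => k _.
  by rewrite seriesX_comm [(k + _)%N]addnC.
by rewrite !comm Dsym.
Qed.

Let eta_dil : dilate q^-1 serEta = current 1 y 0.
Proof.
by apply: fpsP => n; rewrite /dilate /serEta /current scalerA -exprMn mulVf.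
Qed.
Let Xp := dilate q X.
Let Xm := dilate q^-1 X.

Let X_x : Xp * dilate q serXi = current 1 x 0 * Xp.
Proof.
have := exchange_current (X0c x) qq1 X_exchange_x 0 => /(congr1 (dilate q)).
rewrite !dilateM => ->; congr (_ * _); apply: fpsP => n.
by rewrite /dilate /current scalerA -exprMn mulfV.
Qed.

Let X_y : Xp * current 1 y 0 = dilate q serEta * Xp.
Proof.
have qq1' : q^-1 != q by rewrite eq_sym.
have := exchange_current (X0c y) qq1' X_exchange_y 0 => /(congr1 (dilate q)).
rewrite !dilateM => <-; congr (_ * _); apply: fpsP => n.
by rewrite /dilate /current scalerA -exprMn mulfV.
Qed.

Let X_b : Xp * dilate q^-1 b = dilate q b * Xm.
Proof. by rewrite !dilateM eta_dil mulrA X_y. Qed.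

(* The sum of Delta_left and Delta_right is the generating function of the     *)
(* relations Delta_{n+1} = 0.                                                  *)
Lemma Delta_left : Xp * dilate q^-1 g +
  (kap ^+ 2 / q) *: (t * (dilate q b * dilate q^-1 a)) = 1.
Proof.
have e1 : Xp * dilate q^-1 Y = 1.
  rewrite -[RHS](dilate1 A q^-1) -seriesXY dilateM dilate_comp.
  by congr (dilate _ _ * _); rewrite expr2 mulrA mulVf ?mul1r.
have e2 : Xp * dilate q^-1 b * dilate q^-1 serXi = dilate q b * dilate q^-1 a.
  by rewrite X_b /a dilateM mulrA.
rewrite -e2 /g dilateD dilateN dilateZ dilateM dilate_X dilateM.
apply: (@nc_lin _ _ _ (Xp * dilate q^-1 Y - 1
   - (kap ^+ 2 / q) *: ((Xp * t - t * Xp) * (dilate q^-1 b * dilate q^-1 serXi)))).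
  by rewrite e1 tC subrr mul0r scaler0 subr0.
by nc_coefs K; field.
Qed.

Let Xp_psi : Xp * psi = psi * Xp. Proof. exact: dX_psi. Qed.

(** All phi_{k,n-k} equal psi_{n+1}, so the coefficient is psi_{n+1} times a geometric sum of
    q^(2k), equal to q^(2n+2) - 1 after scaling. *)
Let eta_xi : (kap ^+ 2 * q) *: (t * (dilate q serEta * current 1 x 0
    - q ^- 2 *: (current 1 x 0 * dilate q serEta))) = dilate (q ^+ 2) psi - psi.
Proof.
have etaE n : dilate q serEta n = q ^+ (2 * n) *: y n.
  by rewrite /dilate /serEta /current add0n scalerA -exprD mul2n addnn.
have xE n : current 1 x 0 n = x n by rewrite /current expr1n scale1r.
apply: fpsP => -[|n]; rewrite !fpsE fpsXM.
  by rewrite scaler0 /dilate expr0 scale1r subrr.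
rewrite !fpsE !fpsM.
transitivity (\sum_(k < n.+1) (kap * q * q ^+ (2 * k)) *: phi q x y k (n - k)).
  rewrite [X in _ - _ *: X](reindex_inj rev_ord_inj) /= scaler_sumr -sumrB scaler_sumr.
  apply: eq_bigr => k _; rewrite subSS subKn -1?ltnS // !etaE !xE /phi.
  by nc_coefs K; ring.
transitivity (\sum_(k < n.+1) (kap * q * q ^+ (2 * k)) *: psi n.+1).
  apply: eq_bigr => k _; rewrite (phiE q0 qnu charK rs) subnKC // -ltnS //.
rewrite -scaler_suml /dilate -[X in _ = _ - X]scale1r -scalerBl; congr (_ *: _).
elim: n => [|n IH]; first by rewrite big_ord1; field.
by rewrite big_ord_recr /= IH exprM [Z in _ = Z - _]exprS; field.
Qed.

Lemma Delta_right : dilate q g * Xm +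
  (kap ^+ 2 / q) *: (t * (dilate q a * dilate q^-1 b)) = 1.
Proof.
have e1 : psi * Xp * Xm = 1 by rewrite -Xp_psi -mulrA -dX_psi mulrA seriesX_sqrt.
have ea : dilate q a = current 1 x 0 * Xp by rewrite dilateM X_x.
have eb : Xp * dilate q^-1 b = dilate q serEta * Xp * Xm by rewrite X_b dilateM.
have eY : dilate q Y = dilate (q ^+ 2) psi * Xp.
  by rewrite YE XPsiC dilateM /Psi dilate_comp -expr2.
have eg : dilate q g = dilate (q ^+ 2) psi * Xp
    - (kap ^+ 2 * q) *: (t * (dilate q serEta * (current 1 x 0 * Xp))).
  rewrite /g dilateD dilateN dilateZ dilateM dilate_X eY !dilateM -X_x -/Xp.
  by nc_coefs K; ring.
rewrite ea -[X in t * X]mulrA eb eg.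
apply: (@nc_lin (fps A) _ _ (psi * Xp * Xm - 1
   - ((kap ^+ 2 * q) *: (t * (dilate q serEta * current 1 x 0
    - q ^- 2 *: (current 1 x 0 * dilate q serEta)))
      - (dilate (q ^+ 2) psi - psi)) * (Xp * Xm))).
  by rewrite e1 eta_xi !subrr mul0r subr0.
by nc_coefs K; field.
Qed.

End HalfCurrents.

(** * The exchange relations between the alternating currents *)

Section AlternatingCore.
Variables (K : fieldType) (q : K).
Hypotheses (q0 : q != 0) (qnu : forall n, (0 < n)%N -> q ^+ n != 1).
Local Notation kap := (q - q^-1).

Let kap0 : kap != 0.
Proof. by have := @qpow_sub_neq0 K q q0 qnu 1 isT; rewrite expr1. Qed.
Let two0 : q + q^-1 != 0.
Proof. by have := @qpow_add_neq0 K q q0 qnu 1 isT; rewrite expr1. Qed.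
Let qm2 : 1 - q ^- 2 != 0.
Proof. by rewrite subr_eq0 eq_sym invr_eq1 qnu. Qed.

(** The part of the alternating relations that the series give directly, freed of the scalars k_+,
    k_- and stable under passing to the converse algebra. *)
Record alternating_core (A : algType K) (a b X g : nat -> A) : Prop := {
  core_aX : forall n, q *: (a 0%N * X n) - q^-1 *: (X n * a 0%N) = kap *: a n;
  core_bX : forall n, q *: (X n * b 0%N) - q^-1 *: (b 0%N * X n) = kap *: b n;
  core_ag : forall n, q *: (g n * a 0%N) - q^-1 *: (a 0%N * g n) = kap *: a n;
  core_bg : forall n, q *: (b 0%N * g n) - q^-1 *: (g n * b 0%N) = kap *: b n;
  core_ga : forall n,
    g n.+1 - X n.+1 = (1 - q ^- 2) *: (b 0%N * a n - a n * b 0%N);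
  core_gb : forall n,
    g n.+1 - X n.+1 = (1 - q ^- 2) *: (b n * a 0%N - a 0%N * b n);
  core_aa : forall n, a n * a 0%N = a 0%N * a n;
  core_bb : forall n, b n * b 0%N = b 0%N * b n;
  core_XX : forall m n, X m * X n = X n * X m;
  core_Xa : forall m n,
    X n.+1 * a m - a m * X n.+1 = X m.+1 * a n - a n * X m.+1;
  core_Xb : forall m n,
    X n.+1 * b m - b m * X n.+1 = X m.+1 * b n - b n * X m.+1;
  core_Xg : forall m n, X m * g n - g n * X m = X n * g m - g m * X n
}.

Lemma core_converse (A : algType K) (a b X g : nat -> A) :
  alternating_core a b X g -> @alternating_core A^c b a X g.
Proof.
case=> aX bX ag bg ga gb aa bb XX Xa Xb Xg; split=> //.
- by move=> n; exact: esym (bb n).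
- by move=> n; exact: esym (aa n).
- by move=> m n; exact: XX.
- move=> m n; have /(congr1 -%R) := Xb m n; rewrite !opprB => e; exact: e.
- move=> m n; have /(congr1 -%R) := Xa m n; rewrite !opprB => e; exact: e.
- move=> m n; have /(congr1 -%R) := Xg m n; rewrite !opprB => e; exact: e.
Qed.

Section Core.
Variables (A : algType K) (a b X g : nat -> A).
Hypothesis core : alternating_core a b X g.

(** Write a_{j+1} as a q-commutator of a_0 and X_{j+1}: [core_Xa] gives [a_i, a_{j+1}] =
    [a_j, a_{i+1}], and j descends to 0. *)
Lemma core_a_comm m n : a m * a n = a n * a m.
Proof.
pose c i j := a i * a j - a j * a i.
suff H j i : c i j = 0 by apply/subr0_eq; exact: H.
elim: j i => [|j IH] i; first by rewrite /c (core_aa core) // subrr.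
suff e : c i j.+1 = - c i.+1 j by rewrite e IH oppr0.
apply: (scalerI kap0); pose B k := q *: (a 0%N * X k) - q^-1 *: (X k * a 0%N) - kap *: a k.
pose D k := a k * a 0%N - a 0%N * a k.
pose s := X j.+1 * a i - a i * X j.+1 - (X i.+1 * a j - a j * X i.+1).
apply: (@nc_lin _ _ _ (- (a i * B j.+1 - B j.+1 * a i) + (a j * B i.+1 - B i.+1 * a j)
  - (q *: (a 0%N * s) - q^-1 *: (s * a 0%N))
  + (q *: (D i * X j.+1) - q^-1 *: (X j.+1 * D i))
  - (q *: (D j * X i.+1) - q^-1 *: (X i.+1 * D j)))).
  rewrite /B /D /s !(core_aX core) // !(core_aa core) // (core_Xa core) // !subrr.
  by rewrite !(mul0r, mulr0, scaler0, oppr0, addr0).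
by rewrite /B /D /s /c; nc_coefs K; field.
Qed.

(** Replace g by X through [core_ga]; the Jacobi identity and [a_m, a_n] = 0 make the added double
    commutators symmetric. *)
Lemma core_g_a m n : a m * g n.+1 - g n.+1 * a m = a n * g m.+1 - g m.+1 * a n.
Proof.
pose G k := g k.+1 - X k.+1 - (1 - q ^- 2) *: (b 0%N * a k - a k * b 0%N).
pose s := X n.+1 * a m - a m * X n.+1 - (X m.+1 * a n - a n * X m.+1).
pose c := a m * a n - a n * a m.
apply: (@nc_lin _ _ _ (a m * G n - G n * a m - (a n * G m - G m * a n) - s
  + (1 - q ^- 2) *: (b 0%N * c - c * b 0%N))).
  rewrite /G /s /c !(core_ga core) // (core_Xa core) // core_a_comm !subrr.
  by rewrite !(mul0r, mulr0, scaler0, oppr0, addr0).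
by rewrite /G /s /c; nc_coefs K; field.
Qed.

Let P m n := a m * b n - b n * a m.

(* The same difference is computed in terms of the commutators of the g_n in    *)
(* core_P_g; comparing the two shows that the g_n commute.                     *)
Lemma core_P_X m n :
  (kap * (1 - q ^- 2)) *: (P m.+1 n - P n.+1 m) =
  - (q *: (g n.+1 * X m.+1) - q^-1 *: (X m.+1 * g n.+1)
     - (q *: (g m.+1 * X n.+1) - q^-1 *: (X n.+1 * g m.+1))).
Proof.
pose B k := q *: (a 0%N * X k) - q^-1 *: (X k * a 0%N) - kap *: a k.
pose G k := g k.+1 - X k.+1 - (1 - q ^- 2) *: (b k * a 0%N - a 0%N * b k).
pose s := X n.+1 * b m - b m * X n.+1 - (X m.+1 * b n - b n * X m.+1).
pose c := X m.+1 * X n.+1 - X n.+1 * X m.+1.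
apply: (@nc_lin _ _ _ ((1 - q ^- 2) *: (- (B m.+1 * b n - b n * B m.+1)
    + (B n.+1 * b m - b m * B n.+1) - (q *: (a 0%N * s) - q^-1 *: (s * a 0%N)))
  + (q *: (G n * X m.+1) - q^-1 *: (X m.+1 * G n))
  - (q *: (G m * X n.+1) - q^-1 *: (X n.+1 * G m))
  - (q + q^-1) *: c)).
  rewrite /B /G /s /c !(core_aX core) // !(core_gb core) // (core_Xb core) // (core_XX core) // !subrr.
  by rewrite !(mul0r, mulr0, scaler0, oppr0, addr0).
by rewrite /P /B /G /s /c; nc_coefs K; field.
Qed.

End Core.

Section Symmetry.
Variables (A : algType K) (a b X g : nat -> A).
Hypothesis core : alternating_core a b X g.

Lemma core_b_comm m n : b m * b n = b n * b m.
Proof. exact: (@core_a_comm A^c b a X g (core_converse core) n m). Qed.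

Lemma core_g_b m n : b m * g n.+1 - g n.+1 * b m = b n * g m.+1 - g m.+1 * b n.
Proof.
have e := @core_g_a A^c b a X g (core_converse core) m n.
by rewrite -opprB -[RHS]opprB; congr (- _).
Qed.

Let P m n := a m * b n - b n * a m.

Lemma core_P_g m n :
  (kap * (1 - q ^- 2)) *: (P m.+1 n - P n.+1 m) =
  - ((q + q^-1) *: (g m.+1 * g n.+1 - g n.+1 * g m.+1)
     - (q *: (g m.+1 * X n.+1) - q^-1 *: (X n.+1 * g m.+1))
     + (q *: (g n.+1 * X m.+1) - q^-1 *: (X m.+1 * g n.+1))).
Proof.
pose B k := q *: (g k * a 0%N) - q^-1 *: (a 0%N * g k) - kap *: a k.
pose G k := g k.+1 - X k.+1 - (1 - q ^- 2) *: (b k * a 0%N - a 0%N * b k).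
pose s := b m * g n.+1 - g n.+1 * b m - (b n * g m.+1 - g m.+1 * b n).
apply: (@nc_lin _ _ _ ((1 - q ^- 2) *: (- (B m.+1 * b n - b n * B m.+1)
    + (B n.+1 * b m - b m * B n.+1) + (q *: (s * a 0%N) - q^-1 *: (a 0%N * s)))
  + (q *: (g m.+1 * G n) - q^-1 *: (G n * g m.+1))
  - (q *: (g n.+1 * G m) - q^-1 *: (G m * g n.+1)))).
  have sE : s = 0 by rewrite /s core_g_b subrr.
  rewrite sE /B /G !(core_ag core) // !(core_gb core) // !subrr.
  by rewrite !(mul0r, mulr0, scaler0, oppr0, addr0).
by rewrite /P /B /G /s; nc_coefs K; field.
Qed.

Lemma core_g_comm m n : g m.+1 * g n.+1 = g n.+1 * g m.+1.
Proof.
apply/subr0_eq/(scalerI two0); rewrite scaler0.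
have := core_P_g m n; rewrite (core_P_X core) => e.
by apply: (nc_from e); nc_coefs K; field.
Qed.

(** Index 0 is the agreement of the two formulas for g - X. The step compares [core_P_X] with its
    converse, the difference being governed by [core_Xg]. *)
Lemma core_a_b m n : a m * b n - b n * a m = a n * b m - b m * a n.
Proof.
pose N i j := P i j - P j i.
have kq : kap * (1 - q ^- 2) != 0 by rewrite mulf_neq0.
suff H j i : N i j = 0 by apply/subr0_eq; exact: H.
elim: j i => [|j IH] i.
  have := core_gb core i; rewrite (core_ga core) => /(scalerI qm2) e.
  by apply: (nc_from (esym e)); rewrite /N /P; nc_coefs K; ring.
suff e : N i j.+1 = - N i.+1 j by rewrite e IH oppr0.
apply: (scalerI kq).
have e1 := core_P_X core i j.
have e2 : (kap * (1 - q ^- 2)) *: (P j i.+1 - P i j.+1) =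
  - (q *: (X i.+1 * g j.+1) - q^-1 *: (g j.+1 * X i.+1)
     - (q *: (X j.+1 * g i.+1) - q^-1 *: (g i.+1 * X j.+1))).
  exact: (@core_P_X A^c b a X g (core_converse core) i j).
have e3 := core_Xg core i.+1 j.+1.
rewrite -/(P i.+1 j) -/(P j.+1 i) in e1.
apply: (@nc_lin _ _ _ (((kap * (1 - q ^- 2)) *: (P i.+1 j - P j.+1 i)
   + (q *: (g j.+1 * X i.+1) - q^-1 *: (X i.+1 * g j.+1)
     - (q *: (g i.+1 * X j.+1) - q^-1 *: (X j.+1 * g i.+1))))
  - ((kap * (1 - q ^- 2)) *: (P j i.+1 - P i j.+1)
   + (q *: (X i.+1 * g j.+1) - q^-1 *: (g j.+1 * X i.+1)
     - (q *: (X j.+1 * g i.+1) - q^-1 *: (g i.+1 * X j.+1))))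
  + (q + q^-1) *: (X i.+1 * g j.+1 - g j.+1 * X i.+1
     - (X j.+1 * g i.+1 - g i.+1 * X j.+1)))).
  by rewrite e1 e2 e3 !subrr !addNr !(scaler0, subr0, addr0).
by rewrite /N /P; nc_coefs K; field.
Qed.

End Symmetry.
End AlternatingCore.

(** * From the core relations to the defining relations, with scalars *)

Section AlternatingRelations.
Variables (K : fieldType) (q kp km : K).
Hypotheses (q0 : q != 0) (qnu : forall n, (0 < n)%N -> q ^+ n != 1).
Hypotheses (kp0 : kp != 0) (km0 : km != 0).
Local Notation kap := (q - q^-1).
Local Notation th := (q + q^-1).
Local Notation rho := (kp * km * (q + q^-1) ^+ 2).

Let kap0 : kap != 0.
Proof. by have := @qpow_sub_neq0 K q q0 qnu 1 isT; rewrite expr1. Qed.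
Let th0 : th != 0.
Proof. by have := @qpow_add_neq0 K q q0 qnu 1 isT; rewrite expr1. Qed.

Let qm : q * q - 1 != 0. Proof. by rewrite subr_eq0 -expr2 qnu. Qed.
Let qp : q * q + 1 != 0.
Proof.
by apply: contraNneq th0 => e; rewrite -[th](mulfK q0) mulrDl mulVf // e mul0r.
Qed.
Ltac nz := by rewrite ?q0 ?qm ?qp ?kp0 ?km0.

Section Relations.
Variables (A : algType K) (a b X g : nat -> A).
Hypothesis core : alternating_core q a b X g.
Hypothesis delta : forall n,
  (q ^+ n.+1 + q ^- n.+1) *: (X n.+1 + g n.+1)
  + (kap ^+ 2 / q) *: (\sum_(k < n.+1) q ^ (- n%:Z + 2 * k%:Z) *:
       (a k * b (n - k)%N + b k * a (n - k)%N))
  + \sum_(k < n) q ^ (- n%:Z + 1 + 2 * k%:Z) *: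
       (g k.+1 * X (n - k)%N + X k.+1 * g (n - k)%N) = 0.

(** The powers of q + q^-1 come from U = qu^2/(q + q^-1), since U^(-k-1) is (q + q^-1)^(k+1)
    (qu^2)^(-k-1). *)
Definition altW (i : int) : A :=
  match i with
  | Posz 0 => (- km * q) *: a 0%N
  | Posz k.+1 => (kp * q ^- 2 * th ^- k) *: b k
  | Negz k => (- km * q * th ^- k.+1) *: a k.+1
  end.
Definition altG (k : nat) : A := (rho / kap * th ^- k.+1) *: X k.+1.
Definition altGt (k : nat) : A := (rho / kap * th ^- k.+1) *: g k.+1.

Lemma altW_neg k : altW (- k%:Z) = (- km * q * th ^- k) *: a k.
Proof. by case: k => [|k] //; rewrite /= expr0 invr1 mulr1. Qed.

Lemma altW_pos k : altW (k%:Z + 1) = (kp * q ^- 2 * th ^- k) *: b k.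
Proof. by rewrite -PoszD addn1. Qed.

Let thS k : th ^- k.+1 = th^-1 * th ^- k.
Proof. by rewrite exprS invfM. Qed.

Lemma alt_relE x y : alt_rel q rho altW altG altGt x y -> x = y.
Proof.
have [aX bX ag bg ga gb aa bb XX Xa Xb Xg] := core.
have W0 : altW 0 = (- km * q) *: a 0%N by [].
have W1 : altW 1 = (kp * q ^- 2) *: b 0%N by rewrite /= expr0 invr1 mulr1.
have Wm k : altW (- k%:Z - 1) = (- km * q * (th^-1 * th ^- k)) *: a k.+1.
  by rewrite -thS -altW_neg; congr altW; lia.
have Wp k : altW (k%:Z + 2) = (kp * q ^- 2 * (th^-1 * th ^- k)) *: b k.+1.
  by rewrite -thS -altW_pos; congr altW; lia.
pose E := (W0, W1, Wm, Wp, altW_neg, altW_pos).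
case=> [k|k|k|k|k|k|k l|k l|k l|k l|k l|k l|k l|k l|k l|k l|n];
  rewrite /comm /qcomm ?E /altG /altGt ?thS.
(* Each relation is a scalar multiple of one core relation or of a consequence; symbolic powers are
   generalized before calling [field]. *)
- apply: (nc_from (congr1 ( *:%R (- (kp * km / kap * th ^- k))) (gb k))).
  by move: (th ^- k) => u; nc_coefs K; field; nz.
- apply: (nc_from (congr1 ( *:%R (- (kp * km / kap * th ^- k))) (ga k))).
  by move: (th ^- k) => u; nc_coefs K; field; nz.
- apply: (nc_from (congr1 ( *:%R (- km * q * (rho / kap) / th * th ^- k)) (aX k.+1))).
  by move: (th ^- k) => u; nc_coefs K; field; nz.
- apply: (nc_from (congr1 ( *:%R (- km * q * (rho / kap) / th * th ^- k)) (ag k.+1))).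
  by move: (th ^- k) => u; nc_coefs K; field; nz.
- apply: (nc_from (congr1 ( *:%R (kp / q ^+ 2 * (rho / kap) / th * th ^- k)) (bX k.+1))).
  by move: (th ^- k) => u; nc_coefs K; field; nz.
- apply: (nc_from (congr1 ( *:%R (kp / q ^+ 2 * (rho / kap) / th * th ^- k)) (bg k.+1))).
  by move: (th ^- k) => u; nc_coefs K; field; nz.
- apply: (nc_from (congr1 ( *:%R ((km * q) ^+ 2 * th ^- k * th ^- l)) (core_a_comm q0 qnu core k l))).
  by move: (th ^- k) (th ^- l) => u v; nc_coefs K; field; nz.
- apply: (nc_from (congr1 ( *:%R ((kp / q ^+ 2) ^+ 2 * th ^- k * th ^- l)) (core_b_comm q0 qnu core k l))).
  by move: (th ^- k) (th ^- l) => u v; nc_coefs K; field; nz.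
- apply: (nc_from (congr1 ( *:%R (- (km * kp / q) * th ^- k * th ^- l)) (core_a_b q0 qnu core k l))).
  by move: (th ^- k) (th ^- l) => u v; nc_coefs K; field; nz.
- apply: (nc_from (congr1 ( *:%R (km * q * (rho / kap) / th * th ^- k * th ^- l)) (Xa k l))).
  by move: (th ^- k) (th ^- l) => u v; nc_coefs K; field; nz.
- apply: (nc_from (congr1 ( *:%R (- (km * q * (rho / kap) / th) * th ^- k * th ^- l)) (core_g_a q0 qnu core k l))).
  by move: (th ^- k) (th ^- l) => u v; nc_coefs K; field; nz.
- apply: (nc_from (congr1 ( *:%R (- (kp / q ^+ 2 * (rho / kap) / th) * th ^- k * th ^- l)) (Xb k l))).
  by move: (th ^- k) (th ^- l) => u v; nc_coefs K; field; nz.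
- apply: (nc_from (congr1 ( *:%R (kp / q ^+ 2 * (rho / kap) / th * th ^- k * th ^- l)) (core_g_b q0 qnu core k l))).
  by move: (th ^- k) (th ^- l) => u v; nc_coefs K; field; nz.
- apply: (nc_from (congr1 ( *:%R ((rho / kap / th) ^+ 2 * th ^- k * th ^- l)) (XX k.+1 l.+1))).
  by move: (th ^- k) (th ^- l) => u v; nc_coefs K; field; nz.
- apply: (nc_from (congr1 ( *:%R ((rho / kap / th) ^+ 2 * th ^- k * th ^- l)) (core_g_comm q0 qnu core k l))).
  by move: (th ^- k) (th ^- l) => u v; nc_coefs K; field; nz.
- apply: (nc_from (congr1 ( *:%R ((rho / kap / th) ^+ 2 * th ^- k * th ^- l)) (Xg k.+1 l.+1))).
  by move: (th ^- k) (th ^- l) => u v; nc_coefs K; field; nz.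
rewrite /alt_Delta.
pose c := rho / kap * th ^- n.+1.
apply: (@nc_lin _ _ _ ((c / (q ^+ n.+1 + q ^- n.+1)) *: ((q ^+ n.+1 + q ^- n.+1) *: (X n.+1 + g n.+1)
  + (kap ^+ 2 / q) *: (\sum_(k < n.+1) q ^ (- n%:Z + 2 * k%:Z) *:
       (a k * b (n - k)%N + b k * a (n - k)%N))
  + \sum_(k < n) q ^ (- n%:Z + 1 + 2 * k%:Z) *:
       (g k.+1 * X (n - k)%N + X k.+1 * g (n - k)%N)))).
  by rewrite delta scaler0.
have qn0 : q ^+ n.+1 + q ^- n.+1 != 0 by apply: qpow_add_neq0.
rewrite subr0 !scalerDr [c / _ *: (_ *: X _)]scalerA [c / _ *: (_ *: g _)]scalerA mulfVK //.
congr (_ + _ + _).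
- rewrite -scaleNr [RHS]scalerA !scaler_sumr; apply: eq_bigr => k _.
  have kn : (k <= n)%N by rewrite -ltnS.
  rewrite (_ : n%:Z + 1 - k%:Z = (n - k)%N%:Z + 1); last by lia.
  rewrite (_ : k%:Z - n%:Z = - (n - k)%N%:Z); last by lia.
  rewrite !altW_neg !altW_pos -!scalerAl -!scalerAr.
  have -> : c = rho / kap * (th^-1 * (th ^- k * th ^- (n - k))).
    by rewrite /c thS -[th ^- k * _]invfM -exprD subnKC.
  move: (q ^+ n.+1 + q ^- n.+1) qn0 (th ^- k) (th ^- (n - k)) (q ^ _) => d d0 u v w.
  by nc_coefs K; field; rewrite q0 qm qp d0.
rewrite !scaler_sumr; apply: eq_bigr => k _.
have kn : (k < n)%N by [].
rewrite subnSK // -!scalerAl -!scalerAr.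
have -> : c = rho / kap * (th ^- k.+1 * th ^- (n - k)).
  by rewrite /c -invfM -exprD addSn subnKC // ltnW.
move: (q ^+ n.+1 + q ^- n.+1) qn0 (th ^- k.+1) (th ^- (n - k)) (q ^ _) => d d0 u v w.
by nc_coefs K; field; rewrite ?kp0 ?km0 ?q0 ?qm ?qp ?d0.
Qed.
End Relations.
End AlternatingRelations.

(** * The currents of the root vectors satisfy the core relations *)

Section CoreOfRoots.
Variables (K : fieldType) (q : K) (A : algType K).
Hypotheses (q0 : q != 0) (qnu : forall n, (0 < n)%N -> q ^+ n != 1).
Hypothesis charK : [pchar K] =i pred0.
Variables (x y : nat -> A) (F : fps A).
Hypothesis rs : root_system q x y.
Hypothesis F0 : F 0%N = 0.
Hypothesis Fexp : ser_exp F = psi q x y.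
Local Notation kap := (q - q^-1).
Local Notation a := (serA q x F).
Local Notation b := (serB q y F).
Local Notation g := (serG q x y F).
Local Notation X := (seriesX q F).

Lemma serA0 : a 0%N = x 0%N.
Proof.
by rewrite /serA fpsM big_ord1 subnn seriesX0 // mul1r /serXi /current /= expr0 scale1r.
Qed.

Lemma serB0 : b 0%N = y 0%N.
Proof.
by rewrite /serB fpsM big_ord1 subnn seriesX0 // mulr1 /serEta /current /= expr0 scale1r.
Qed.

Lemma root_alternating_core : alternating_core q a b X g.
Proof.
have coef n (f h : fps A) : f = h -> f n = h n by move=> ->.
split.
- move=> n; have := coef n _ _ (serA_qcomm q0 qnu charK rs F0 Fexp).
  by rewrite !fpsE fpsCM fpsMC serA0.
- move=> n; have := coef n _ _ (serB_qcomm q0 qnu charK rs F0 Fexp).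
  by rewrite !fpsE fpsCM fpsMC serB0.
- move=> n; have := coef n _ _ (serG_qcomm_x q0 qnu charK rs F0 Fexp).
  by rewrite !fpsE fpsCM fpsMC serA0.
- move=> n; have := coef n _ _ (serG_qcomm_y q0 qnu charK rs F0 Fexp).
  by rewrite !fpsE fpsCM fpsMC serB0.
- move=> n; have := coef n.+1 _ _ (serG_commA q0 qnu charK rs F0 Fexp).
  by rewrite !fpsE fpsXM !fpsE fpsCM fpsMC serB0.
- move=> n; have := coef n.+1 _ _ (serG_commB q0 qnu charK rs F0 Fexp).
  by rewrite !fpsE fpsXM !fpsE fpsCM fpsMC serA0.
- move=> n; have := coef n _ _ (serA_comm_x0 q0 qnu charK rs F0 Fexp).
  by rewrite fpsCM fpsMC serA0.
- move=> n; have := coef n _ _ (serB_comm_y0 q0 qnu charK rs F0 Fexp).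
  by rewrite fpsCM fpsMC serB0.
- exact: (seriesX_comm q0 qnu charK rs F0 Fexp).
- exact: (X_serA_sym q0 qnu charK rs F0 Fexp).
- exact: (X_serB_sym q0 qnu charK rs F0 Fexp).
- exact: (XG_sym q0 qnu charK rs F0 Fexp).
Qed.

(** Coefficient n+1 of [Delta_left] and [Delta_right], added. The extreme terms of the products of X
    and g, where one factor is 1, give the leading term; the inner ones give the last sum. *)
Lemma root_delta_rel n :
  (q ^+ n.+1 + q ^- n.+1) *: (X n.+1 + g n.+1)
  + (kap ^+ 2 / q) *: (\sum_(k < n.+1) q ^ (- n%:Z + 2 * k%:Z) *:
       (a k * b (n - k)%N + b k * a (n - k)%N))
  + \sum_(k < n) q ^ (- n%:Z + 1 + 2 * k%:Z) *:
       (g k.+1 * X (n - k)%N + X k.+1 * g (n - k)%N) = 0.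
Proof.
pose T (f h : nat -> A) : A :=
  \sum_(k < n.+1) q ^ (- n%:Z + 2 * k%:Z) *: (f k * h (n - k)%N).
pose V (f h : nat -> A) : A :=
  \sum_(k < n) q ^ (- n%:Z + 1 + 2 * k%:Z) *: (f k.+1 * h (n - k)%N).
have dM (f h : fps A) m : (dilate q f * dilate q^-1 h) m =
    \sum_(k < m.+1) q ^ (- m%:Z + 2 * k%:Z) *: (f k * h (m - k)%N).
  rewrite fpsM; apply: eq_bigr => k _; rewrite /dilate -scalerAl -scalerAr scalerA.
  congr (_ *: _); rewrite exprVn exprnN exprnP -expfzDr //; congr (q ^ _).
  by have : (k <= m)%N by [rewrite -ltnS]; lia.
have dMn (f h : fps A) : (dilate q f * dilate q^-1 h) n = T f h by exact: dM.
have dMS (f h : fps A) : (dilate q f * dilate q^-1 h) n.+1 =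
    q ^- n.+1 *: (f 0%N * h n.+1) + V f h + q ^+ n.+1 *: (f n.+1 * h 0%N).
  rewrite dM big_ord_recr big_ord_recl /= subnn subn0; congr (_ *: _ + _ + _ *: _).
  - by rewrite mulr0 addr0 exprnN.
  - by apply: eq_bigr => k _; congr (q ^ _ *: _); rewrite /bump /=; lia.
  - by rewrite exprnP; congr (q ^ _); lia.
have eR : (dilate q g * dilate q^-1 X) n.+1 + (kap ^+ 2 / q) *: T a b = 0.
  have := congr1 (fun f : fps A => f n.+1) (Delta_right q0 qnu charK rs F0 Fexp).
  by rewrite !fpsE fpsXM dMn.
have eL : (dilate q X * dilate q^-1 g) n.+1 + (kap ^+ 2 / q) *: T b a = 0.
  have := congr1 (fun f : fps A => f n.+1) (Delta_left q0 qnu charK rs F0 Fexp).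
  by rewrite !fpsE fpsXM dMn.
move: eR eL; rewrite !dMS !seriesX0 // !serG0 // !mul1r !mulr1 => eR eL.
have -> : \sum_(k < n.+1) q ^ (- n%:Z + 2 * k%:Z) *:
    (a k * b (n - k)%N + b k * a (n - k)%N) = T a b + T b a.
  by rewrite -big_split; apply: eq_bigr => k _; rewrite scalerDr.
have -> : \sum_(k < n) q ^ (- n%:Z + 1 + 2 * k%:Z) *:
    (g k.+1 * X (n - k)%N + X k.+1 * g (n - k)%N) = V g X + V X g.
  by rewrite -big_split; apply: eq_bigr => k _; rewrite scalerDr.
move: (T a b) (T b a) (V g X) (V X g) eR eL => t1 t2 v1 v2 eR eL.
by apply: (nc_from (f_equal2 (fun u v => u + v) eR eL)); nc_coefs K; ring.
Qed.

End CoreOfRoots.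

(** * The universal property of a presented algebra *)

Section FreeEval.
Variables (K : fieldType) (I : choiceType) (B : algType K) (v : I -> B).

Definition word_eval (m : {fmonom I}) : B := \prod_(i <- (m : seq I)) v i.

Fact word_eval_mmorphism : mmorphism word_eval.
Proof.
split=> [m1 m2|]; last by rewrite /word_eval fm1 big_nil.
by rewrite /word_eval fmM big_cat.
Qed.
HB.instance Definition _ :=
  monalg.isMultiplicative.Build {fmonom I} B word_eval word_eval_mmorphism.

Definition free_eval (x : free_alg K I) : B := mmap (in_alg B) word_eval x.

Fact free_eval_multiplicative : monoid_morphism free_eval.
Proof.
have [|fM f1] := @commr_mmap_is_multiplicative _ _ _ (in_alg B) word_eval; last by split.
by move=> g m m'; rewrite /GRing.comm /= -scalerAl -scalerAr mul1r mulr1.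
Qed.

Fact free_eval_linear : linear free_eval.
Proof.
move=> k x y; rewrite /free_eval mmapD; congr (_ + _).
by rewrite mmapZ /= -scalerAl mul1r.
Qed.

HB.instance Definition _ := GRing.isLinear.Build K (free_alg K I) B _ free_eval
  free_eval_linear.

HB.instance Definition _ := GRing.isMonoidMorphism.Build (free_alg K I) B free_eval
  free_eval_multiplicative.

Lemma free_eval_gen i : free_eval (free_gen K i) = v i.
Proof.
rewrite /free_gen -lock /free_eval mmapU /= scale1r mul1r /word_eval fmU.
by rewrite big_seq1.
Qed.

End FreeEval.

Section Generators.
Variables (K : fieldType) (I : choiceType) (B : algType K).

Lemma malg_wordM (m1 m2 : {fmonom I}) :
  << mmul m1 m2 >> = << m1 >> * << m2 >> :> {malg K[{fmonom I}]}.
Proof. by rewrite malgM_def fgmulUU mulr1. Qed.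

Lemma malg_word (m : {fmonom I}) :
  << m >> = \prod_(i <- (m : seq I)) free_gen K i :> free_alg K I.
Proof.
case: m => s; elim: s => [|i s IH] /=.
  by rewrite big_nil -[RHS]/(<< mone >> : {malg K[{fmonom I}]}); congr << _ >>; apply/eqP; rewrite fmP fm1.
rewrite big_cons -IH /free_gen -lock -[RHS]malg_wordM; congr << _ >>.
by apply/eqP; rewrite fmP fmM fmU.
Qed.

Lemma free_alg_eq (f g : {lrmorphism free_alg K I -> B}) :
  (forall i, f (free_gen K i) = g (free_gen K i)) -> f =1 g.
Proof.
move=> fg x.
have -> : x = \sum_(m <- msupp x) x@_m *: \prod_(i <- (m : seq I)) free_gen K i.
  rewrite [LHS]monalgE; apply: eq_bigr => m _; rewrite -malg_word.
  by apply/malgP => m'; rewrite mcoeffZ !mcoeffU; case: eqP => _; rewrite ?mulr1 ?mulr0.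
rewrite !raddf_sum; apply: eq_bigr => m _ /=; rewrite !linearZ /= !rmorph_prod.
by congr (_ *: _); apply: eq_bigr => i _; exact: fg.
Qed.

End Generators.

Section Lift.
Variables (K : fieldType) (I : choiceType).
Variable rel : free_alg K I -> free_alg K I -> Prop.
Variable aug : rel_augmented rel.
Local Notation Q := (presented aug).
Variable B : algType K.

Lemma presented_eq (f g : {lrmorphism Q -> B}) :
  (forall i, f (presented_gen aug i) = g (presented_gen aug i)) -> f =1 g.
Proof.
move=> fg; elim/presented_ind => x.
exact: (@free_alg_eq _ _ _ (f \o presented_pi aug) (g \o presented_pi aug)).
Qed.

Variable v : I -> B.
Hypothesis v_rel : forall x y, rel x y -> free_eval v x = free_eval v y.

(** The proof is an argument so that the morphism structures can be declared on [lift v_rel]. *)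
Definition lift (_ : forall x y, rel x y -> free_eval v x = free_eval v y)
  (a : Q) : B := free_eval v (repr a).

Lemma lift_pi x : lift v_rel (presented_pi aug x) = free_eval v x.
Proof.
apply/subr0_eq; rewrite -raddfB /=.
have := presented_repr aug x; move: (repr _ - x) => z.
elim=> [y y' /v_rel e||y y' _ e _ e'|a y b _ e].
- by rewrite raddfB /= e subrr.
- exact: raddf0.
- by rewrite raddfD /= e e' addr0.
- by rewrite !rmorphM /= e mulr0 mul0r.
Qed.

Fact lift_linear : linear (lift v_rel).
Proof.
move=> k; elim/presented_ind => x; elim/presented_ind => y.
by rewrite -linearP !lift_pi linearP.
Qed.

Fact lift_multiplicative : monoid_morphism (lift v_rel).
Proof.
split; first by rewrite -(rmorph1 (presented_pi aug)) lift_pi rmorph1.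
elim/presented_ind => x; elim/presented_ind => y.
by rewrite -rmorphM !lift_pi rmorphM.
Qed.

HB.instance Definition _ := GRing.isLinear.Build K Q B _ (lift v_rel)
  lift_linear.
HB.instance Definition _ := GRing.isMonoidMorphism.Build Q B (lift v_rel)
  lift_multiplicative.

Lemma lift_gen i : lift v_rel (presented_gen aug i) = v i.
Proof. by rewrite lift_pi free_eval_gen. Qed.

Definition lift_morphism : {lrmorphism Q -> B} := lift v_rel.

End Lift.

Section RelMorphism.
Variables (K : fieldType) (A B : algType K).

Section Fun.
Variable f : A -> B.
Hypotheses (fD : forall x y, f (x + y) = f x + f y)
  (fB : forall x y, f (x - y) = f x - f y)
  (fM : forall x y, f (x * y) = f x * f y)
  (fZ : forall c x, f (c *: x) = c *: f x) (f0 : f 0 = 0).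

Let fS n (F : 'I_n -> A) : f (\sum_i F i) = \sum_i f (F i).
Proof.
elim: n F => [|n IH] F; first by rewrite !big_ord0.
by rewrite !big_ord_recl fD IH.
Qed.

Let fc u w : f (comm u w) = comm (f u) (f w).
Proof. by rewrite /comm fB !fM. Qed.
Let fcc u w u' w' :
  f (comm u w + comm u' w') = comm (f u) (f w) + comm (f u') (f w').
Proof. by rewrite fD !fc. Qed.
Let fq c u w : f (qcomm c u w) = qcomm c (f u) (f w).
Proof. by rewrite /qcomm fB !fZ !fM. Qed.

Lemma alt_Delta_fun q rho (W : int -> A) (G Gt : nat -> A) n :
  f (alt_Delta q rho W G Gt n) = alt_Delta q rho (f \o W) (f \o G) (f \o Gt) n.
Proof.
rewrite /alt_Delta fD fB fD !fZ !fS; congr (_ - _ *: _ + _ *: _);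
  by apply: eq_bigr => k _; rewrite fZ fD !fM.
Qed.

Lemma alt_rel_fun q rho (W : int -> A) (G Gt : nat -> A) x y :
  alt_rel q rho W G Gt x y ->
  alt_rel q rho (f \o W) (f \o G) (f \o Gt) (f x) (f y).
Proof.
case=> [k|k|k|k|k|k|k l|k l|k l|k l|k l|k l|k l|k l|k l|k l|n].
all: rewrite ?f0 ?fcc ?fc ?fq ?fZ ?fB.
- exact: (@alt_rel_W0W _ _ _ _ (f \o W) (f \o G) (f \o Gt) k).
- exact: (@alt_rel_WW1 _ _ _ _ (f \o W) (f \o G) (f \o Gt) k).
- exact: (@alt_rel_W0G _ _ _ _ (f \o W) (f \o G) (f \o Gt) k).
- exact: (@alt_rel_GtW0 _ _ _ _ (f \o W) (f \o G) (f \o Gt) k).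
- exact: (@alt_rel_GW1 _ _ _ _ (f \o W) (f \o G) (f \o Gt) k).
- exact: (@alt_rel_W1Gt _ _ _ _ (f \o W) (f \o G) (f \o Gt) k).
- exact: (@alt_rel_WmWm _ _ _ _ (f \o W) (f \o G) (f \o Gt) k l).
- exact: (@alt_rel_WpWp _ _ _ _ (f \o W) (f \o G) (f \o Gt) k l).
- exact: (@alt_rel_WmWp _ _ _ _ (f \o W) (f \o G) (f \o Gt) k l).
- exact: (@alt_rel_WmG _ _ _ _ (f \o W) (f \o G) (f \o Gt) k l).
- exact: (@alt_rel_WmGt _ _ _ _ (f \o W) (f \o G) (f \o Gt) k l).
- exact: (@alt_rel_WpG _ _ _ _ (f \o W) (f \o G) (f \o Gt) k l).
- exact: (@alt_rel_WpGt _ _ _ _ (f \o W) (f \o G) (f \o Gt) k l).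
- exact: (@alt_rel_GG _ _ _ _ (f \o W) (f \o G) (f \o Gt) k l).
- exact: (@alt_rel_GtGt _ _ _ _ (f \o W) (f \o G) (f \o Gt) k l).
- exact: (@alt_rel_GtG _ _ _ _ (f \o W) (f \o G) (f \o Gt) k l).
rewrite alt_Delta_fun; exact: alt_rel_Delta.
Qed.

(** Used for the projection from the free algebra: a relation between the generators of [Aq] comes
    from one that was factored out. *)
Lemma alt_rel_fun_lift q rho (W : int -> A) (G Gt : nat -> A) x' y' :
  alt_rel q rho (f \o W) (f \o G) (f \o Gt) x' y' ->
  exists x y, [/\ alt_rel q rho W G Gt x y, f x = x' & f y = y'].
Proof.
case=> [k|k|k|k|k|k|k l|k l|k l|k l|k l|k l|k l|k l|k l|k l|n].
- by do 2 eexists; split; [exact: (alt_rel_W0W _ _ _ _ _ k)| |]; rewrite ?fc ?fq ?fZ ?fB.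
- by do 2 eexists; split; [exact: (alt_rel_WW1 _ _ _ _ _ k)| |]; rewrite ?fc ?fq ?fZ ?fB.
- by do 2 eexists; split; [exact: (alt_rel_W0G _ _ _ _ _ k)| |]; rewrite ?fc ?fq ?fZ ?fB.
- by do 2 eexists; split; [exact: (alt_rel_GtW0 _ _ _ _ _ k)| |]; rewrite ?fc ?fq ?fZ ?fB.
- by do 2 eexists; split; [exact: (alt_rel_GW1 _ _ _ _ _ k)| |]; rewrite ?fc ?fq ?fZ ?fB.
- by do 2 eexists; split; [exact: (alt_rel_W1Gt _ _ _ _ _ k)| |]; rewrite ?fc ?fq ?fZ ?fB.
- by do 2 eexists; split; [exact: (alt_rel_WmWm _ _ _ _ _ k l)| |]; rewrite ?f0 ?fcc ?fc.
- by do 2 eexists; split; [exact: (alt_rel_WpWp _ _ _ _ _ k l)| |]; rewrite ?f0 ?fcc ?fc.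
- by do 2 eexists; split; [exact: (alt_rel_WmWp _ _ _ _ _ k l)| |]; rewrite ?f0 ?fcc ?fc.
- by do 2 eexists; split; [exact: (alt_rel_WmG _ _ _ _ _ k l)| |]; rewrite ?f0 ?fcc ?fc.
- by do 2 eexists; split; [exact: (alt_rel_WmGt _ _ _ _ _ k l)| |]; rewrite ?f0 ?fcc ?fc.
- by do 2 eexists; split; [exact: (alt_rel_WpG _ _ _ _ _ k l)| |]; rewrite ?f0 ?fcc ?fc.
- by do 2 eexists; split; [exact: (alt_rel_WpGt _ _ _ _ _ k l)| |]; rewrite ?f0 ?fcc ?fc.
- by do 2 eexists; split; [exact: (alt_rel_GG _ _ _ _ _ k l)| |]; rewrite ?f0 ?fcc ?fc.
- by do 2 eexists; split; [exact: (alt_rel_GtGt _ _ _ _ _ k l)| |]; rewrite ?f0 ?fcc ?fc.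
- by do 2 eexists; split; [exact: (alt_rel_GtG _ _ _ _ _ k l)| |]; rewrite ?f0 ?fcc ?fc.
by do 2 eexists; split; [exact: (alt_rel_Delta _ _ _ _ _ n)| |]; rewrite ?f0 ?alt_Delta_fun.
Qed.

Lemma serre_rel_fun q (E : 'I_2 -> A) x y :
  serre_rel q E x y -> serre_rel q (f \o E) (f x) (f y).
Proof. by case=> i j ij; rewrite fc !fq f0; exact: (@serre_rel_intro _ _ _ (f \o E)). Qed.

End Fun.

Variable f : {lrmorphism A -> B}.

Lemma alt_rel_morph q rho (W : int -> A) (G Gt : nat -> A) x y :
  alt_rel q rho W G Gt x y ->
  alt_rel q rho (f \o W) (f \o G) (f \o Gt) (f x) (f y).
Proof.
apply: alt_rel_fun; [exact: raddfD|exact: raddfB|exact: rmorphM|exact: linearZZ|exact: raddf0].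
Qed.

Lemma serre_rel_morph q (E : 'I_2 -> A) x y :
  serre_rel q E x y -> serre_rel q (f \o E) (f x) (f y).
Proof.
apply: serre_rel_fun; [exact: raddfB|exact: rmorphM|exact: linearZZ|exact: raddf0].
Qed.

Lemma alt_rel_morph_lift q rho (W : int -> A) (G Gt : nat -> A) x' y' :
  alt_rel q rho (f \o W) (f \o G) (f \o Gt) x' y' ->
  exists x y, [/\ alt_rel q rho W G Gt x y, f x = x' & f y = y'].
Proof.
apply: alt_rel_fun_lift; [exact: raddfD|exact: raddfB|exact: rmorphM|exact: linearZZ|exact: raddf0].
Qed.

Lemma lrmorph_comm u w : f (comm u w) = comm (f u) (f w).
Proof. by rewrite /comm raddfB /= !rmorphM. Qed.

Lemma lrmorph_qcomm c u w : f (qcomm c u w) = qcomm c (f u) (f w).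
Proof. by rewrite /qcomm raddfB /= !linearZ /= !rmorphM. Qed.

Lemma alt_Delta_morph q rho (W : int -> A) (G Gt : nat -> A) n :
  f (alt_Delta q rho W G Gt n) = alt_Delta q rho (f \o W) (f \o G) (f \o Gt) n.
Proof.
apply: alt_Delta_fun; [exact: raddfD|exact: raddfB|exact: rmorphM|exact: linearZZ|exact: raddf0].
Qed.

End RelMorphism.

(** * The two presentations *)

Section Serre.
Variables (K : fieldType) (q : K).
Hypotheses (q0 : q != 0) (qnu : forall n, (0 < n)%N -> q ^+ n != 1).
Variable A : algType K.

Let th0 : q + q^-1 != 0.
Proof. by have := @qpow_add_neq0 K q q0 qnu 1 isT; rewrite expr1. Qed.

Definition serre_word (a b : A) : A := comm a (qcomm q^-1 a (qcomm q a b)).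

Lemma serre_relE (E : 'I_2 -> A) u v :
  (forall i j, i != j -> serre_word (E i) (E j) = 0) -> serre_rel q E u v -> u = v.
Proof. by move=> H; case=> i j ij; exact: H. Qed.

(** Expanding E_delta turns x_1 x_0 - q^2 x_0 x_1 into a multiple of the Serre word of E_1, and the
    relation of the y_k into that of E_0. *)
Lemma serre_root_system (E0 E1 : A) :
  serre_word E0 E1 = 0 -> serre_word E1 E0 = 0 ->
  root_system q (root_alpha1 q E0 E1) (root_alpha0 q E0 E1).
Proof.
have hE : h0 q (root_alpha1 q E0 E1) (root_alpha0 q E0 E1) = root_delta q E0 E1 by [].
move=> e0 e1; split=> [k|k||]; rewrite ?hE.
- by rewrite /= scalerA mulfV // scale1r.
- by rewrite /= scalerA mulfV // scale1r.
- rewrite /= /comm /root_delta; apply: (scalerI th0).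
  apply: (nc_from (congr1 ( *:%R (-1)) e1)); rewrite /serre_word /comm /qcomm.
  by move: (q + q^-1) th0 => t t0; nc_coefs K; field; rewrite ?q0 ?t0 ?oner_neq0.
rewrite /= /comm /root_delta; apply: (scalerI th0).
apply: (nc_from e0); rewrite /serre_word /comm /qcomm.
by move: (q + q^-1) th0 => t t0; nc_coefs K; field; rewrite ?q0 ?t0 ?oner_neq0.
Qed.

(** The three commutators in the Serre word commute as operators, so it is [op1 (op2 [W0, W1])].
    Here [op2 Gt] = -rho W' and [op1 G] = rho W', and [op1 + op2] is (q + q^-1) [W0, .], which
    vanishes at W'. *)
Lemma serre_exchange (rho c : K) (W0 W1 G Gt W' : A) :
  comm W0 W1 = c *: (Gt - G) -> qcomm q W0 G = rho *: W' ->
  qcomm q Gt W0 = rho *: W' -> comm W0 W' = 0 -> serre_word W0 W1 = 0.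
Proof.
move=> eW eG eGt eW'.
pose op1 (u : A) := q *: (W0 * u) - q^-1 *: (u * W0).
pose op2 (u : A) := q^-1 *: (W0 * u) - q *: (u * W0).
have o1 : op1 0 = 0 by rewrite /op1 mulr0 mul0r !scaler0 subrr.
have o2 : op2 0 = 0 by rewrite /op2 mulr0 mul0r !scaler0 subrr.
apply: (@nc_lin _ _ _ (op1 (op2 (comm W0 W1 - c *: (Gt - G)))
  - c *: (op1 (qcomm q Gt W0 - rho *: W') + op2 (qcomm q W0 G - rho *: W'))
  - (c * rho * (q + q^-1)) *: comm W0 W')).
  by rewrite eW eG eGt eW' !subrr o2 o1 addr0 !scaler0 !subr0.
by rewrite /serre_word /op1 /op2 /comm /qcomm; nc_coefs K; field; rewrite ?q0 ?oner_neq0.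
Qed.

Lemma serre_scale (s t : K) (a b : A) :
  serre_word a b = 0 -> serre_word (s *: a) (t *: b) = 0.
Proof.
move=> e; apply: (nc_from (congr1 ( *:%R (s ^+ 3 * t)) e)).
by rewrite /serre_word /comm /qcomm; nc_coefs K; field; rewrite ?q0 ?oner_neq0.
Qed.

End Serre.

(** Beyond its leading term, Delta_{n+1} only sees generators that the recursion on [n] has already
    reached. *)
Lemma alt_Delta_congr (K : fieldType) (q rho : K) (A : algType K)
    (W W' : int -> A) (G G' Gt Gt' : nat -> A) n :
  (forall k, (k <= n)%N ->
    W (- k%:Z) = W' (- k%:Z) /\ W (k%:Z + 1) = W' (k%:Z + 1)) ->
  (forall k, (k < n)%N -> G k = G' k /\ Gt k = Gt' k) ->
  alt_Delta q rho W G Gt n - (G n + Gt n) =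
  alt_Delta q rho W' G' Gt' n - (G' n + Gt' n).
Proof.
have key (u v w : A) : u - v + w - u = - v + w by nc_coefs K; ring.
move=> eW eG; rewrite /alt_Delta !key.
congr (- (_ *: _) + _ *: _); apply: eq_bigr => k _.
  have kn : (k <= n)%N by rewrite -ltnS.
  have -> : n%:Z + 1 - k%:Z = (n - k)%N%:Z + 1 by lia.
  have -> : k%:Z - n%:Z = - (n - k)%N%:Z by lia.
  have [-> ->] := eW _ kn; have [-> ->] // := eW (n - k)%N (leq_subr _ _).
have [-> ->] := eG k (ltn_ord k).
by have [|-> ->] // := eG (n - k.+1)%N; rewrite ltn_subrL /=; case: (n) k => [[]|].
Qed.

Section Alternating.
Variables (K : fieldType) (q rho : K).
Hypotheses (q0 : q != 0) (qnu : forall n, (0 < n)%N -> q ^+ n != 1).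
Hypothesis charK : [pchar K] =i pred0.
Hypothesis rho0 : rho != 0.
Local Notation th := (q + q^-1).

Let th0 : th != 0.
Proof. by have := @qpow_add_neq0 K q q0 qnu 1 isT; rewrite expr1. Qed.

Section AlternatingAlgebra.
Variables (A : algType K) (W : int -> A) (G Gt : nat -> A).
Hypothesis alt : forall x y, alt_rel q rho W G Gt x y -> x = y.

Lemma alt_serre01 : serre_word q (W 0) (W 1) = 0.
Proof.
apply: (serre_exchange q0 (alt (alt_rel_W0W _ _ _ _ _ 0))
  (alt (alt_rel_W0G _ _ _ _ _ 0)) (alt (alt_rel_GtW0 _ _ _ _ _ 0))).
exact: (alt (alt_rel_WmWm _ _ _ _ _ 0 1)).
Qed.

Lemma alt_serre10 : serre_word q (W 1) (W 0) = 0.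
Proof.
apply: (serre_exchange (c := th^-1) q0 _ (alt (alt_rel_W1Gt _ _ _ _ _ 0))
  (alt (alt_rel_GW1 _ _ _ _ _ 0))); last exact: (alt (alt_rel_WpWp _ _ _ _ _ 0 1)).
have /(congr1 -%R) := alt (alt_rel_W0W _ _ _ _ _ 0).
by rewrite /comm -scalerN !opprB.
Qed.

(* The generators are determined by W_0 and W_1: inductively, G_{n+1} and       *)
(* \tilde G_{n+1} are found from their difference and, by Delta_{n+1} = 0,      *)
(* from their sum.                                                             *)
Lemma alt_endo_fix (f : {lrmorphism A -> A}) : f (W 0) = W 0 -> f (W 1) = W 1 ->
  (forall i, f (W i) = W i) /\ (forall k, f (G k) = G k /\ f (Gt k) = Gt k).
Proof.
move=> f0 f1.
have two : (2%:R : K) != 0 by have /pcharf0P -> := charK.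
pose P n := (forall k, (k <= n)%N ->
    f (W (- k%:Z)) = W (- k%:Z) /\ f (W (k%:Z + 1)) = W (k%:Z + 1)) /\
  (forall k, (k < n)%N -> f (G k) = G k /\ f (Gt k) = Gt k).
have H n : P n.
  elim: n => [|n [IHW IHG]].
    by split=> // k; rewrite leqn0 => /eqP ->.
  have fD : f (Gt n - G n) = Gt n - G n.
    have e : Gt n - G n = th *: comm (W 0) (W (n%:Z + 1)).
      by rewrite (alt (alt_rel_W0W _ _ _ _ _ n)) scalerA mulfV // scale1r.
    by rewrite e linearZ /= lrmorph_comm f0 (IHW n (leqnn n)).2.
  have fS : f (G n + Gt n) = G n + Gt n.
    have := @alt_Delta_congr K q rho A (f \o W) W (f \o G) G (f \o Gt) Gt n IHW IHG.
    rewrite -alt_Delta_morph (alt (alt_rel_Delta _ _ _ _ _ n)) raddf0 !sub0r.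
    by move=> /oppr_inj e; rewrite raddfD.
  have [fG fGt] : f (G n) = G n /\ f (Gt n) = Gt n.
    have fGn : f (G n) = G n.
      apply: (scalerI two); rewrite -linearZ /=.
      have -> : 2%:R *: G n = G n + Gt n - (Gt n - G n) by nc_coefs K; ring.
      by rewrite raddfB /= fS fD.
    by split=> //; move: fS; rewrite raddfD /= fGn => /addrI.
  split=> k; last first.
    by rewrite ltnS leq_eqVlt => /orP[/eqP -> //|]; exact: IHG.
  rewrite leq_eqVlt ltnS => /orP[/eqP ->|]; last exact: IHW.
  split; apply: (scalerI rho0); rewrite -linearZ /=.
    rewrite (_ : - n.+1%:Z = - n%:Z - 1); last by lia.
    by rewrite -(alt (alt_rel_W0G _ _ _ _ _ n)) lrmorph_qcomm f0 fG.
  rewrite (_ : n.+1%:Z + 1 = n%:Z + 2); last by lia.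
  by rewrite -(alt (alt_rel_GW1 _ _ _ _ _ n)) lrmorph_qcomm f1 fG.
split=> [i|k]; last exact: ((H k.+1).2 k (ltnSn k)).
have [k [->|->]] : exists k, i = - k%:Z \/ i = k%:Z + 1.
  case: i => [[|k]|k]; first by exists 0%N; left.
    by exists k; right; lia.
  by exists k.+1; left; lia.
- exact: ((H k).1 k (leqnn k)).1.
- exact: ((H k).1 k (leqnn k)).2.
Qed.

End AlternatingAlgebra.

Lemma Aq_alt_rel x y :
  alt_rel q rho (AqW q rho) (AqG q rho) (AqGt q rho) x y -> x = y.
Proof.
move=> /(@alt_rel_morph_lift K _ _ (presented_pi (Aq_rel_augmented (q := q) (rho := rho)))).
by case=> u [v [/presented_rel uv <- <-]]; exact: uv.
Qed.

Lemma Aq_endo_id (f : {lrmorphism Aq q rho -> Aq q rho}) :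
  f (AqW q rho 0) = AqW q rho 0 -> f (AqW q rho 1) = AqW q rho 1 -> f =1 id.
Proof.
move=> f0 f1; have [fW fG] := alt_endo_fix Aq_alt_rel f0 f1.
apply: (@presented_eq _ _ _ _ _ f idfun) => -[i|[k|k]].
- exact: fW.
- exact: (fG k).1.
- exact: (fG k).2.
Qed.

End Alternating.

(** * The images of the generators as coefficients of the stated series *)

Section Images.
Variables (K : fieldType) (q kp km : K).
Hypotheses (q0 : q != 0) (qnu : forall n, (0 < n)%N -> q ^+ n != 1).
Hypothesis charK : [pchar K] =i pred0.
Hypotheses (kp0 : kp != 0) (km0 : km != 0).
Variables (A : algType K) (E0 E1 : A).
Hypotheses (serre01 : serre_word q E0 E1 = 0) (serre10 : serre_word q E1 E0 = 0).
Variable Ed : nat -> A.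
Hypothesis EdP : imaginary_root_vectors q E0 E1 Ed.
Local Notation kap := (q - q^-1).
Local Notation th := (q + q^-1).
Local Notation rho := (kp * km * th ^+ 2).
Local Notation x := (root_alpha1 q E0 E1).
Local Notation y := (root_alpha0 q E0 E1).

Let kap0 : kap != 0.
Proof. by have := @qpow_sub_neq0 K q q0 qnu 1 isT; rewrite expr1. Qed.
Let th0 : th != 0.
Proof. by have := @qpow_add_neq0 K q q0 qnu 1 isT; rewrite expr1. Qed.

Let rs : root_system q x y.
Proof. exact: serre_root_system. Qed.

Definition logPsi : fps A := ser_shift (fun k => kap *: Ed k).
Let F0 : logPsi 0%N = 0. Proof. by []. Qed.
Lemma exp_logPsi : ser_exp logPsi = psi q x y.
Proof.
apply/funext => n; rewrite EdP /ser_one; case: n => [|n] /=; first by rewrite addr0.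
by rewrite add0r.
Qed.

Local Notation a := (serA q x logPsi).
Local Notation b := (serB q y logPsi).
Local Notation g := (serG q x y logPsi).
Local Notation X := (seriesX q logPsi).
Local Notation Y := (seriesY q logPsi).

Definition imgW : int -> A := altW q kp km a b.
Definition imgG : nat -> A := altG q kp km X.
Definition imgGt : nat -> A := altGt q kp km g.

Lemma img_rel u v : alt_rel q rho imgW imgG imgGt u v -> u = v.
Proof.
apply: alt_relE => //; first exact: (root_alternating_core q0 qnu charK rs F0 exp_logPsi).
exact: (root_delta_rel q0 qnu charK rs F0 exp_logPsi).
Qed.

Lemma imgW0 : imgW 0 = (- km * q) *: E1.
Proof. by rewrite /imgW /= serA0. Qed.

Lemma imgW1 : imgW 1 = (kp * q ^- 2) *: E0.
Proof. by rewrite /imgW /= serB0 // expr0 invr1 mulr1. Qed.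

Let X' := ser_exp (ser_rescale q (ser_shift (fun k =>
    (- (q - q^-1) * (q ^+ k.+1 + q ^- k.+1)^-1) *: Ed k))).
Let Y' := ser_exp (ser_rescale q (ser_shift (fun k =>
    ((q - q^-1) * (q ^+ (2 * k.+1) / (q ^+ k.+1 + q ^- k.+1))) *: Ed k))).

Lemma X'E : X' = dilate q^-1 X.
Proof.
rewrite /X' ser_rescaleE dilate_exp; congr (dilate _ (ser_exp _)).
apply/funext => -[|n]; rewrite /logX /logPsi /= ?scaler0 // scalerA.
by congr (_ *: _); rewrite !mulNr mulrC.
Qed.

Lemma Y'E : Y' = dilate q^-1 Y.
Proof.
rewrite /Y' ser_rescaleE dilate_exp; congr (dilate _ (ser_exp _)).
by apply/funext => -[|n]; rewrite /logY /logPsi /= ?scaler0 // scalerA mulrC.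
Qed.

Let c := q / th.
Let cS n : c ^- n.+1 = q ^- n.+1 * th ^+ n.+1.
Proof. by rewrite /c exprMn exprVn invfM invrK. Qed.

Lemma img_W_plus n : ser_rescale c (ser_shift (fun k => imgW (- k%:Z))) n =
  (- km * q * th) *:
    ser_mul X' (ser_rescale q (ser_shift (fun k => q ^+ k *: x k))) n.
Proof.
have e : ser_mul X' (ser_rescale q (ser_shift (fun k => q ^+ k *: x k))) =
    dilate q^-1 (fpsX A * a).
  rewrite X'E ser_rescaleE ser_shiftE -[LHS]/(dilate q^-1 X * dilate q^-1 _) -dilateM.
  congr (dilate _ _); rewrite mulrA fpsX_comm -mulrA; congr (_ * (_ * _)).
rewrite e /ser_rescale /dilate fpsXM; case: n => [|n]; first by rewrite /= !scaler0.
rewrite /= /imgW altW_neg !scalerA cS exprVn; congr (_ *: _).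
rewrite (exprS th n); move: (th ^+ n) (expf_neq0 n th0) (q ^- n.+1) => u u0 v.
by field; rewrite ?q0 ?u0.
Qed.

Lemma img_W_minus n : ser_rescale c (ser_shift (fun k => imgW (k%:Z + 1))) n =
  (kp * q^-1 * th) *:
    ser_mul (ser_rescale q (ser_shift (fun k => q ^ (k%:Z - 1) *: y k))) X' n.
Proof.
have e : ser_mul (ser_rescale q (ser_shift (fun k => q ^ (k%:Z - 1) *: y k))) X' =
    q^-1 *: dilate q^-1 (fpsX A * b).
  rewrite X'E ser_rescaleE ser_shiftE -[LHS]/(dilate q^-1 _ * dilate q^-1 X) -dilateM.
  rewrite -dilateZ; congr (dilate _ _).
  have -> : (fun k => q ^ (k%:Z - 1) *: y k) = q^-1 *: serEta q y.
    apply/funext => k; rewrite fpsZ /serEta /current add0n scalerA expfzDr //.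
    by rewrite mulrC exprnP.
  by rewrite -!scalerAr -!scalerAl mulrA.
rewrite e /ser_rescale fpsZ /dilate fpsXM; case: n => [|n]; first by rewrite /= !scaler0.
have -> : ser_shift (fun k => imgW (k%:Z + 1)) n.+1 = (kp * q ^- 2 * th ^- n) *: b n.
  exact: altW_pos.
rewrite /= !scalerA cS exprVn; congr (_ *: _).
rewrite (exprS th n); move: (th ^+ n) (expf_neq0 n th0) (q ^- n.+1) => u u0 v.
by field; rewrite ?q0 ?u0.
Qed.

Lemma img_G_plus n : ser_rescale c (ser_shift imgG) n =
  (rho / kap) *: (X' n - ser_one A n).
Proof.
rewrite X'E /ser_rescale; case: n => [|n] /=.
  by rewrite /dilate expr0 scale1r seriesX0 // subrr !scaler0.
rewrite /ser_one subr0 /dilate /imgG /altG !scalerA cS exprVn; congr (_ *: _).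
move: (th ^+ n.+1) (expf_neq0 n.+1 th0) (q ^- n.+1) => u u0 v.
have qm : q * q - 1 != 0 by rewrite subr_eq0 -expr2 qnu.
by field; rewrite ?q0 ?u0 ?qm.
Qed.

Lemma img_G_minus n : ser_rescale c (ser_shift imgGt) n =
  (rho / kap) *: (Y' n - ser_one A n)
  - (rho * kap) *: \sum_(k < n) \sum_(l < n | (k + l < n)%N)
      (q ^+ (k + l) * q ^- (k + l).+1) *: (y k * X' (n - (k + l).+1)%N * x l).
Proof.
rewrite Y'E /ser_rescale; case: n => [|n] /=.
  rewrite big_ord0 /dilate expr0 scale1r /seriesY ser_exp0 ?subrr ?scaler0 ?subr0 //.
  by rewrite /logY scaler0.
have gE : g n.+1 = Y n.+1 - kap ^+ 2 *: (b * serXi q x) n.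
  by rewrite /serG !fpsE fpsXM.
have -> : \sum_(k < n.+1) \sum_(l < n.+1 | (k + l < n.+1)%N)
      (q ^+ (k + l) * q ^- (k + l).+1) *: (y k * X' (n.+1 - (k + l).+1)%N * x l) =
    q ^- n.+1 *: (b * serXi q x) n.
  rewrite /serB -mulrA fpsM scaler_sumr; apply: eq_bigr => k _.
  have kn : (k <= n)%N by rewrite -ltnS.
  (* For fixed k the condition k + l < n + 1 is shortened to a range of l, which is then reversed to
     match the convolution of X with the x-current. *)
  rewrite (eq_bigl (fun l : 'I_n.+1 => (l < (n - k).+1)%N)); last by move=> l /=; lia.
  rewrite -(big_ord_widen n.+1 (fun l => (q ^+ (k + l) * q ^- (k + l).+1) *:
      (y k * X' (n.+1 - (k + l).+1)%N * x l))); last by lia.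
  rewrite fpsM (reindex_inj rev_ord_inj) /= mulr_sumr scaler_sumr.
  apply: eq_bigr => l _; have lk : (l <= n - k)%N by rewrite -ltnS.
  rewrite subSS subSS; set j := (n - k - l)%N.
  have -> : (n - (k + j) = l)%N by rewrite /j; lia.
  have -> : q ^- n.+1 = q ^- (k + j).+1 * q ^- l.
    by rewrite -invfM -exprD; congr (q ^- _); rewrite /j; lia.
  rewrite X'E /dilate /serEta /serXi /current !add0n exprVn exprD.
  by move: (q ^- (k + j).+1) (q ^- l) => u v; nc_coefs K; ring.
rewrite /ser_one subr0 /dilate /imgGt /altGt gE cS exprVn.
move: (th ^+ n.+1) (expf_neq0 n.+1 th0) (q ^- n.+1) => u u0 v.
have qm : q * q - 1 != 0 by rewrite subr_eq0 -expr2 qnu.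
by nc_coefs K; field; rewrite ?q0 ?u0 ?qm.
Qed.

End Images.

(** * The map and its inverse *)

Section Isomorphism.
Variables (K : fieldType) (q kp km : K).
Hypotheses (q0 : q != 0) (qnu : forall n, (0 < n)%N -> q ^+ n != 1).
Hypothesis charK : [pchar K] =i pred0.
Hypotheses (kp0 : kp != 0) (km0 : km != 0).
Local Notation th := (q + q^-1).
Local Notation rho := (kp * km * th ^+ 2).
Local Notation E0 := (UplusE q ord0).
Local Notation E1 := (UplusE q ord_max).
Variable Ed : nat -> Uplus q.
Hypothesis EdP : imaginary_root_vectors q E0 E1 Ed.

Let rho0 : rho != 0.
Proof.
apply: mulf_neq0; first exact: mulf_neq0.
by apply: expf_neq0; have := @qpow_add_neq0 K q q0 qnu 1 isT; rewrite expr1.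
Qed.

Lemma Uplus_serre (i j : 'I_2) : i != j -> serre_word q (UplusE q i) (UplusE q j) = 0.
Proof.
move=> ij; pose p : {lrmorphism _ -> _} := presented_pi (@Uplus_rel_augmented K q).
have := presented_rel (@Uplus_rel_augmented K q) (serre_rel_intro q _ ij).
by rewrite -/p; rewrite (lrmorph_comm p) !(lrmorph_qcomm p) raddf0.
Qed.

Let serre01 : serre_word q E0 E1 = 0. Proof. exact: Uplus_serre. Qed.
Let serre10 : serre_word q E1 E0 = 0. Proof. exact: Uplus_serre. Qed.

Local Notation iW := (imgW q kp km E0 E1 Ed).
Local Notation iG := (imgG q kp km Ed).
Local Notation iGt := (imgGt q kp km E0 E1 Ed).

Definition img (i : alt_index) : Uplus q :=
  match i with inl i => iW i | inr (inl k) => iG k | inr (inr k) => iGt k end.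

Lemma alt_img_rel u v : Aq_rel q rho u v -> free_eval img u = free_eval img v.
Proof.
move=> /(alt_rel_morph (free_eval img)).
rewrite (_ : _ \o _ = iW); last by apply/funext => i /=; rewrite free_eval_gen.
rewrite (_ : _ \o _ = iG); last by apply/funext => i /=; rewrite free_eval_gen.
rewrite (_ : _ \o _ = iGt); last by apply/funext => i /=; rewrite free_eval_gen.
exact: img_rel.
Qed.

Definition iota_morph : {lrmorphism Aq q rho -> Uplus q} :=
  lift_morphism (Aq_rel_augmented (q := q) (rho := rho)) alt_img_rel.

(** The scalars invert those of [imgW1] and [imgW0]; E_0 corresponds to W_1 and E_1 to W_0. *)
Definition gen_img (i : 'I_2) : Aq q rho :=
  if i == ord0 then (kp * q ^- 2)^-1 *: AqW q rho 1 else (- km * q)^-1 *: AqW q rho 0.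

Lemma gen_img_rel u v : Uplus_rel q u v -> free_eval gen_img u = free_eval gen_img v.
Proof.
move=> /(serre_rel_morph (free_eval gen_img)).
rewrite (_ : _ \o _ = gen_img); last by apply/funext => i /=; rewrite free_eval_gen.
apply: serre_relE => i j ij; have alt := @Aq_alt_rel K q rho; rewrite /gen_img.
case: (eqVneq i ord0) (eqVneq j ord0) => [i0|i0] [j0|j0].
- by rewrite i0 j0 eqxx in ij.
- exact: (serre_scale q0 (kp * q ^- 2)^-1 (- km * q)^-1 (alt_serre10 q0 alt)).
- exact: (serre_scale q0 (- km * q)^-1 (kp * q ^- 2)^-1 (alt_serre01 q0 alt)).
- by case: i j i0 j0 ij => [[|[|]]] //= ? [[|[|]]].
Qed.

Definition jota_morph : {lrmorphism Uplus q -> Aq q rho} :=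
  lift_morphism (@Uplus_rel_augmented K q) gen_img_rel.

Lemma iota_gen i : iota_morph (presented_gen _ i) = img i.
Proof. exact: lift_gen. Qed.

Lemma jota_gen i : jota_morph (UplusE q i) = gen_img i.
Proof. exact: lift_gen. Qed.

(** On [Uplus] the composite is checked on E_0 and E_1; on [Aq] it suffices by [Aq_endo_id] that it
    fixes W_0 and W_1. *)
Lemma iota_bijective : bijective iota_morph.
Proof.
have iW0 : iota_morph (AqW q rho 0) = (- km * q) *: E1.
  by apply: etrans (iota_gen _) _; exact: imgW0.
have iW1 : iota_morph (AqW q rho 1) = (kp * q ^- 2) *: E0.
  by apply: etrans (iota_gen _) _; exact: imgW1.
have c0 : - km * q != 0 by rewrite mulf_neq0 ?oppr_eq0.
have c1 : kp * q ^- 2 != 0 by rewrite mulf_neq0 // invr_eq0 expf_neq0.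
exists jota_morph.
  apply: (@Aq_endo_id K q rho q0 qnu charK rho0 (jota_morph \o iota_morph)) => /=.
    by rewrite iW0 linearZ /= jota_gen /gen_img /= scalerA mulfV // scale1r.
  by rewrite iW1 linearZ /= jota_gen /gen_img /= scalerA mulfV // scale1r.
apply: (@presented_eq _ _ _ _ _ (iota_morph \o jota_morph) idfun) => i /=.
rewrite -/(UplusE q i) jota_gen /gen_img; case: eqP => [->|/eqP i0].
  by rewrite linearZ /= iW1 scalerA mulVf // scale1r.
rewrite linearZ /= iW0 scalerA mulVf // scale1r.
by congr (UplusE q _); apply/val_inj; case: i i0 => [[|[|]]].
Qed.

Lemma alternating_isomorphism :
  let W_plus := ser_rescale (q / th) (ser_shift (fun k => AqW q rho (- k%:Z))) in
  let W_minus := ser_rescale (q / th) (ser_shift (fun k => AqW q rho (k%:Z + 1))) in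
  let G_plus := ser_rescale (q / th) (ser_shift (fun k => AqG q rho k)) in
  let G_minus := ser_rescale (q / th) (ser_shift (fun k => AqGt q rho k)) in
  let Ea0 := root_alpha0 q E0 E1 in
  let Ea1 := root_alpha1 q E0 E1 in
  let X := ser_exp (ser_rescale q (ser_shift (fun k =>
    (- (q - q^-1) * (q ^+ k.+1 + q ^- k.+1)^-1) *: Ed k))) in
  let Y := ser_exp (ser_rescale q (ser_shift (fun k =>
    ((q - q^-1) * (q ^+ (2 * k.+1) / (q ^+ k.+1 + q ^- k.+1))) *: Ed k))) in
  exists2 iota : {lrmorphism Aq q rho -> Uplus q},
    bijective iota &
    forall n : nat,
    [/\ iota (W_plus n) =
          (- km * q * (q + q^-1)) *:
            ser_mul X (ser_rescale q (ser_shift (fun k => q ^+ k *: Ea1 k))) n,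
        iota (W_minus n) =
          (kp * q^-1 * (q + q^-1)) *:
            ser_mul (ser_rescale q (ser_shift (fun k =>
              q ^ (k%:Z - 1) *: Ea0 k))) X n,
        iota (G_plus n) =
          (rho / (q - q^-1)) *: (X n - ser_one (Uplus q) n) &
        iota (G_minus n) =
          (rho / (q - q^-1)) *: (Y n - ser_one (Uplus q) n)
          - (rho * (q - q^-1)) *:
              \sum_(k < n) \sum_(l < n | (k + l < n)%N)
                (q ^+ (k + l) * q ^- (k + l).+1) *:
                  (Ea0 k * X (n - (k + l).+1)%N * Ea1 l)].
Proof.
move=> Wp Wm Gp Gm Ea0 Ea1 X Y; exists iota_morph; first exact: iota_bijective.
have iS (f : nat -> Aq q rho) (f' : nat -> Uplus q) n :
    (forall k, iota_morph (f k) = f' k) ->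
    iota_morph (ser_rescale (q / th) (ser_shift f) n) =
    ser_rescale (q / th) (ser_shift f') n.
  move=> ff; rewrite /ser_rescale linearZ /=; congr (_ *: _).
  by case: n => [|n] /=; [exact: raddf0|exact: ff].
move=> n; split.
- rewrite (iS _ (fun k => iW (- k%:Z))); last by move=> k; exact: iota_gen.
  exact: img_W_plus.
- rewrite (iS _ (fun k => iW (k%:Z + 1))); last by move=> k; exact: iota_gen.
  exact: img_W_minus.
- rewrite (iS _ iG); last by move=> k; exact: iota_gen.
  exact: img_G_plus.
rewrite (iS _ iGt); last by move=> k; exact: iota_gen.
exact: img_G_minus.
Qed.

End Isomorphism.

(** * The ground field C(q): characteristic zero, q not a root of unity *)

Section QVar.
Variable R : realType.

Lemma Cq_pchar0 : [pchar Cq R] =i pred0.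
Proof.
apply/pcharf0P => n.
have -> : (n%:R : Cq R) = tofrac (n%:R%:P) by rewrite polyCMn polyC1 rmorph_nat.
by rewrite tofrac_eq0 polyC_eq0 Num.Theory.pnatr_eq0.
Qed.

Lemma qvar_neq0 : qvar R != 0.
Proof. by rewrite /qvar tofrac_eq0 polyX_eq0. Qed.

Lemma qvar_expr_neq1 n : (0 < n)%N -> qvar R ^+ n != 1.
Proof.
case: n => // n _; rewrite /qvar -rmorphXn -[1](rmorph1 (@tofrac _)) tofrac_eq.
by apply/eqP => /(congr1 (fun p : {poly R[i]} => size p)); rewrite size_polyXn size_poly1.
Qed.

End QVar.

(* Every formal series below is a power series in t = u^-2: its value at n is  *)
(* the coefficient of u^(-2n). Since U = qu^2/(q+q^-1), ser_rescale by         *)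
(* q/(q+q^-1) turns a series in U^-1 into one in t, and ser_rescale by q does  *)
(* the same for a series in (qu^2)^-1.                                         *)
Theorem proposition5p27 (R : realType) (kp km : Cq R) :
  kp != 0 -> km != 0 ->
  let q := qvar R in
  let rho := kp * km * (q + q^-1) ^+ 2 in
  let W_plus := ser_rescale (q / (q + q^-1))
    (ser_shift (fun k => AqW q rho (- k%:Z))) in
  let W_minus := ser_rescale (q / (q + q^-1))
    (ser_shift (fun k => AqW q rho (k%:Z + 1))) in
  let G_plus := ser_rescale (q / (q + q^-1))
    (ser_shift (fun k => AqG q rho k)) in
  let G_minus := ser_rescale (q / (q + q^-1))
    (ser_shift (fun k => AqGt q rho k)) in
  let E0 := UplusE q ord0 in
  let E1 := UplusE q ord_max in
  let Ea0 := root_alpha0 q E0 E1 in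
  let Ea1 := root_alpha1 q E0 E1 in
  forall Ed : nat -> Uplus q, imaginary_root_vectors q E0 E1 Ed ->
  let X := ser_exp (ser_rescale q (ser_shift (fun k =>
    (- (q - q^-1) * (q ^+ k.+1 + q ^- k.+1)^-1) *: Ed k))) in
  let Y := ser_exp (ser_rescale q (ser_shift (fun k =>
    ((q - q^-1) * (q ^+ (2 * k.+1) / (q ^+ k.+1 + q ^- k.+1))) *: Ed k))) in
  exists2 iota : {lrmorphism Aq q rho -> Uplus q},
    bijective iota &
    forall n : nat,
    [/\ iota (W_plus n) =
          (- km * q * (q + q^-1)) *:
            ser_mul X (ser_rescale q (ser_shift (fun k => q ^+ k *: Ea1 k))) n,
        iota (W_minus n) =
          (kp * q^-1 * (q + q^-1)) *:
            ser_mul (ser_rescale q (ser_shift (fun k =>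
              q ^ (k%:Z - 1) *: Ea0 k))) X n,
        iota (G_plus n) =
          (rho / (q - q^-1)) *: (X n - ser_one (Uplus q) n) &
        iota (G_minus n) =
          (rho / (q - q^-1)) *: (Y n - ser_one (Uplus q) n)
          - (rho * (q - q^-1)) *:
              \sum_(k < n) \sum_(l < n | (k + l < n)%N)
                (q ^+ (k + l) * q ^- (k + l).+1) *:
                  (Ea0 k * X (n - (k + l).+1)%N * Ea1 l)].
Proof.
move=> kp0 km0 q rho Wp Wm Gp Gm E0 E1 Ea0 Ea1 Ed EdP.
exact: (alternating_isomorphism (@qvar_neq0 R) (@qvar_expr_neq1 R)
  (@Cq_pchar0 R) kp0 km0 EdP).
Qed.
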